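(* Let $F:\mathbb{R}^d\to\mathbb{R}$ be a $C^1$ function with locally Lipschitz continuous gradient $\nabla F$ and such that $F(x)\to+\infty$ as $\|x\|\to+\infty$. Let $S:\mathbb{R}^d\to\mathbb{R}_+^d$ be locally Lipschitz continuous, let $\varepsilon>0$, and let $\mathsf h,\mathsf r,\mathsf p,\mathsf q:(0,+\infty)\to\mathbb{R}_+$ be continuous functions satisfying: (i) $\mathsf h\in C^1((0,+\infty),\mathbb{R}_+)$, $\dot{\mathsf h}(t)\le 0$ on $(0,+\infty)$, and $h_\infty:=\lim_{t\to\infty}\mathsf h(t)$ is positive; (ii) $\mathsf r$ and $\mathsf q$ are non-increasing, and $r_\infty:=\lim_{t\to\infty}\mathsf r(t)$, $q_\infty:=\lim_{t\to\infty}\mathsf q(t)$ are positive; (iii) $\mathsf p(t)$ converges to some $p_\infty$ as $t\to\infty$; (iv) for all $t\in(0,+\infty)$, $\mathsf r(t)\ge \mathsf q(t)/4$, and $r_\infty>q_\infty/4$. Let $z_0\in\mathcal Z_+$ and $t_0>0$. Then there exists a unique global solution $\mathsf z:[t_0,+\infty)\to\mathcal Z_+$ of the ODE (E) given in the context, with initial condition $\mathsf z(t_0)=z_0$. Moreover $\mathsf z([t_0,+\infty))$ is a bounded subset of $\mathcal Z_+$, and, as $t\to+\infty$, $\mathsf z(t)$ converges towards the set $$\Upsilon:=\{(p_\infty S(x_\star)/q_\infty,\,0,\,x_\star)\,:\,x_\star\in\mathbb{R}^d,\ \nabla F(x_\star)=0\}.$$ If, additionally, the condition (A0) given in the context holds,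 then one can take $t_0=0$, that is: there exists a unique global solution $\mathsf z:[0,+\infty)\to\mathcal Z_+$ of the ODE (E) with initial condition $\mathsf z(0)=z_0$, the set $\mathsf z([0,+\infty))$ is a bounded subset of $\mathcal Z_+$, and, as $t\to+\infty$, $\mathsf z(t)$ converges towards the set $\Upsilon$.
   Context: $d\ge1$ is an integer, $\mathbb{R}_+=[0,\infty)$, $\mathcal Z_+:=\mathbb{R}_+^d\times\mathbb{R}^d\times\mathbb{R}^d$. Operations on vectors (quotient, square root, powers such as $x^{\odot 2}$, addition of a scalar) and inequalities between vectors are componentwise. Convergence of $\mathsf z(t)$ towards a set $A$ means $\operatorname{dist}(\mathsf z(t),A)=\inf_{a\in A}\|\mathsf z(t)-a\|\to0$. ODE (E), with $\mathsf z(t)=(\mathsf v(t),\mathsf m(t),\mathsf x(t))$: $$\dot{\mathsf v}(t)=\mathsf p(t)S(\mathsf x(t))-\mathsf q(t)\mathsf v(t),\qquad \dot{\mathsf m}(t)=\mathsf h(t)\nabla F(\mathsf x(t))-\mathsf r(t)\mathsf m(t),\qquad \dot{\mathsf x}(t)=-\mathsf m(t)/\sqrt{\mathsf v(t)+\varepsilon}.$$ When $t_0=0$, a solution with $\mathsf z(0)=z_0$ satisfies these equations for $t>0$. Condition (A0): either $\mathsf h,\mathsf r,\mathsf p,\mathsf q\in C^1([0,+\infty),\mathbb{R}_+)$, or all of the following hold: (a) for every $x\in\mathbb{R}^d$, $S(x)\ge\nabla F(x)^{\odot2}$; (b) the functions $\mathsf h/\mathsf p$, $\mathsf h/(\mathsf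 q-2\mathsf r)$, $t\mapsto t\mathsf h(t)$, $t\mapsto t\mathsf r(t)$, $t\mapsto t\mathsf p(t)$, $t\mapsto t\mathsf q(t)$ are bounded near zero; (c) there exists $t_1>0$ such that $2\mathsf r(t)-\mathsf q(t)>0$ for all $0<t<t_1$; (d) there exists $\delta>0$ such that $\mathsf h/\mathsf r,\ \mathsf p/\mathsf q\in C^1([0,\delta),\mathbb{R}_+)$ (after extension by their limits at $0$); (e) the initial condition $z_0=(v_0,m_0,x_0)\in\mathcal Z_+$ satisfies $m_0=\nabla F(x_0)\lim_{t\downarrow0}\mathsf h(t)/\mathsf r(t)$ and $v_0=S(x_0)\lim_{t\downarrow0}\mathsf p(t)/\mathsf q(t)$. *)

(* Defs.v *)
From mathcomp Require Import all_boot all_order all_algebra.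
From mathcomp Require Import all_classical all_reals all_analysis.
Set Implicit Arguments.
Unset Strict Implicit.
Unset Printing Implicit Defensive.
Import Order.TTheory GRing.Theory Num.Theory.
Import numFieldNormedType.Exports.
Local Open Scope classical_set_scope.
Local Open Scope ring_scope.

(* Vectors of R^d are row vectors 'rV[R]_d, normed by MathComp-Analysis with
   the sup norm. Every use of the norm below (coercivity, local Lipschitz
   continuity, boundedness, convergence of a distance to 0) is invariant under
   passing to an equivalent norm, in particular to the Euclidean one. *)

Section calculus.
Context {R : realType}.

Definition gradient (d : nat) (F : 'rV[R]_d -> R) (x : 'rV[R]_d) : 'rV[R]_d :=
  \row_i 'D_(delta_mx 0 i) F x.

Definition C1_function (d : nat) (F : 'rV[R]_d -> R) : Prop :=
  (forall x, differentiable F x) /\ continuous (gradient F).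

Definition locally_lipschitz (V W : normedModType R) (f : V -> W) : Prop :=
  forall x : V, exists2 U : set V, nbhs x U & [lipschitz f y | y in U].

Definition coercive_function (d : nat) (F : 'rV[R]_d -> R) : Prop :=
  forall A : R, exists M : R, forall x, M < `|x| -> A < F x.

(* f is differentiable at t relatively to I, with derivative l: this is the
   usual derivative at an interior point of I, the right derivative at a left
   endpoint of I. *)
Definition has_derivative_in (V : normedModType R) (I : set R) (f : R -> V)
    (t : R) (l : V) : Prop :=
  (s - t)^-1 *: (f s - f t) @[s --> within I t^'] --> l.

(* f is only meaningful on the positive reals; it belongs to C^1(I, R_+), for
   an interval I with left endpoint 0 included, when it has an extension g at 0
   which does. The value f 0 is irrelevant. *)
Definition extends_C1_nneg (I : set R) (f : R -> R) : Prop :=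
  exists g dg : R -> R,
    [/\ forall t, I t -> 0 < t -> g t = f t,
        forall t, I t -> 0 <= g t,
        forall t, I t -> has_derivative_in I g t (dg t)
      & {within I, continuous dg}].

(* The ratio f / g is bounded near 0; since division by 0 yields 0 here, that
   the quotient makes sense has to be required separately. *)
Definition ratio_bounded_near0 (f g : R -> R) : Prop :=
  (\forall t \near 0^'+, g t != 0) /\
  bounded_near (fun t => f t / g t) (0^'+ : set_system R).

(* In \bar R, so that the distance to the empty set is +oo. *)
Definition set_dist (V : normedModType R) (A : set V) (z : V) : \bar R :=
  ereal_inf [set (`|z - a|)%:E | a in A].

End calculus.

Section ode.
Context {R : realType} {d : nat}.

(* States z = (v, m, x). *)
Definition state : Type := ('rV[R]_d * 'rV[R]_d * 'rV[R]_d)%type.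

Definition Zplus : set state := [set z : state | forall i, 0 <= z.1.1 0 i].

Definition direction (eps : R) (v m : 'rV[R]_d) : 'rV[R]_d :=
  \row_i (- (m 0 i / Num.sqrt (v 0 i + eps))).

(* z solves the ODE on [t0, +oo[ with z t0 = z0 and stays in Z_+. The equations are
   imposed for all t >= t0 (with a right derivative at t0) when t0 > 0, and for
   all t > 0 when t0 = 0, in which case z is only continuous at 0. *)
Definition is_global_solution (F : 'rV[R]_d -> R) (S : 'rV[R]_d -> 'rV[R]_d)
    (eps : R) (h r p q : R -> R) (t0 : R) (z0 : state) (z : R -> state) : Prop :=
  [/\ z t0 = z0,
      forall t, t0 <= t -> Zplus (z t),
      {within `[t0, +oo[, continuous z}
    & forall t, t0 <= t -> 0 < t ->
      let: (v, m, x) := z t in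
      [/\ has_derivative_in `[t0, +oo[ (fun s => (z s).1.1) t
            (p t *: S x - q t *: v),
          has_derivative_in `[t0, +oo[ (fun s => (z s).1.2) t
            (h t *: gradient F x - r t *: m)
        & has_derivative_in `[t0, +oo[ (fun s => (z s).2) t
            (direction eps v m)]].

Definition Upsilon (F : 'rV[R]_d -> R) (S : 'rV[R]_d -> 'rV[R]_d)
    (pinf qinf : R) : set state :=
  [set ((pinf / qinf) *: S x, 0, x) | x in [set x | gradient F x = 0]].

Definition well_posed_and_convergent (F : 'rV[R]_d -> R)
    (S : 'rV[R]_d -> 'rV[R]_d) (eps : R) (h r p q : R -> R) (pinf qinf : R)
    (t0 : R) (z0 : state) : Prop :=
  exists z : R -> state,
    [/\ is_global_solution F S eps h r p q t0 z0 z,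
        forall z' : R -> state, is_global_solution F S eps h r p q t0 z0 z' ->
          forall t, t0 <= t -> z' t = z t,
        bounded_set (z @` `[t0, +oo[)
      & set_dist (Upsilon F S pinf qinf) (z t) @[t --> +oo] --> 0%E].

Definition condition_A0 (F : 'rV[R]_d -> R) (S : 'rV[R]_d -> 'rV[R]_d)
    (h r p q : R -> R) (z0 : state) : Prop :=
  [/\ extends_C1_nneg `[0, +oo[ h, extends_C1_nneg `[0, +oo[ r,
      extends_C1_nneg `[0, +oo[ p & extends_C1_nneg `[0, +oo[ q]
  \/
  [/\ forall x i, (gradient F x) 0 i ^+ 2 <= S x 0 i,
      [/\ ratio_bounded_near0 h p /\
          ratio_bounded_near0 h (fun t => q t - 2 * r t),
          bounded_near (fun t => t * h t) (0^'+ : set_system R),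
          bounded_near (fun t => t * r t) (0^'+ : set_system R),
          bounded_near (fun t => t * p t) (0^'+ : set_system R)
        & bounded_near (fun t => t * q t) (0^'+ : set_system R)],
      exists2 t1 : R, 0 < t1 & forall t : R, 0 < t < t1 -> 0 < 2 * r t - q t,
      exists2 delta : R, 0 < delta &
        extends_C1_nneg `[0, delta[ (fun t => h t / r t) /\
        extends_C1_nneg `[0, delta[ (fun t => p t / q t)
    & let: (v0, m0, x0) := z0 in
      m0 = lim (h t / r t @[t --> 0^'+]) *: gradient F x0 /\
      v0 = lim (p t / q t @[t --> 0^'+]) *: S x0].

End ode.
Arguments state : clear implicits.

(* Main.v *)
(* For t > 0 the energy h(t) (F(x) - min F) + sum_i m_i^2 / (2 sqrt(v_i + eps)) is
   nonincreasing, with dissipation at least (r - q/4) sum_i m_i^2 / sqrt(v_i + eps).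
   As h >= hinf > 0 and F is coercive, this bounds x, then v, then m, by constants
   depending only on the initial condition. Hence truncating the vector field far
   away does not change the solution, and Picard iteration for the truncated
   (globally Lipschitz) field yields a global solution.

   Convergence uses Barbalat-type arguments instead of a limiting autonomous flow:
   the dissipation is integrable and m is Lipschitz, so m -> 0; then m' is close to
   h grad F(x) with x slowly varying, so grad F(x) -> 0; then v follows the
   exponentially stable linear equation v' = p S(x) - q v with slowly varying
   forcing, so v - (pinf / qinf) S(x) -> 0. Compactness turns grad F(x) -> 0 into
   convergence to the set of critical points.

   At t0 = 0 the coefficients may blow up, but h / r and p / q stay bounded, and a
   solution of y' = k f - l y is controlled by sup (k / l) |f| alone. This gives a
   stability estimate uniform up to time 0, whence uniqueness, and makes the
   solutions started from z0 at times s -> 0 a Cauchy family, whose limit is the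
   solution from time 0. (A0) enters only through the bound on these
   ratios and to show that these solutions stay close to z0 at small times,
   uniformly in s. *)
Require Import Defs.
From mathcomp Require Import all_boot all_order all_algebra.
From mathcomp Require Import all_classical all_reals all_analysis.
From mathcomp Require Import ring lra.
Set Implicit Arguments.
Unset Strict Implicit.
Unset Printing Implicit Defensive.
Import Order.TTheory GRing.Theory Num.Theory.
Import numFieldNormedType.Exports.
Local Open Scope classical_set_scope.
Local Open Scope ring_scope.

(** * Real functions of one variable *)

(** The comparison principle for [y' = k f - l y] costs no integral of [k] or [l], but it brings no
    small factor either: smallness in time can only come from the equation for [x], which contains
    no coefficient. Stability is therefore proved on windows whose length depends on the ratio bound
    and on Lipschitz constants alone, and then iterated.

    The comparison between [r] and [q / 4] comes from the weight of the kinetic energy: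
    differentiating [1 / (2 sqrt(v + eps))] along [v' = p S - q v] produces at most [q / 4] times
    [m ^+ 2 / sqrt(v + eps)].

    Positivity of [v], its upper bound, the comparison principle and the convergence of [v] all rest
    on one scalar barrier argument, applied to a coordinate or to its opposite; with the sup norm,
    nothing is lost in passing between coordinates and vectors. *)

Lemma within_continuousP (R : realType) (V : normedModType R) (A : set R)
    (f : R -> V) :
  {within A, continuous f} <->
  forall t, A t -> forall e : R, 0 < e -> exists2 d : R, 0 < d &
    forall u, A u -> `|u - t| < d -> `|f u - f t| < e.
Proof.
split.
- move=> /subspace_continuousP cf t At e e0.
  have /cvgrPdist_lt/(_ e e0) := cf t At.
  move=> /nbhs_ballP[d /= d0 H]; exists d => // u Au ut.
  rewrite distrC; apply: H => //.
  by rewrite /ball/= distrC.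
- move=> H; apply/subspace_continuousP => t At.
  apply/cvgrPdist_lt => e e0; have [d d0 {}H] := H t At e e0.
  apply/nbhs_ballP; exists d => // u; rewrite /ball/= => tu Au.
  by rewrite distrC; apply: H => //; rewrite distrC.
Qed.

Section within_continuous_ops.
Context {R : realType} (A : set R).
Implicit Types f g : R -> R.

Lemma within_continuousD f g : {within A, continuous f} ->
  {within A, continuous g} -> {within A, continuous (fun u => f u + g u)}.
Proof. by move=> cf cg x; exact: (continuousD (cf x) (cg x)). Qed.

Lemma within_continuousM f g : {within A, continuous f} ->
  {within A, continuous g} -> {within A, continuous (fun u => f u * g u)}.
Proof. by move=> cf cg x; exact: (continuousM (cf x) (cg x)). Qed.

Lemma within_continuousN f : {within A, continuous f} ->
  {within A, continuous (fun u => - f u)}.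
Proof. by move=> cf x; exact: (continuousN (cf x)). Qed.

Lemma within_continuous_cst (c : R) : {within A, continuous (fun=> c)}.
Proof. by move=> x; exact: cst_continuous. Qed.

Lemma within_continuousB f g : {within A, continuous f} ->
  {within A, continuous g} -> {within A, continuous (fun u => f u - g u)}.
Proof. by move=> cf cg; apply: within_continuousD => //; exact: within_continuousN. Qed.

Lemma within_continuous_sum (I : Type) (r : seq I) (F : I -> R -> R) :
  (forall i, {within A, continuous (F i)}) ->
  {within A, continuous (fun u => \sum_(i <- r) F i u)}.
Proof.
move=> cF; elim: r => [|i r IH].
  by under eq_fun do rewrite big_nil; exact: within_continuous_cst.
by under eq_fun do rewrite big_cons; exact: within_continuousD.
Qed.

End within_continuous_ops.

Section realfun.
Context {R : realType}.
Implicit Types (f df y dy : R -> R) (a b s t A B k : R).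

Lemma is_derive_continuous (V : normedModType R) (f : R -> V) (l : V) t :
  is_derive t 1 f l -> {for t, continuous f}.
Proof. by case=> /derivable1_diffP + _; exact: differentiable_continuous. Qed.

(** Differentiability is asked in the open segment only, since a trajectory is merely known to be
    continuous at its starting time. *)
Lemma derive_le0_le f df s t : s <= t ->
  {within `[s, t], continuous f} ->
  (forall u, s < u < t -> is_derive u 1 f (df u)) ->
  (forall u, s < u < t -> df u <= 0) -> f t <= f s.
Proof.
rewrite le_eqVlt => /predU1P[->//|st] cf fdf df0.
have fdf' u : u \in `]s, t[ -> is_derive u 1 f (df u).
  by rewrite in_itv/=; exact: fdf.
have [c] := MVT st fdf' cf.
rewrite in_itv/= => cst E; rewrite -subr_le0 E.
by rewrite mulr_le0_ge0 ?df0// subr_ge0 ltW.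
Qed.

Lemma derive_bound f df M s t : s <= t ->
  {within `[s, t], continuous f} ->
  (forall u, s < u < t -> is_derive u 1 f (df u)) ->
  (forall u, s < u < t -> `|df u| <= M) -> `|f t - f s| <= M * (t - s).
Proof.
rewrite le_eqVlt => /predU1P[->|st] cf fdf dfM.
  by rewrite !subrr normr0 mulr0.
have fdf' u : u \in `]s, t[ -> is_derive u 1 f (df u).
  by rewrite in_itv/=; exact: fdf.
have [c] := MVT st fdf' cf.
rewrite in_itv/= => cst ->.
by rewrite normrM (gtr0_norm (_ : 0 < t - s)) ?subr_gt0// ler_pM2r ?subr_gt0 ?dfM.
Qed.

Lemma derive_ge_le f df c s t : s <= t ->
  {within `[s, t], continuous f} ->
  (forall u, s < u < t -> is_derive u 1 f (df u)) ->
  (forall u, s < u < t -> c <= df u) -> c * (t - s) <= f t - f s.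
Proof.
rewrite le_eqVlt => /predU1P[->|st] cf fdf dfM.
  by rewrite !subrr mulr0.
have fdf' u : u \in `]s, t[ -> is_derive u 1 f (df u).
  by rewrite in_itv/=; exact: fdf.
have [x] := MVT st fdf' cf.
rewrite in_itv/= => cst ->.
by rewrite ler_pM2r ?subr_gt0 ?dfM.
Qed.

(** Squaring removes the corner at 0: the difference quotient there is at most [|h|] in absolute
    value. *)
Lemma is_derive_posrt_sqr (x : R) :
  is_derive x 1 (fun z : R => Num.max z 0 ^+ 2) (2 * Num.max x 0).
Proof.
have [x0|x0|->] := ltgtP x 0.
- apply: (@near_eq_is_derive _ _ _ (cst 0)).
    near=> z; rewrite /= max_r ?expr0n// ltW//.
    by near: z; exact: lt_nbhsl.
  by rewrite mulr0; exact: is_derive_cst.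
- apply: (@near_eq_is_derive _ _ _ (fun z : R => z ^+ 2)).
    near=> z; rewrite /= max_l// ltW//.
    by near: z; exact: lt_nbhsr.
  by apply: is_derive_eq; rewrite /GRing.scale/= mulr1; ring.
- rewrite ?maxxx mulr0.
  have H : h^-1 *: (((fun z : R => Num.max z 0 ^+ 2) \o shift (0:R)) (h *: (1:R))
      - Num.max 0 0 ^+ 2) @[h --> (0:R)^'] --> (0:R).
    apply/cvgrPdist_le => e e0; near=> h.
    rewrite /= sub0r normrN addr0 maxxx expr0n subr0 /GRing.scale/= mulr1.
    have h0 : h != 0 by near: h; exact: nbhs_dnbhs_neq.
    have he : `|h| <= e by near: h; apply: dnbhs0_le.
    have [hp|hn] := leP 0 h.
      by rewrite expr2 mulrA mulVf// mul1r.
    by rewrite expr0n mulr0 normr0 ltW.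
  by apply: DeriveDef; [apply/cvg_ex; exists 0|exact: cvg_lim].
Unshelve. all: by end_near. Qed.

(* Applied to the squared positive part of [(y - A) e^(k u)], which is
   differentiable even where [y] crosses [A]. *)
Lemma posrt_exp_decay y dy A k s t : s <= t ->
  {within `[s, t], continuous y} ->
  (forall u, s < u < t -> is_derive u 1 y (dy u)) ->
  (forall u, s < u < t -> A < y u -> dy u <= - k * (y u - A)) ->
  y t - A <= expR (- k * (t - s)) * Num.max (y s - A) 0.
Proof.
move=> st cy ydy dyle.
pose g u := (y u - A) * expR (k * (u - s)).
pose dg u := dy u * expR (k * (u - s)) + (y u - A) * (k * expR (k * (u - s))).
have gdg u : s < u < t -> is_derive u 1 g (dg u).
  move=> ut; have := ydy u ut => ?.
  apply: is_derive_eq; rewrite /dg /GRing.scale/=.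
  by ring.
have cg : {within `[s, t], continuous g}.
  apply: within_continuousM.
    by apply: within_continuousB => //; exact: within_continuous_cst.
  apply: continuous_subspaceT => v; exact: is_derive_continuous.
have H : Num.max (g t) 0 ^+ 2 <= Num.max (g s) 0 ^+ 2.
  apply: (@derive_le0_le (fun u => Num.max (g u) 0 ^+ 2)
    (fun u => 2 * Num.max (g u) 0 * dg u) s t st).
  - move=> u; apply: (@continuous_comp _ _ _ (g : subspace _ -> R)
      (fun z => Num.max z 0 ^+ 2)); first exact: cg.
    apply: differentiable_continuous; apply/derivable1_diffP.
    by have := is_derive_posrt_sqr (g u) => -[].
  - move=> u ut; have ? := gdg u ut; have ? := is_derive_posrt_sqr (g u).
    exact: (@is_derive1_comp _ (fun z => Num.max z 0 ^+ 2) g).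
  - move=> u ut; have [g0|g0] := leP (g u) 0; first by rewrite mulr0 mul0r.
    have e0 := expR_gt0 (k * (u - s)).
    have yA : A < y u by rewrite -subr_gt0 -(pmulr_lgt0 _ e0).
    have c0 : 0 < 2 * g u by rewrite mulr_gt0.
    rewrite (pmulr_rle0 _ c0) /dg.
    rewrite mulrA -mulrDl pmulr_lle0 ?subr_gt0//.
    by have := dyle u ut yA; rewrite mulNr; lra.
have H1 : Num.max (g t) 0 <= Num.max (g s) 0.
  have m0 z : 0 <= Num.max z 0 :> R by rewrite le_max lexx orbT.
  by move: H; rewrite ler_sqr ?nnegrE.
have : g t <= Num.max (g s) 0 by apply: le_trans H1; rewrite le_max lexx.
rewrite {2}/g subrr mulr0 expR0 mulr1 /g -ler_pdivlMr ?expR_gt0//.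
by rewrite -expRN mulrC mulNr.
Qed.

(** Decay at rate [k = 0]: the excess over [A] cannot grow where it is positive, so it never becomes
    positive. *)
Lemma barrier_le y dy A s t : s <= t ->
  {within `[s, t], continuous y} ->
  (forall u, s < u < t -> is_derive u 1 y (dy u)) ->
  (forall u, s < u < t -> A < y u -> dy u <= 0) ->
  y s <= A -> y t <= A.
Proof.
move=> st cy ydy dyle ysA.
have := @posrt_exp_decay y dy A 0 s t st cy ydy.
rewrite (@max_r _ _ (y s - A)) ?subr_le0// mulr0 -[y t <= A]subr_le0 => H; apply: H => u su Ayu.
by rewrite oppr0 mul0r; exact: dyle.
Qed.

(** A bootstrap. At the first time [T] where [B <= f], continuity gives the weak bound [f <= B] on
    all of [[a, T]], and the hypothesis improves it to [f T < B]. *)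
Lemma continuation (f : R -> R) a b B : {within `[a, b], continuous f} ->
  f a < B ->
  (forall t, a <= t <= b -> (forall u, a <= u <= t -> f u <= B) -> f t < B) ->
  forall t, a <= t <= b -> f t < B.
Proof.
move=> /within_continuousP cf faB IH t0 /andP[at0 t0b].
rewrite ltNge; apply/negP => Bft0.
pose E := [set t | a <= t <= b /\ B <= f t].
have Et0 : E t0 by split => //; rewrite at0.
have lbE : lbound E a by move=> u [/andP[]].
have infE : has_inf E by split; [exists t0|exists a].
pose T := inf E.
have aT : a <= T by apply: lb_le_inf => //; exists t0.
have Tt0 : T <= t0 by apply: ge_inf => //; exists a.
have Tab : a <= T <= b by rewrite aT (le_trans Tt0).
have Tin : `[a, b]%classic T by rewrite /= in_itv.
have below u : a <= u < T -> f u < B.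
  move=> /andP[au uT]; rewrite ltNge; apply/negP => Bfu.
  have : T <= u; last by rewrite leNgt uT.
  apply: ge_inf; first by exists a.
  by split => //; rewrite au (le_trans (ltW uT))//; case/andP: Tab.
have fT : B <= f T.
  rewrite leNgt; apply/negP => fTB.
  have gap : 0 < B - f T by rewrite subr_gt0.
  have [d d0 H] := cf T Tin _ gap.
  have [u [uab Bfu] uT] : exists2 u, E u & u < T + d by exact: inf_adherent.
  have Tu : T <= u by apply: ge_inf; [exists a|split].
  have uTd : `|u - T| < d by rewrite ger0_norm ?subr_ge0// ltrBlDl.
  have := H u; rewrite /= in_itv/= => /(_ uab uTd).
  by rewrite ltr_norml ltrD2r => /andP[_]; rewrite ltNge Bfu.
have fTle : f T <= B.
  rewrite leNgt; apply/negP => BfT.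
  have aT' : a < T.
    by rewrite lt_neqAle aT andbT; apply: contraTneq BfT => <-; rewrite -leNgt ltW.
  have gap : 0 < f T - B by rewrite subr_gt0.
  have [d d0 H] := cf T Tin _ gap.
  pose u := Num.max a (T - d / 2).
  have uT : a <= u < T.
    by rewrite /u le_max lexx/= gt_max aT'/= ltrBlDr ltrDl divr_gt0.
  have := below u uT; rewrite ltNge => /negP; apply.
  have := H u; rewrite /= in_itv/= => Hu.
  have /Hu : a <= u <= b.
    by case/andP: uT => -> /ltW uT/=; apply: le_trans uT _; case/andP: Tab.
  have Tdu : T - d / 2 <= u by rewrite /u le_max lexx orbT.
  move: uT => /andP[_ uT].
  have dd : `|u - T| < d by rewrite ltr0_norm ?subr_lt0//; lra.
  by move=> /(_ dd); rewrite ltr_norml; lra.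
have : f T < B.
  apply: IH => // u /andP[au]; rewrite le_eqVlt => /predU1P[->//|uT].
  by rewrite ltW// below// au.
by rewrite ltNge fT.
Qed.

(* Were [g >= e] at arbitrarily large times, [g >= e / 2] would hold on windows of
   fixed length, along which [y] would grow by a fixed amount. *)
Lemma barbalat (y dy g : R -> R) (l L T e c : R) : 0 < e -> 0 < c -> 0 <= L ->
  (forall t, T <= t -> is_derive t 1 y (dy t)) ->
  (forall s t, T <= s -> s <= t -> `|g t - g s| <= L * (t - s)) ->
  (forall t, T <= t -> e / 2 <= g t -> c <= dy t) ->
  y t @[t --> +oo] --> l ->
  \forall t \near +oo, g t < e.
Proof.
move=> e0 c0 L0 ydy gL gdy yl.
(* Over a window of this length [g] drops by at most [L * tau <= e / 2]; the [+ 1] covers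
   [L = 0]. *)
pose tau := e / 2 / (L + 1).
have tau0 : 0 < tau by rewrite !divr_gt0// ltr_wpDl.
(* Past [M] two values of [y] differ by less than [c * tau], the least growth of [y] over a
   window. *)
have [M [_ HM]] : \forall t \near +oo, `|l - y t| < c * tau / 2.
  by move/cvgrPdist_lt : yl; apply; rewrite divr_gt0// mulr_gt0.
exists (Num.max M T); split; first exact: num_real.
move=> t; rewrite gt_max => /andP[Mt Tt].
rewrite ltNge; apply/negP => egt.
have gu u : t <= u <= t + tau -> e / 2 <= g u.
  move=> /andP[tu ut].
  have H := gL t u (ltW Tt) tu.
  have : L * (u - t) <= e / 2.
    apply: (@le_trans _ _ (L * tau)); first by rewrite ler_wpM2l// lerBlDl.
    rewrite /tau mulrCA ger_pMr ?divr_gt0//.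
    by rewrite ler_pdivrMr ?ltr_wpDl// mul1r lerDl.
  by move: H; rewrite ler_norml => /andP[]; lra.
have Hyy : c * (t + tau - t) <= y (t + tau) - y t.
  apply: (@derive_ge_le y dy).
  - by rewrite lerDl ltW.
  - apply: derivable_within_continuous => u; rewrite in_itv/= => /andP[tu _].
    by have [] := ydy u (le_trans (ltW Tt) tu).
  - by move=> u /andP[/ltW tu _]; apply: ydy; exact: le_trans (ltW Tt) tu.
  - move=> u /andP[/ltW tu /ltW ut]; apply: gdy; first exact: le_trans (ltW Tt) tu.
    by apply: gu; rewrite tu.
have /= := HM t Mt; have /= := HM (t + tau).
rewrite (lt_trans Mt) ?ltrDl// => /(_ isT).
by rewrite !ltr_norml; lra.
Qed.

End realfun.

(** * Global Picard theorem *)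

Section matrix_norm.
Context {R : realType} {m n : nat}.
Implicit Types M : 'M[R]_(m, n).

Lemma mx_norm_le M (c : R) : 0 <= c ->
  (forall i j, `|M i j| <= c) -> `|M| <= c.
Proof.
move=> c0 H; rewrite /Num.norm/= mx_normrE.
by apply/bigmax_leP; split => // -[i j] _; exact: H.
Qed.

Lemma le_mx_norm M i j : `|M i j| <= `|M|.
Proof.
rewrite [leRHS]/Num.norm/= mx_normrE.
exact: (le_bigmax _ (fun k : 'I_m * 'I_n => `|M k.1 k.2|) (i, j)).
Qed.

End matrix_norm.

Section cauchy.
Context {R : realType} {m n : nat}.
Local Notation V := 'M[R]_(m, n).
Implicit Types u : nat -> V.

Lemma cauchy_seq_cvg u :
  (forall e : R, 0 < e ->
    exists N, forall i j, (N <= i)%N -> (N <= j)%N -> `|u i - u j| < e) ->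
  exists l : V, u @ \oo --> l.
Proof.
move=> H; suff : cvgn u by move=> /cvg_ex[l ul]; exists l.
apply/cauchy_cvgP; apply: cauchy_exP => e e0.
have [N HN] := H e e0; exists (u N); exists N => // k /= Nk.
by rewrite -ball_normE/=; exact: HN.
Qed.

Lemma lim_norm_le u (l a : V) (c : R) (N : nat) : u @ \oo --> l ->
  (forall j, (N <= j)%N -> `|u j - a| <= c) -> `|l - a| <= c.
Proof.
move=> ul H.
have ul' : (fun j => `|u j - a|) @ \oo --> `|l - a|.
  by apply: cvg_norm; apply: cvgB => //; exact: cvg_cst.
by apply: (cvgr_to_le ul'); exists N.
Qed.

Lemma half_pow_lt (c e : R) : 0 <= c -> 0 < e -> exists k : nat, c / 2 ^+ k < e.
Proof.
move=> c0 e0.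
have : (fun k => c * (2^-1) ^+ k) @ \oo --> c * (0 : R).
  by apply: cvgMr; apply: cvg_expr; rewrite ger0_norm ?invr_ge0// invf_lt1 ?ltr1n.
rewrite mulr0 => /cvgr0_norm_lt /(_ e e0)[N _ /(_ N (leqnn _))].
by rewrite exprVn ger0_norm; [exists N|rewrite mulr_ge0// invr_ge0 exprn_ge0].
Qed.

Lemma geometric_seq_cvg u (c : R) :
  (forall k, `|u k.+1 - u k| <= c / 2 ^+ k) ->
  exists l : V, u @ \oo --> l /\ forall k, `|l - u k| <= 2 * c / 2 ^+ k.
Proof.
move=> uc.
have c0 : 0 <= c by have := uc 0%N; rewrite expr0 divr1; exact: le_trans.
have pow0 k : 0 < (2 : R) ^+ k by rewrite exprn_gt0.
(* The subtracted tail makes the induction close: an increment [c / 2 ^+ n] is exactly the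
   difference of two consecutive tails [2 * c / 2 ^+ n]. *)
have H k j : `|u (k + j)%N - u k| <= 2 * c / 2 ^+ k - 2 * c / 2 ^+ (k + j).
  elim: j => [|j IH]; first by rewrite addn0 !subrr normr0.
  rewrite addnS (le_trans (ler_distD (u (k + j)%N) _ _))//.
  apply: (le_trans (lerD (uc _) IH)).
  rewrite exprS invfM !mulrA.
  by rewrite [2 * c]mulrC (mulfK (_ : 2 != 0))//; lra.
have H' k j : `|u (k + j)%N - u k| <= 2 * c / 2 ^+ k.
  by rewrite (le_trans (H k j))// lerBlDr lerDl divr_ge0 ?mulr_ge0// ltW.
have [|l ul] := @cauchy_seq_cvg u.
  move=> e e0.
  have [||N HN] := @half_pow_lt (2 * c) (e / 2); rewrite ?mulr_ge0 ?divr_gt0//.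
  exists N => i j Ni Nj.
  rewrite (le_lt_trans (ler_distD (u N) _ _))//.
  have h1 := H' N (i - N)%N; have h2 := H' N (j - N)%N.
  rewrite subnKC// in h1; rewrite subnKC// distrC in h2.
  by lra.
exists l; split => // k; apply: (lim_norm_le ul (N := k)) => j kj.
by have := H' k (j - k)%N; rewrite subnKC.
Qed.

End cauchy.

Section primitive.
Context {R : realType}.
Local Notation mu := (@lebesgue_measure R).

Definition primitive (f : R -> R) (a t : R) : R :=
  (\int[mu]_(s in `[a, t]) f s)%R.

Lemma is_derive_primitive (f : R -> R) (a t : R) : continuous f -> a < t ->
  is_derive t 1 (primitive f a) (f t).
Proof.
move=> cf at_.
(* Integrating slightly beyond [t] makes [t] an interior point. *)
have fi : mu.-integrable `[a, t + 1] (EFin \o f).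
  apply: continuous_compact_integrable; first exact: segment_compact.
  exact: continuous_subspaceT.
have tt1 : t < t + 1 by rewrite ltrDl.
have [df Ef] := continuous_FTC1_closed tt1 fi at_ (cf t).
apply: DeriveDef; first exact: df.
by rewrite -derive1E; exact: Ef.
Qed.
End primitive.

Lemma cvg_mx {R : realType} {m n : nat} {T : Type} (F : set_system T)
    {FF : Filter F} (M : T -> 'M[R]_(m, n)) (l : 'M[R]_(m, n)) :
  (forall i j, M s i j @[s --> F] --> l i j) -> M s @[s --> F] --> l.
Proof.
move=> H; apply/cvgrPdist_le => e e0.
have : \forall s \near F, forall k : 'I_m * 'I_n, `|l k.1 k.2 - M s k.1 k.2| <= e.
  by apply: filter_forall => -[i j]; move/cvgrPdist_le : (H i j); apply.
apply: filterS => s Hs; apply: mx_norm_le; first exact: ltW.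
by move=> i j; rewrite !mxE; exact: (Hs (i, j)).
Qed.

(** * Derivatives relative to a set *)

Section has_derivative_in.
Context {R : realType}.
Implicit Types (V : normedModType R) (I : set R).

Lemma has_derivative_inP V I (f : R -> V) t (l : V) :
  has_derivative_in I f t l <->
  forall e : R, 0 < e -> exists2 d : R, 0 < d & forall s, I s -> s != t ->
    `|s - t| < d -> `|l - (s - t)^-1 *: (f s - f t)| < e.
Proof.
split=> [/cvgrPdist_lt H e /H|H].
  rewrite /within/= => /nbhs_ballP[d /= d0 {}H]; exists d => // s Is st sd.
  by apply: H => //; rewrite /ball/= distrC.
apply/cvgrPdist_lt => e /H[d d0 {}H].
apply/nbhs_ballP; exists d => // s; rewrite /ball/= => ts st Is.
by apply: H => //; rewrite distrC.
Qed.

Lemma is_deriveP V (f : R -> V) (t : R) (l : V) :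
  is_derive t 1 f l <-> has_derivative_in setT f t l.
Proof.
have E (e : R) (h : R) : ((f \o shift t) (h *: (1 : R))) = f (h + t).
  by rewrite /= /GRing.scale/= mulr1.
split=> [[/derivable1_diffP /derivable1_diffP dft <-]|/has_derivative_inP H].
  apply/has_derivative_inP => e e0.
  have /cvgrPdist_lt/(_ e e0) := dft.
  rewrite /dnbhs/within/= => /nbhs_ballP[d /= d0 H]; exists d => // s _ st sd.
  have := H (s - t); rewrite /ball/= sub0r normrN subr_eq0 => /(_ sd st).
  by rewrite /GRing.scale/= mulr1 subrK.
have : h^-1 *: ((f \o shift t) (h *: (1 : R)) - f t) @[h --> (0 : R)^'] --> l.
  apply/cvgrPdist_lt => e /H[d d0 {}H].
  rewrite /dnbhs/within/=; apply/nbhs_ballP; exists d => // h.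
  rewrite /ball/= sub0r normrN => hd h0.
  have := H (h + t) I; rewrite addrK => /(_ _ hd) /=.
  rewrite /GRing.scale/= mulr1; apply.
  by rewrite -subr_eq0 addrK.
by move=> H1; apply: DeriveDef; [apply/cvg_ex; exists l|exact: cvg_lim].
Qed.

Lemma has_derivative_in_sub V I J (f : R -> V) t (l : V) : I `<=` J ->
  has_derivative_in J f t l -> has_derivative_in I f t l.
Proof.
move=> IJ /has_derivative_inP H; apply/has_derivative_inP => e /H[d d0 {}H].
by exists d => // s /IJ; exact: H.
Qed.

Lemma has_derivative_in_interior V (a : R) (f : R -> V) t (l : V) : a < t ->
  has_derivative_in `[a, +oo[ f t l -> is_derive t 1 f l.
Proof.
move=> a_t /has_derivative_inP H; apply/is_deriveP/has_derivative_inP => e e0.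
have [d d0 {}H] := H e e0.
exists (Num.min d (t - a)); first by rewrite lt_min d0 subr_gt0.
move=> s _ st; rewrite lt_min => /andP[sd sta]; apply: H => //.
by rewrite /= in_itv/= andbT; move: sta; rewrite ltr_norml; lra.
Qed.

Lemma has_derivative_in_continuous V I (f : R -> V) t (l : V) :
  has_derivative_in I f t l -> f s @[s --> within I (nbhs t)] --> f t.
Proof.
move=> /has_derivative_inP /(_ 1 ltr01)[d d0 H].
apply/cvgrPdist_lt => e e0.
pose d' := Num.min d (e / (`|l| + 1)).
have l1 : 0 < `|l| + 1 by rewrite ltr_wpDl.
rewrite /within/=; apply/nbhs_ballP; exists d'.
  by rewrite /= /d' lt_min d0 divr_gt0.
move=> s; rewrite /ball/= /d' distrC lt_min => /andP[sd se] Is.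
have [->|st] := eqVneq s t; first by rewrite subrr normr0.
have := H s Is st sd.
have st0 : s - t != 0 by rewrite subr_eq0.
set w := _ *: _ => lw.
have -> : f t - f s = - (s - t) *: w.
  by rewrite /w scalerA mulNr divff// scaleN1r opprB.
have wl : `|w| <= `|l| + 1.
  rewrite -[w](subrK l) (le_trans (ler_normD _ _))// addrC lerD2l.
  by rewrite distrC ltW.
rewrite normrZ normrN (le_lt_trans (ler_wpM2l _ wl))//.
by rewrite -ltr_pdivlMr.
Qed.

Lemma has_derivative_in_mx m n I (f : R -> 'M[R]_(m, n)) t (l : 'M[R]_(m, n)) :
  has_derivative_in I f t l <->
  forall i j, has_derivative_in I (fun s => f s i j) t (l i j).
Proof.
split=> [/has_derivative_inP H i j|H].
  apply/has_derivative_inP => e /H[d d0 {}H]; exists d => // s Is st sd.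
  apply: le_lt_trans (H s Is st sd).
  by rewrite (le_trans _ (le_mx_norm _ i j))// !mxE.
apply/has_derivative_inP => e e0.
have {}H i j : exists2 d : R, 0 < d & forall s, I s -> s != t ->
    `|s - t| < d -> `|l i j - (s - t)^-1 *: (f s i j - f t i j)| < e / 2.
  by move/has_derivative_inP : (H i j); apply; rewrite divr_gt0.
have [d d0 Hd] : exists2 d : R, 0 < d & forall i j s, I s -> s != t ->
    `|s - t| < d -> `|l i j - (s - t)^-1 *: (f s i j - f t i j)| < e / 2.
  pose D i j := sval (cid2 (H i j)).
  exists (\big[Num.min/1]_(k : 'I_m * 'I_n) D k.1 k.2).
    by apply/bigmin_gtP; split => // -[i j] _; rewrite /D; case: cid2.
  move=> i j s Is st sd.
  have : `|s - t| < D i j.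
    by rewrite (lt_le_trans sd)//; exact: (bigmin_le _ (i, j) (fun k => D k.1 k.2)).
  by rewrite /D; case: cid2 => /= ? ? + ?; exact.
exists d => // s Is st sd; rewrite (@le_lt_trans _ _ (e / 2))//; last first.
  by rewrite ltr_pdivrMr// ltr_pMr// ltr1n.
apply: mx_norm_le; first by rewrite divr_ge0// ltW.
by move=> i j; rewrite !mxE ltW// Hd.
Qed.

End has_derivative_in.

Lemma has_derivative_in_eq {R : realType} (V : normedModType R) (I : set R)
    (f g : R -> V) t l : (forall s, I s -> f s = g s) -> I t ->
  has_derivative_in I f t l -> has_derivative_in I g t l.
Proof.
move=> fg It /has_derivative_inP H; apply/has_derivative_inP => e /H[dl d0 {}H].
by exists dl => // s Is st std; rewrite -!fg//; exact: H.
Qed.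

Lemma is_derive_has_derivative_in {R : realType} (V : normedModType R) (I : set R)
    (f : R -> V) (t : R) (l : V) : is_derive t 1 f l -> has_derivative_in I f t l.
Proof. by move=> /is_deriveP; apply: has_derivative_in_sub; exact: subsetT. Qed.

(** * Picard iteration on a half-line *)

Section picard.
Context {R : realType} {m n : nat}.
Variables (f : R -> 'M[R]_(m, n) -> 'M[R]_(m, n)) (K B t0 : R) (z0 : 'M[R]_(m, n)).
Hypothesis K1 : 1 <= K.
Hypothesis fc : forall z, continuous (f ^~ z).
Hypothesis fL : forall t y z, `|f t y - f t z| <= K * `|y - z|.
Hypothesis fB : forall t, `|f t z0| <= B.

Let K0 : 0 < K. Proof. exact: lt_le_trans ltr01 K1. Qed.

Let f_comp_continuous (z : R -> 'M[R]_(m, n)) : continuous z ->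
  continuous (fun s => f s (z s)).
Proof.
move=> cz t; apply/cvgrPdist_lt => e e0.
have e2 : 0 < e / 2 by rewrite divr_gt0.
have eK : 0 < e / 2 / K by rewrite divr_gt0.
have /cvgrPdist_lt/(_ _ e2) c1 := @fc (z t) t.
have /cvgrPdist_lt/(_ _ eK) c2 := cz t.
near=> s.
rewrite (le_lt_trans (ler_distD (f s (z t)) _ _))//.
have h1 : `|f t (z t) - f s (z t)| < e / 2 by near: s.
have h2 : `|z t - z s| < e / 2 / K by near: s.
have := fL s (z t) (z s); rewrite ltr_pdivlMr// in h2; lra.
Unshelve. all: by end_near. Qed.

(** The integral starts at [t0 - 1] so that the fundamental theorem applies at [t0] as well, with a
    two-sided derivative; [step] subtracts the value at [t0]. *)
Let step_coord (z : R -> 'M[R]_(m, n)) i j (t : R) : R :=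
  primitive (fun s => f s (z s) i j) (t0 - 1) t.

(** Replacing [t] by [Num.max t t0] extends the iterates by [z0] to the left of [t0], so that they
    are continuous on the whole line. *)
Let step (z : R -> 'M[R]_(m, n)) (t : R) : 'M[R]_(m, n) :=
  z0 + \matrix_(i, j) (step_coord z i j (Num.max t t0) - step_coord z i j t0).

Let coord_comp_continuous (z : R -> 'M[R]_(m, n)) i j : continuous z ->
  continuous (fun s => f s (z s) i j).
Proof.
move=> cz t; apply: (@continuous_comp _ _ _ (fun s => f s (z s)) (fun M => M i j)).
  exact: f_comp_continuous.
exact: coord_continuous.
Qed.

Let is_derive_step_coord (z : R -> 'M[R]_(m, n)) i j t : continuous z -> t0 <= t ->
  is_derive t 1 (step_coord z i j) (f t (z t) i j).
Proof.
move=> cz t0t; apply: (@is_derive_primitive _ (fun s => f s (z s) i j)).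
  exact: coord_comp_continuous.
by rewrite ltrBlDr (le_lt_trans t0t)// ltrDl.
Qed.

Let step_coord_continuous (z : R -> 'M[R]_(m, n)) i j : continuous z ->
  continuous (fun t => step_coord z i j (Num.max t t0)).
Proof.
move=> cz t.
apply: (@continuous_comp _ _ _ (fun t => Num.max t t0) (step_coord z i j)); last first.
  by apply: (is_derive_continuous (is_derive_step_coord _ _ cz _)); rewrite le_max lexx orbT.
by apply: continuous_max; [exact: cvg_id|exact: cst_continuous].
Qed.

Let step_continuous (z : R -> 'M[R]_(m, n)) : continuous z -> continuous (step z).
Proof.
move=> cz t; apply: cvg_mx => i j; rewrite /step !mxE.
under eq_fun do rewrite !mxE.
apply: cvgD; first exact: cvg_cst.
apply: cvgB; last exact: cvg_cst.
exact: step_coord_continuous.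
Qed.

Let step_le z t : t <= t0 -> step z t = z0.
Proof.
move=> tt0; rewrite /step max_r//; apply/matrixP => i j.
by rewrite !mxE subrr addr0.
Qed.

Let E (t : R) : R := expR (2 * K * (t - t0)).

Let is_derive_E (t : R) : is_derive t 1 E (2 * K * E t).
Proof. by apply: is_derive_eq; rewrite /E /GRing.scale/=; ring. Qed.

(* The weight [E] makes [step] a contraction on the whole half-line. *)
Let step_contraction (y z : R -> 'M[R]_(m, n)) (c : R) : 0 <= c ->
  continuous y -> continuous z ->
  (forall t, t0 <= t -> `|y t - z t| <= c * E t) ->
  forall t, t0 <= t -> `|step y t - step z t| <= c / 2 * E t.
Proof.
move=> c0 cy cz yz t t0t.
apply: mx_norm_le; first by rewrite mulr_ge0 ?divr_ge0// expR_ge0.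
move=> i j; rewrite /step !mxE (max_l t0t).
pose g s := step_coord y i j s - step_coord z i j s.
rewrite (_ : _ - _ = g t - g t0); last by rewrite /g; ring.
pose dg s := f s (y s) i j - f s (z s) i j.
have gdg s : t0 <= s -> is_derive s 1 g (dg s).
  move=> t0s; have ? := is_derive_step_coord i j cy t0s.
  by have ? := is_derive_step_coord i j cz t0s; exact: is_deriveB.
have dgle s : t0 <= s -> `|dg s| <= c * K * E s.
  move=> t0s; rewrite /dg; have := le_mx_norm (f s (y s) - f s (z s)) i j.
  rewrite !mxE => /le_trans; apply; rewrite (le_trans (fL _ _ _))//.
  by rewrite -mulrA mulrCA ler_wpM2l ?yz// ltW.
(* The sign [(-1) ^+ b] yields both halves of the bound on the absolute value. As [E' = 2 * K * E],
   a primitive of the bound [c * K * E] on [dg] is [c / 2 * E]. *)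
have key (b : bool) : (-1) ^+ b * (g t - g t0) <= c / 2 * E t.
  pose w s := (-1) ^+ b * g s - c / 2 * E s.
  have wdw s : t0 <= s -> is_derive s 1 w ((-1) ^+ b * dg s - c * K * E s).
    move=> t0s; have ? := gdg s t0s; have ? := is_derive_E s.
    by apply: is_derive_eq; rewrite /GRing.scale/=; field.
  have : w t <= w t0.
    apply: (@derive_le0_le _ w (fun s => (-1) ^+ b * dg s - c * K * E s)) => //.
    - apply: derivable_within_continuous => s; rewrite in_itv/= => /andP[t0s _].
      by have [] := wdw s t0s.
    - by move=> s /andP[/ltW t0s _]; exact: wdw.
    - move=> s /andP[/ltW t0s _]; rewrite subr_le0.
      by rewrite (le_trans _ (dgle s t0s))// (le_trans (ler_norm _))// normrMsign.
  rewrite /w [_ * (g t - g t0)]mulrBr /E subrr mulr0 expR0 mulr1.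
  have : 0 <= c / 2 by rewrite divr_ge0.
  by lra.
rewrite ler_norml; have := key false; have := key true.
by rewrite expr0 expr1; lra.
Qed.

Let zn k : R -> 'M[R]_(m, n) := iter k step (fun=> z0).

Let zn_continuous k : continuous (zn k).
Proof.
elim: k => [|k IH]; first exact: cst_continuous.
exact: step_continuous.
Qed.

Let B0 : 0 <= B. Proof. exact: le_trans (fB t0). Qed.

Let zn_dist k t : t0 <= t -> `|zn k.+1 t - zn k t| <= B / 2 ^+ k * E t.
Proof.
elim: k t => [t t0t|k IH t t0t]; last first.
  rewrite (_ : B / 2 ^+ k.+1 = B / 2 ^+ k / 2).
    have c0 : 0 <= B / 2 ^+ k by rewrite divr_ge0// exprn_ge0.
    apply: (@step_contraction (zn k.+1) (zn k)) => //.
  by rewrite exprSr invfM mulrA.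
rewrite expr0 divr1; apply: mx_norm_le; first by rewrite mulr_ge0// expR_ge0.
move=> i j; rewrite /= /step !mxE (max_l t0t) addrAC subrr add0r.
pose g s := step_coord (fun=> z0) i j s.
have gdg s : t0 <= s -> is_derive s 1 g (f s z0 i j).
  by move=> t0s; apply: (@is_derive_step_coord (fun=> z0)) => //; exact: cst_continuous.
(* The first increment is compared with the weight through [t - t0 <= 2 * K * (t - t0) <= E t],
   where [1 <= K] enters. *)
apply: (@le_trans _ _ (B * (t - t0))).
  apply: (@derive_bound _ g (fun s => f s z0 i j)) => //.
  - apply: derivable_within_continuous => s; rewrite in_itv/= => /andP[t0s _].
    by have [] := gdg s t0s.
  - by move=> s /andP[/ltW t0s _]; exact: gdg.
  - by move=> s _; rewrite (le_trans (le_mx_norm _ _ _)).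
rewrite ler_wpM2l// (@le_trans _ _ (2 * K * (t - t0)))//.
  have K2 : 1 <= 2 * K by rewrite (le_trans K1)// ler_peMl// ?ler1n// ltW.
  by rewrite ler_peMl ?subr_ge0.
by rewrite (le_trans _ (expR_ge1Dx _))// lerDr.
Qed.

Let zn_dist_max k t : `|zn k.+1 t - zn k t| <= B * E (Num.max t t0) / 2 ^+ k.
Proof.
have [t0t|/ltW tt0] := leP t0 t; first by rewrite mulrAC; exact: zn_dist.
rewrite (_ : zn k.+1 t = z0); last by rewrite /= step_le.
rewrite (_ : zn k t = z0) ?subrr ?normr0; last first.
  by case: k => [|k] //=; rewrite step_le.
by rewrite !mulr_ge0// ?expR_ge0// invr_ge0 exprn_ge0.
Qed.

(** Two functions are returned because the fixed point [z], constant to the left of [t0], has in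
    general no derivative at [t0]. The same integral without the clamp on time is [w]: it is
    differentiable at [t0] too and agrees with [z] from [t0] on. *)
Theorem picard_global : exists z w : R -> 'M[R]_(m, n),
  [/\ continuous z, z t0 = z0, forall t, t0 <= t -> z t = w t &
    forall t, t0 <= t -> forall i j, is_derive t 1 (fun s => w s i j) (f t (z t) i j)].
Proof.
have lim_ex t := geometric_seq_cvg (u := zn ^~ t) (fun k => zn_dist_max k t).
pose z t := sval (cid (lim_ex t)).
have zlim t : zn ^~ t @ \oo --> z t by rewrite /z; case: cid => /= ? [].
have zdist k t : `|z t - zn k t| <= 2 * (B * E (Num.max t t0)) / 2 ^+ k.
  by rewrite /z; case: cid => /= ? [].
have cz : continuous z.
  move=> t; apply/cvgrPdist_lt => e e0.
  (* [C] dominates the constant of [zdist] at all times within 1 of [t]: the convergence is uniform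
     there, and the limit is continuous. *)
  pose C := 2 * (B * E (Num.max t t0 + 1)).
  have C0 : 0 <= C by rewrite !mulr_ge0// expR_ge0.
  have [k Hk] : exists k, C / 2 ^+ k < e / 3.
    by apply: half_pow_lt => //; rewrite divr_gt0.
  have zk s : `|t - s| < 1 -> `|z s - zn k s| < e / 3.
    move=> ts; apply: le_lt_trans Hk; rewrite (le_trans (zdist k s))//.
    have st : Num.max s t0 <= Num.max t t0 + 1.
      rewrite ge_max; move: ts; rewrite ltr_norml => /andP[ts _].
      rewrite (@le_trans _ _ (t + 1)) ?lerD2r ?le_max ?lexx//=; last by lra.
      by rewrite (@le_trans _ _ (Num.max t t0))// ?le_max ?lexx ?orbT// lerDl.
    have Est : E (Num.max s t0) <= E (Num.max t t0 + 1).
      by rewrite /E ler_expR ler_wpM2l ?lerB// mulr_ge0// ltW.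
    by rewrite ler_wpM2r ?invr_ge0 ?exprn_ge0// /C ler_wpM2l// ler_wpM2l.
  have e3 : 0 < e / 3 by rewrite divr_gt0.
  have /cvgrPdist_lt/(_ _ e3) ck := @zn_continuous k t.
  near=> s.
  have h1 : `|t - s| < 1.
    by near: s; have /cvgrPdist_lt/(_ 1 ltr01) := @cvg_id _ (nbhs t).
  have h2 := zk s h1.
  have h3 := zk t; rewrite subrr normr0 in h3; have {}h3 := h3 ltr01.
  have h4 : `|zn k t - zn k s| < e / 3 by near: s.
  rewrite (le_lt_trans (ler_distD (zn k t) _ _))//.
  have := ler_distD (zn k s) (zn k t) (z s).
  by rewrite [`|zn k s - z s|]distrC; lra.
(* Both sides are within a multiple of [2 ^- k] of [zn k.+1 t], the right one by contraction applied
   to [z] and [zn k]. *)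
have fix_z t : t0 <= t -> z t = step z t.
  move=> t0t; apply/eqP; rewrite -subr_eq0 -normr_le0 leNgt; apply/negP.
  have c0 : 0 <= 2 * (B * E t) by rewrite !mulr_ge0// expR_ge0.
  move=> /(half_pow_lt c0)[k]; rewrite ltNge => /negP; apply.
  have h1 := zdist k.+1 t.
  have Bk : 0 <= 2 * B / 2 ^+ k by rewrite !mulr_ge0// invr_ge0 exprn_ge0.
  have h2 : `|step z t - zn k.+1 t| <= 2 * B / 2 ^+ k / 2 * E t.
    apply: step_contraction => // s t0s; rewrite (le_trans (zdist k s))//.
    by rewrite (max_l t0s) le_eqVlt; apply/orP; left; apply/eqP; ring.
  rewrite (le_trans (ler_distD (zn k.+1 t) _ _))// [leRHS](_ : _ =
      2 * (B * E t) / 2 ^+ k.+1 + 2 * B / 2 ^+ k / 2 * E t).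
    rewrite (max_l t0t) in h1; rewrite distrC in h2.
    by apply: lerD; [exact: h1|exact: h2].
  by rewrite exprS invfM; field; rewrite expf_neq0.
exists z, (fun t => z0 + \matrix_(i, j) (step_coord z i j t - step_coord z i j t0)).
split => //.
- by rewrite fix_z// step_le.
- by move=> t t0t; rewrite (fix_z t t0t) /step (max_l t0t).
- move=> t t0t i j; under eq_fun do rewrite !mxE.
  have ? := is_derive_step_coord i j cz t0t.
  by apply: is_derive_eq; rewrite subr0 add0r mul1r.
Unshelve. all: by end_near. Qed.

End picard.

(** * Local Lipschitz continuity and the chain rule *)

Section lipschitz.
Context {R : realType}.

Lemma locally_lipschitz_continuous (V W : normedModType R) (f : V -> W) :
  locally_lipschitz f -> continuous f.
Proof.
move=> fL x; have [U xU] := fL x.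
move=> /(filterI (nbhs_pinfty_gt (num_real (0 : R)))) /filter_ex[M [M0 HM]].
apply/cvgrPdist_lt => e e0; near=> y.
have := HM (x, y); rewrite /= => /(_ _)/le_lt_trans; apply.
  by split => //=; [exact: nbhs_singleton|near: y].
rewrite -ltr_pdivlMl//; near: y.
by move/cvgrPdist_lt : (@cvg_id _ (nbhs x)); apply; rewrite mulr_gt0// invr_gt0.
Unshelve. all: by end_near. Qed.

(** Compactness of the product of [A] with itself gives one constant without convexity: near a
    diagonal point the local constant applies, and near [(x, y)] with [x != y] the increment of [f]
    is bounded while the distance stays away from 0. *)
Lemma locally_lipschitz_compact (V W : normedModType R) (f : V -> W) (A : set V) :
  locally_lipschitz f -> compact A ->
  exists2 L : R, 0 < L & forall x y, A x -> A y -> `|f x - f y| <= L * `|x - y|.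
Proof.
move=> fL cA.
have cf := locally_lipschitz_continuous fL.
have /compact_near_coveringP cAA := compact_setX cA cA.
have : \forall L \near (+oo : set_system R), A `*` A `<=`
    [set w | `|f w.1 - f w.2| <= L * `|w.1 - w.2|].
  apply: (cAA R (+oo : set_system R)
    (fun L w => `|f w.1 - f w.2| <= L * `|w.1 - w.2|)) => -[x y] [/= Ax Ay].
  have [<-|xy] := eqVneq x y.
    have [U xU HU] := fL x.
    exists ((U `*` U), [set M | forall w, (U `*` U) w ->
        `|f w.1 - f w.2| <= M * `|w.1 - w.2|]) => /=.
      by split => //; exists (U, U).
    by move=> [w L] [/= ? ?]; auto.
  pose c := `|x - y|.
  have c0 : 0 < c by rewrite normr_gt0 subr_eq0.
  pose D := `|f x - f y| + 2.
  (* Moving each point by less than [c / 4] and each image by less than 1 keeps the distance above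
     [c / 2] and the increment below [D]. *)
  have near_pt z : \forall w \near z, `|z - w| < c / 4 /\ `|f z - f w| < 1.
    near=> w; split; near: w.
      by move/cvgrPdist_lt : (@cvg_id _ (nbhs z)); apply; rewrite divr_gt0.
    by move/cvgrPdist_lt : (cf z); apply.
  exists ([set w | `|x - w| < c / 4 /\ `|f x - f w| < 1] `*`
          [set w | `|y - w| < c / 4 /\ `|f y - f w| < 1],
          [set L | D / (c / 2) <= L]) => /=.
    split; last by apply: nbhs_pinfty_ge; exact: num_real.
    by exists ([set w | `|x - w| < c / 4 /\ `|f x - f w| < 1],
               [set w | `|y - w| < c / 4 /\ `|f y - f w| < 1]) => //; split; exact: near_pt.
  move=> [[w1 w2] L] /= [[[xw1 fw1] [yw2 fw2]] DL].
  have c2 : c / 2 <= `|w1 - w2|.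
    have := ler_distD w1 x y; have := ler_distD w2 w1 y.
    by rewrite [`|w2 - y|]distrC -/c; lra.
  have fD : `|f w1 - f w2| <= D.
    have := ler_distD (f x) (f w1) (f w2); have := ler_distD (f y) (f x) (f w2).
    by rewrite [`|f w1 - f x|]distrC /D; lra.
  rewrite (le_trans fD)// (@le_trans _ _ (D / (c / 2) * (c / 2)))//.
    by rewrite divfK// gt_eqF// divr_gt0.
  by rewrite ler_pM// ?divr_ge0// ?addr_ge0// ltW.
move=> /(filterI (nbhs_pinfty_gt (num_real (0 : R)))) /filter_ex[L [L0 HL]].
by exists L => // x y Ax Ay; apply: (HL (x, y)).
Unshelve. all: by end_near. Qed.

Lemma compact_norm_le d (M : R) : compact [set x : 'rV[R]_d | `|x| <= M].
Proof.
apply: bounded_closed_compact.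
  by exists M; split; [exact: num_real|move=> x Mx y /= yM; rewrite (le_trans yM)// ltW].
apply: (@closed_comp _ _ (fun x : 'rV[R]_d => `|x|) [set y | y <= M]).
  by move=> x _; exact: norm_continuous.
exact: closed_le.
Qed.

Lemma locally_lipschitz_ball d (W : normedModType R) (f : 'rV[R]_d -> W) (M : R) :
  locally_lipschitz f ->
  exists2 L : R, 0 < L & forall x y, `|x| <= M -> `|y| <= M ->
    `|f x - f y| <= L * `|x - y|.
Proof.
by move=> fL; exact: (locally_lipschitz_compact fL (compact_norm_le (M := M))).
Qed.

(** Outside a large ball [F] exceeds [F 0]; the ball is compact and contains 0, so the minimum over
    it is a lower bound everywhere. *)
Lemma coercive_lbound d (F : 'rV[R]_d -> R) : continuous F -> coercive_function F ->
  exists c : R, forall x, c <= F x.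
Proof.
move=> cF Fco; have [M HM] := Fco (F 0).
have [||x0 _ Hx0] := @compact_EVT_min _ _ F _ _ (compact_norm_le (M := Num.max M 0)).
- by exists 0; rewrite /= normr0 le_max lexx orbT.
- exact: continuous_subspaceT.
exists (F x0) => x; have [xM|Mx] := leP `|x| (Num.max M 0).
  by apply: Hx0; rewrite inE.
rewrite (@le_trans _ _ (F 0))//; last first.
  by apply/ltW/HM; rewrite (le_lt_trans _ Mx)// le_max lexx.
by apply: Hx0; rewrite inE /= normr0 le_max lexx orbT.
Qed.

End lipschitz.

Section chain_rule.
Context {R : realType} {d : nat}.

Lemma diff_gradient (F : 'rV[R]_d -> R) (x l : 'rV[R]_d) : differentiable F x ->
  'd F x l = \sum_i l 0 i * gradient F x 0 i.
Proof.
move=> dF; rewrite [in LHS](row_sum_delta l) linear_sum; apply: eq_bigr => i _.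
by rewrite linearZ/= /GRing.scale/= mxE deriveE.
Qed.

Lemma is_derive_comp_gradient (F : 'rV[R]_d -> R) (x : R -> 'rV[R]_d) (t : R)
    (l : 'rV[R]_d) : differentiable F (x t) ->
  (forall i, is_derive t 1 (fun s => x s 0 i) (l 0 i)) ->
  is_derive t 1 (fun s => F (x s)) (\sum_i l 0 i * gradient F (x t) 0 i).
Proof.
move=> dF dx.
have xl : is_derive t 1 x l.
  apply/is_deriveP/has_derivative_in_mx => i j; rewrite (ord1 i).
  exact/is_deriveP.
have dx' : differentiable x t by apply/derivable1_diffP; case: xl.
have dFx : differentiable (F \o x) t by exact: differentiable_comp.
apply: DeriveDef; first exact/derivable1_diffP.
rewrite deriveE// diff_comp//= -diff_gradient//; congr ('d F (x t) _).
by rewrite -deriveE//; case: xl.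
Qed.

End chain_rule.

(** * Lipschitz estimates for [m / sqrt(v + eps)] *)

Section direction.
Context {R : realType}.
Implicit Types a b m eps : R.

(** With [al] and [be] the two square roots, the difference equals
    [(b - a) / (al * be * (al + be))], and each of the three factors is at least [Num.sqrt eps]. *)
Lemma inv_sqrt_lipschitz eps a b : 0 < eps -> 0 <= a -> 0 <= b ->
  `|(Num.sqrt (a + eps))^-1 - (Num.sqrt (b + eps))^-1|
    <= (Num.sqrt eps ^+ 3)^-1 * `|a - b|.
Proof.
move=> e0 a0 b0.
have s0 : 0 < Num.sqrt eps by rewrite sqrtr_gt0.
have sq x : 0 <= x -> exists y, [/\ y = Num.sqrt (x + eps), Num.sqrt eps <= y & y ^+ 2 = x + eps].
  move=> x0; exists (Num.sqrt (x + eps)); split => //.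
    by rewrite ler_wsqrtr// lerDr.
  by rewrite sqr_sqrtr// addr_ge0// ltW.
have [al [<- sal al2]] := sq a a0; have [be [<- sbe be2]] := sq b b0.
have al0 := lt_le_trans s0 sal; have be0 := lt_le_trans s0 sbe.
have ab0 : 0 < al * be * (al + be) by rewrite !mulr_gt0// addr_gt0.
have -> : al^-1 - be^-1 = (al * be * (al + be))^-1 * (b - a).
  have -> : b - a = be ^+ 2 - al ^+ 2 by rewrite al2 be2; ring.
  by field; rewrite !gt_eqF// addr_gt0.
rewrite normrM distrC ler_wpM2r// ger0_norm; last by rewrite invr_ge0 ltW.
rewrite lef_pV2 ?posrE ?exprn_gt0// !exprS expr0 mulr1 mulrA.
have h1 : Num.sqrt eps * Num.sqrt eps <= al * be.
  by apply: ler_pM => //; exact: ltW.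
by apply: ler_pM => //; rewrite ?mulr_ge0 ?(ltW s0)//; lra.
Qed.

(** Changing [m] first and the root afterwards, only [m'] gets multiplied by a difference of inverse
    roots; hence a bound on one of the two momenta is enough. *)
Lemma direction_lipschitz eps a b m m' M : 0 < eps -> 0 <= a -> 0 <= b -> `|m'| <= M ->
  `|m / Num.sqrt (a + eps) - m' / Num.sqrt (b + eps)|
    <= ((Num.sqrt eps)^-1 + M / Num.sqrt eps ^+ 3) * (`|m - m'| + `|a - b|).
Proof.
move=> e0 a0 b0 mM.
have s0 : 0 < Num.sqrt eps by rewrite sqrtr_gt0.
have M0 : 0 <= M by exact: le_trans mM.
have sa : (Num.sqrt (a + eps))^-1 <= (Num.sqrt eps)^-1.
  by rewrite lef_pV2 ?posrE ?sqrtr_gt0 ?ltr_wpDl// ler_wsqrtr// lerDr.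
have -> : m / Num.sqrt (a + eps) - m' / Num.sqrt (b + eps) =
  (m - m') / Num.sqrt (a + eps) +
  m' * ((Num.sqrt (a + eps))^-1 - (Num.sqrt (b + eps))^-1) by ring.
rewrite (le_trans (ler_normD _ _))// !normrM.
have h1 := inv_sqrt_lipschitz e0 a0 b0.
have h2 : `|m'| * `|(Num.sqrt (a + eps))^-1 - (Num.sqrt (b + eps))^-1| <=
   M * ((Num.sqrt eps ^+ 3)^-1 * `|a - b|) by rewrite ler_pM.
have h3 : `|m - m'| * `|(Num.sqrt (a + eps))^-1| <= `|m - m'| * (Num.sqrt eps)^-1.
  by rewrite ler_wpM2l// ger0_norm// invr_ge0 sqrtr_ge0.
have h4 : 0 <= (Num.sqrt eps)^-1 * `|a - b| by rewrite mulr_ge0// invr_ge0 ltW.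
have h5 : 0 <= M / Num.sqrt eps ^+ 3 * `|m - m'|.
  by rewrite !mulr_ge0// invr_ge0 exprn_ge0// ltW.
lra.
Qed.

End direction.

Section state_norm.
Context {R : realType} {d : nat}.
Implicit Types z : state R d.

Lemma state_norm_leP z (c : R) : 0 <= c ->
  (`|z| <= c <-> forall i, [/\ `|z.1.1 0 i| <= c, `|z.1.2 0 i| <= c & `|z.2 0 i| <= c]).
Proof.
move=> c0; rewrite /Num.norm/= !ge_max; split.
  move=> /andP[/andP[v m] x] i.
  by split; [move: v|move: m|move: x]; apply: le_trans; exact: le_mx_norm.
move=> H; rewrite -andbA; apply/and3P; split; apply: mx_norm_le => // i j; rewrite (ord1 i);
  by case: (H j).
Qed.

Lemma le_state_norm z i :
  [/\ `|z.1.1 0 i| <= `|z|, `|z.1.2 0 i| <= `|z| & `|z.2 0 i| <= `|z|].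
Proof. by have [/(_ (lexx _))] := @state_norm_leP z `|z| (normr_ge0 _). Qed.

Lemma state_norm_x z : `|z.2| <= `|z|.
Proof. by apply: mx_norm_le => // i j; rewrite (ord1 i); have [] := le_state_norm z j. Qed.

Lemma within_continuous_coord (A : set R) (z : R -> state R d) i :
  {within A, continuous z} ->
  [/\ {within A, continuous (fun t => (z t).1.1 0 i)},
      {within A, continuous (fun t => (z t).1.2 0 i)} &
      {within A, continuous (fun t => (z t).2 0 i)}].
Proof.
move=> /within_continuousP cz; split; apply/within_continuousP => t At e e0;
  have [dl d0 H] := cz t At e e0; exists dl => // u Au ut;
  apply: le_lt_trans (H u Au ut); have := le_state_norm (z u - z t) i;
  by case; rewrite !mxE.
Qed.

Lemma within_continuous_state_norm (A : set R) (z : R -> state R d) :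
  {within A, continuous z} -> {within A, continuous (fun t => `|z t|)}.
Proof.
move=> /within_continuousP cz; apply/within_continuousP => t At e e0.
have [dl d0 H] := cz t At e e0; exists dl => // u Au ut.
by rewrite (le_lt_trans (ler_dist_dist _ _))//; exact: H.
Qed.
End state_norm.

(** * Stability of solutions *)

Section flow.
Context {R : realType} {d : nat}.
Variables (F : 'rV[R]_d -> R) (S : 'rV[R]_d -> 'rV[R]_d) (eps : R).
Variables (h r p q : R -> R).

Definition ode_at (z : R -> state R d) (t : R) : Prop := forall i,
  [/\ is_derive t 1 (fun s => (z s).1.1 0 i)
        (p t * S (z t).2 0 i - q t * (z t).1.1 0 i),
      is_derive t 1 (fun s => (z s).1.2 0 i)
        (h t * gradient F (z t).2 0 i - r t * (z t).1.2 0 i)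
    & is_derive t 1 (fun s => (z s).2 0 i)
        (- ((z t).1.2 0 i / Num.sqrt ((z t).1.1 0 i + eps)))].

(** The working notion: equations at times [t > a] only, with two-sided derivatives, and mere
    continuity at [a]. It passes to any later starting time and treats zero and positive starting
    times alike. *)
Definition solution (a : R) (z : R -> state R d) : Prop :=
  [/\ {within `[a, +oo[, continuous z}, forall t, a <= t -> Zplus (z t)
    & forall t, a < t -> ode_at z t].

Lemma solutionW a b z : a <= b -> solution a z -> solution b z.
Proof.
move=> ab [cz zp oz]; split.
- by apply: continuous_subspaceW cz => t /=; rewrite !in_itv/= !andbT; exact: le_trans.
- by move=> t bt; apply: zp; exact: le_trans bt.
- by move=> t bt; apply: oz; exact: le_lt_trans bt.
Qed.

Lemma solution_continuous a s t z : solution a z -> a <= s ->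
  {within `[s, t], continuous z}.
Proof.
move=> [cz _ _] as_; apply: continuous_subspaceW cz => u /=.
by rewrite !in_itv/= andbT => /andP[su _]; exact: le_trans su.
Qed.

Lemma global_solution_solution t0 z0 z : 0 <= t0 ->
  is_global_solution F S eps h r p q t0 z0 z -> solution t0 z.
Proof.
move=> t00 [zt0 zp cz Hz]; split => // t t0t i.
have := Hz t (ltW t0t) (le_lt_trans t00 t0t).
case E : (z t) => [[v m] x] /= [].
move=> /(has_derivative_in_interior t0t)/is_deriveP/has_derivative_in_mx/(_ 0 i)/is_deriveP Dv.
move=> /(has_derivative_in_interior t0t)/is_deriveP/has_derivative_in_mx/(_ 0 i)/is_deriveP Dm.
move=> /(has_derivative_in_interior t0t)/is_deriveP/has_derivative_in_mx/(_ 0 i)/is_deriveP Dx.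
by move: Dv Dm Dx; rewrite !mxE; split.
Qed.

Lemma solution_has_derivative_in t0 z t : solution t0 z -> t0 < t ->
  let: (v, m, x) := z t in
  [/\ has_derivative_in `[t0, +oo[ (fun s => (z s).1.1) t
        (p t *: S x - q t *: v),
      has_derivative_in `[t0, +oo[ (fun s => (z s).1.2) t
        (h t *: gradient F x - r t *: m)
    & has_derivative_in `[t0, +oo[ (fun s => (z s).2) t
        (direction eps v m)].
Proof.
move=> [_ _ oz] t0t; have := oz t t0t; rewrite /ode_at.
case E : (z t) => [[v m] x] /= H.
split; apply/has_derivative_in_mx => i j; rewrite (ord1 i);
  apply: (has_derivative_in_sub (@subsetT _ _)); apply/is_deriveP;
  have [H1 H2 H3] := H j.
- by rewrite !mxE.
- by rewrite [X in is_derive _ _ _ X](_ : _ = h t * gradient F x 0 j - r t * m 0 j) // !mxE.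
- by rewrite /direction mxE.
Qed.

Section stability.
Hypothesis gradF_lip : locally_lipschitz (gradient F).
Hypothesis S_lip : locally_lipschitz S.
Hypothesis eps_gt0 : 0 < eps.

(* The bound [C] only involves the ratios [h / r] and [p / q], so that it does
   not degenerate at a singularity of the coefficients. *)
Lemma linear_comparison (y k l g : R -> R) (s t A C D : R) : s <= t -> 0 <= C ->
  {within `[s, t], continuous y} ->
  (forall u, s < u < t -> is_derive u 1 y (k u * g u - l u * y u)) ->
  (forall u, s < u < t -> [/\ 0 <= k u, 0 <= l u & k u <= C * l u]) ->
  (forall u, s < u < t -> `|g u| <= D) ->
  `|y s| <= A -> 0 <= D -> `|y t| <= A + C * D.
Proof.
move=> st C0 cy dy_ kl gD ysA D0.
have CD : 0 <= C * D by exact: mulr_ge0.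
(* Up to the sign, above the level [A + C * D] one has [k * g <= l * (C * D) <= l * y], so the
   derivative is nonpositive there. *)
have key (b : bool) : (-1) ^+ b * y t <= A + C * D.
  apply: (@barrier_le _ (fun u => (-1) ^+ b * y u)
     (fun u => (-1) ^+ b * (k u * g u - l u * y u)) _ s t st).
  - by apply: within_continuousM => //; exact: within_continuous_cst.
  - by move=> u su; have ? := dy_ u su; apply: is_derive_eq; rewrite /GRing.scale/=; ring.
  - move=> u su; have [k0 l0 kC] := kl u su => yA.
    have h1 : (-1) ^+ b * g u <= D.
      by rewrite (le_trans _ (gD u su))// (le_trans (ler_norm _))// normrMsign.
    have h2 : k u * ((-1) ^+ b * g u) <= l u * (C * D).
      rewrite (le_trans (ler_wpM2l k0 h1))// mulrA [l u * _]mulrC.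
      by rewrite ler_wpM2r.
    have h3 : l u * (C * D) <= l u * ((-1) ^+ b * y u).
      rewrite ler_wpM2l// (le_trans _ (ltW yA))// lerDr.
      exact: le_trans ysA.
    by lra.
  - rewrite (le_trans (ler_norm _))// normrMsign (le_trans ysA)// lerDl//.
by rewrite ler_norml; have := key false; have := key true; rewrite expr0 expr1; lra.
Qed.

(** Let [D] be the maximum over [[s, t]] of the distance between the two [x] components. Comparison
    bounds the differences of [v] and [m] by [dd0 + C * L * D], without a time factor; integrating
    the equation for [x] over a time at most [dl] then gives [D <= dd0 + (dd0 / 2 + D / 2)], and [D]
    is absorbed. The coefficients influence [dl] and [K] through [C] alone, so both are independent
    of [s]. *)
Lemma short_time_stability (M C : R) : 0 <= C ->
  exists2 dl : R, 0 < dl & exists2 K : R, 0 < K &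
  forall (s t : R) (z z' : R -> state R d), s <= t -> t <= s + dl ->
    (forall u, s < u <= t -> [/\ 0 <= h u, 0 <= r u & h u <= C * r u] /\
                             [/\ 0 <= p u, 0 <= q u & p u <= C * q u]) ->
    solution s z -> solution s z' ->
    (forall u, s <= u <= t -> `|z u| <= M /\ `|z' u| <= M) ->
    forall u, s <= u <= t -> `|z u - z' u| <= K * `|z s - z' s|.
Proof.
move=> C0.
have [L1 L10 HG] := locally_lipschitz_ball M gradF_lip.
have [L2 L20 HS] := locally_lipschitz_ball M S_lip.
pose L := L1 + L2.
have L0 : 0 < L by rewrite addr_gt0.
pose Kd := (Num.sqrt eps)^-1 + Num.max M 0 / Num.sqrt eps ^+ 3.
have s0 : 0 < Num.sqrt eps by rewrite sqrtr_gt0.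
have Kd0 : 0 < Kd.
  by rewrite ltr_pwDl// ?invr_gt0// divr_ge0 ?exprn_ge0 ?(ltW s0)// le_max lexx orbT.
pose CL := C * L.
have CL0 : 0 <= CL by rewrite mulr_ge0// ltW.
(* Chosen so that [Kd * (2 * (dd0 + CL * D)) * dl] is at most [(dd0 + D) / 2]. *)
pose dl := (4 * Kd * (1 + CL))^-1.
have dl0 : 0 < dl by rewrite invr_gt0 !mulr_gt0// ltr_wpDr.
exists dl => //; exists (4 + (1 + CL * 4)); first by lra.
move=> s t z z' st tdl coef sz sz' zM.
pose dd0 := `|z s - z' s|.
have dd00 : 0 <= dd0 by exact: normr_ge0.
have cz := solution_continuous (t := t) sz (lexx s).
have cz' := solution_continuous (t := t) sz' (lexx s).
pose w u := z u - z' u.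
have cw : {within `[s, t], continuous w}.
  by move=> u; apply: (@continuousB _ _ _ (z : subspace _ -> _) z'); [exact: cz|exact: cz'].
have cx : {within `[s, t], continuous (fun u => `|(w u).2|)}.
  apply/within_continuousP => u ut e e0.
  have [d1 d10 H] := (within_continuousP _ _).1 cw u ut e e0.
  exists d1 => // u' u't uu'; rewrite (le_lt_trans (ler_dist_dist _ _))//.
  rewrite (le_lt_trans _ (H u' u't uu'))//.
  exact: (state_norm_x (w u' - w u)).
have [um umI Hum] := EVT_max st cx.
pose D := `|(w um).2|.
have D0 : 0 <= D by exact: normr_ge0.
have xD u : s <= u <= t -> `|(z u).2 - (z' u).2| <= D.
  by move=> su; apply: Hum; rewrite in_itv.
have xM u : s <= u <= t -> `|(z u).2| <= M /\ `|(z' u).2| <= M.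
  move=> su; have [h1 h2] := zM u su.
  by split; [exact: le_trans (state_norm_x _) h1|exact: le_trans (state_norm_x _) h2].
have dm u i : s <= u <= t -> `|(w u).1.2 0 i| <= dd0 + C * (L * D) /\
                             `|(w u).1.1 0 i| <= dd0 + C * (L * D).
  move=> /andP[su ut].
  have [_ _ oz] := sz; have [_ _ oz'] := sz'.
  have cwu : {within `[s, u], continuous w}.
    by apply: continuous_subspaceW cw => v /=; rewrite !in_itv/= => /andP[-> /le_trans]; exact.
  have [cv cm _] := within_continuous_coord i cwu.
  have inu v : s < v < u -> s <= v <= t.
    by move=> /andP[/ltW -> /ltW vu] /=; exact: le_trans ut.
  have inu' v : s < v < u -> s < v <= t.
    by move=> /andP[-> /ltW vu] /=; exact: le_trans ut.
  split.
  - apply: (@linear_comparison (fun v => (w v).1.2 0 i) h r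
       (fun v => gradient F (z v).2 0 i - gradient F (z' v).2 0 i) s u) => //.
    + move=> v sv; have [_ d1 _] := oz v (andP sv).1 i; have [_ d2 _] := oz' v (andP sv).1 i.
      rewrite /w; under eq_fun do rewrite !mxE.
      by apply: is_derive_eq; rewrite ?mxE; ring.
    + by move=> v sv; have [] := coef v (inu' v sv).
    + move=> v sv; have [h1 h2] := xM v (inu v sv).
      have := le_mx_norm (gradient F (z v).2 - gradient F (z' v).2) 0 i.
      rewrite !mxE => /le_trans; apply; rewrite (le_trans (HG _ _ h1 h2))//.
      by rewrite ler_pM ?(ltW L10)// ?lerDl ?(ltW L20)// xD// inu.
    + by have [] := le_state_norm (w s) i.
    + by rewrite mulr_ge0// ltW.
  - apply: (@linear_comparison (fun v => (w v).1.1 0 i) p q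
       (fun v => S (z v).2 0 i - S (z' v).2 0 i) s u) => //.
    + move=> v sv; have [d1 _ _] := oz v (andP sv).1 i; have [d2 _ _] := oz' v (andP sv).1 i.
      rewrite /w; under eq_fun do rewrite !mxE.
      by apply: is_derive_eq; rewrite ?mxE; ring.
    + by move=> v sv; have [] := coef v (inu' v sv).
    + move=> v sv; have [h1 h2] := xM v (inu v sv).
      have := le_mx_norm (S (z v).2 - S (z' v).2) 0 i.
      rewrite !mxE => /le_trans; apply; rewrite (le_trans (HS _ _ h1 h2))//.
      by rewrite ler_pM ?(ltW L20)// ?lerDr ?(ltW L10)// xD// inu.
    + by have [] := le_state_norm (w s) i.
    + by rewrite mulr_ge0// ltW.
have dx u i : s <= u <= t -> `|(w u).2 0 i| <= dd0 + Kd * (2 * (dd0 + C * (L * D))) * dl.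
  move=> /andP[su ut].
  have [_ zp oz] := sz; have [_ zp' oz'] := sz'.
  have cwu : {within `[s, u], continuous w}.
    by apply: continuous_subspaceW cw => v /=; rewrite !in_itv/= => /andP[-> /le_trans]; exact.
  have [_ _ cxi] := within_continuous_coord i cwu.
  have inu v : s < v < u -> s <= v <= t.
    by move=> /andP[/ltW -> /ltW vu] /=; exact: le_trans ut.
  pose K2 := Kd * (2 * (dd0 + C * (L * D))).
  have K20 : 0 <= K2.
    by rewrite !mulr_ge0// ?(ltW Kd0)// addr_ge0// !mulr_ge0// ltW.
  pose dir (y : R -> state R d) v := (y v).1.2 0 i / Num.sqrt ((y v).1.1 0 i + eps).
  have : `|(w u).2 0 i - (w s).2 0 i| <= K2 * (u - s).
    apply: (@derive_bound _ (fun v => (w v).2 0 i) (fun v => - dir z v - - dir z' v)) => //.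
      move=> v sv; have [_ _ d1] := oz v (andP sv).1 i; have [_ _ d2] := oz' v (andP sv).1 i.
      by rewrite /w; under eq_fun do rewrite !mxE; exact: is_deriveB.
    move=> v sv; rewrite opprK addrC distrC.
    have [h1 h2] := dm v i (inu v sv).
    rewrite /w !mxE in h1 h2.
    rewrite (le_trans (@direction_lipschitz _ eps _ _ _ _ (Num.max M 0) eps_gt0 _ _ _))//.
    + by apply: zp; case/andP: sv => /ltW.
    + by apply: zp'; case/andP: sv => /ltW.
    + have [_ h3] := zM v (inu v sv); rewrite le_max.
      by have [_ h4 _] := le_state_norm (z' v) i; rewrite (le_trans h4).
    + by rewrite -/Kd /K2 ler_wpM2l ?(ltW Kd0)//; lra.
  have usdl : K2 * (u - s) <= K2 * dl by rewrite ler_wpM2l//; lra.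
  have ws : `|(w s).2 0 i| <= dd0 by have [] := le_state_norm (w s) i.
  have := ler_normD ((w u).2 0 i - (w s).2 0 i) ((w s).2 0 i); rewrite subrK -/K2.
  by lra.
have Kdl : Kd * (2 * (dd0 + C * (L * D))) * dl <= dd0 / 2 + D / 2.
  have -> : Kd * (2 * (dd0 + C * (L * D))) * dl = (dd0 + CL * D) / (2 * (1 + CL)).
    by rewrite /dl /CL; field; rewrite ?gt_eqF// ?ltr_wpDr ?Kd0.
  rewrite ler_pdivrMr; last by rewrite mulr_gt0// ltr_wpDr.
  have := mulr_ge0 CL0 dd00.
  by lra.
have DD : D <= 4 * dd0.
  have : D <= dd0 + (dd0 / 2 + D / 2).
    apply: mx_norm_le; first by rewrite !addr_ge0// divr_ge0.
    have umst : s <= um <= t by move: umI; rewrite in_itv.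
    by move=> i j; rewrite (ord1 i) (le_trans (dx um j umst))// lerD2l.
  by lra.
have final : dd0 + C * (L * D) <= (4 + (1 + CL * 4)) * dd0.
  by rewrite mulrA -/CL; have := ler_wpM2l CL0 DD; lra.
move=> u su; apply/state_norm_leP.
  by rewrite mulr_ge0//; lra.
move=> i; have [h1 h2] := dm u i su; split.
- exact: le_trans h2 final.
- exact: le_trans h1 final.
- have := dx u i su; have := mulr_ge0 CL0 dd00; rewrite -/(w u) -/dd0; lra.
Qed.

End stability.
End flow.

(** * Energy estimate and a priori bounds *)

Section coefficients.
Context {R : realType}.
Implicit Types (f : R -> R).

Lemma nonincreasing_cvg_ge f (l : R) :
  (forall s t : R, 0 < s -> s <= t -> f t <= f s) -> f t @[t --> +oo] --> l ->
  forall t : R, 0 < t -> l <= f t.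
Proof.
move=> fn fl t t0; apply: (cvgr_to_le fl).
by exists t; split; [exact: num_real|move=> s /ltW ts; exact: fn].
Qed.

Lemma derive1_le0_nonincreasing f :
  (forall t : R, 0 < t -> derivable f t 1) ->
  (forall t : R, 0 < t -> derive1 f t <= 0) ->
  forall s t : R, 0 < s -> s <= t -> f t <= f s.
Proof.
move=> df f0 s t s0 st.
apply: (@derive_le0_le _ f (derive1 f) s t st).
- apply: derivable_within_continuous => u; rewrite in_itv/= => /andP[su _].
  by apply: df; exact: lt_le_trans su.
- move=> u /andP[su _]; apply: DeriveDef; last by rewrite derive1E.
  by apply: df; exact: lt_trans su.
- by move=> u /andP[su _]; apply: f0; exact: lt_trans su.
Qed.

Lemma continuous_cvg_bounded f (l a : R) : 0 < a ->
  (forall t : R, 0 < t -> {for t, continuous f}) -> f t @[t --> +oo] --> l ->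
  exists2 C : R, 0 < C & forall t, a <= t -> `|f t| <= C.
Proof.
move=> a0 cf fl.
have [M [_ HM]] : \forall t \near +oo, `|l - f t| < 1.
  by move/cvgrPdist_lt : fl; apply.
pose T := Num.max M a + 1.
have aT : a <= T by rewrite /T (@le_trans _ _ (Num.max M a)) ?lerDl// le_max lexx orbT.
have cn : {within `[a, T], continuous (fun t => `|f t|)}.
  apply/subspace_continuousP => t; rewrite /= in_itv/= => /andP[a_t _].
  apply: cvg_within_filter; apply: cvg_norm; apply: cf; exact: lt_le_trans a_t.
have [c _ Hc] := EVT_max aT cn.
exists (`|f c| + `|l| + 1); first by rewrite ltr_wpDl// addr_ge0.
move=> t a_t; have [tT|Tt] := leP t T.
  have := Hc t; rewrite in_itv/= a_t tT => /(_ isT) /le_trans; apply.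
  by rewrite -addrA lerDl addr_ge0.
have Mt : M < t.
  by rewrite (le_lt_trans _ Tt)// /T (@le_trans _ _ (Num.max M a)) ?lerDl// le_max lexx.
have := HM t Mt; have := ler_distD l (f t) 0; rewrite !subr0 distrC.
by have := normr_ge0 (f c); lra.
Qed.

End coefficients.

Section lyapunov.
Context {R : realType} {d : nat}.
Variables (F : 'rV[R]_d -> R) (S : 'rV[R]_d -> 'rV[R]_d) (eps : R).
Variables (h r p q : R -> R).
Hypothesis F_C1 : C1_function F.
Hypothesis F_coercive : coercive_function F.
Hypothesis S_ge0 : forall x i, 0 <= S x 0 i.
Hypothesis S_lip : locally_lipschitz S.
Hypothesis eps_gt0 : 0 < eps.
Hypothesis coef_ge0 : forall t : R, 0 < t -> [/\ 0 <= h t, 0 <= r t, 0 <= p t & 0 <= q t].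
Hypothesis coef_cont : forall t : R, 0 < t ->
    [/\ {for t, continuous h}, {for t, continuous r},
        {for t, continuous p} & {for t, continuous q}].
Hypothesis h_derivable : forall t : R, 0 < t -> derivable h t 1.
Hypothesis h_noninc : forall t : R, 0 < t -> derive1 h t <= 0.
Hypothesis r_ge_q4 : forall t : R, 0 < t -> q t / 4 <= r t.

Definition energy (c : R) (z : R -> state R d) (t : R) : R :=
  h t * (F (z t).2 - c) +
  \sum_i (z t).1.2 0 i ^+ 2 / (2 * Num.sqrt ((z t).1.1 0 i + eps)).

Lemma energy_term_derive (v m dv dm : R -> R) (t : R) : 0 <= v t ->
  is_derive t 1 v (dv t) -> is_derive t 1 m (dm t) ->
  is_derive t 1 (fun s => m s ^+ 2 / (2 * Num.sqrt (v s + eps)))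
   (m t * dm t / Num.sqrt (v t + eps) - m t ^+ 2 * dv t / (4 * Num.sqrt (v t + eps) ^+ 3)).
Proof.
move=> v0 Dv Dm.
have ve : 0 < v t + eps by rewrite ltr_wpDl.
have s0 : Num.sqrt (v t + eps) != 0 by rewrite gt_eqF// sqrtr_gt0.
have D1 : is_derive t 1 (fun s => Num.sqrt (v s + eps))
    ((2 * Num.sqrt (v t + eps))^-1 * dv t).
  apply: (@is_derive1_comp _ Num.sqrt (fun s => v s + eps)).
    exact: is_derive1_sqrt.
  by apply: is_derive_eq; rewrite addr0.
have D2 : is_derive t 1 (fun s => (2 * Num.sqrt (v s + eps))^-1)
    (- (2 * Num.sqrt (v t + eps)) ^- 2 *: (2 * ((2 * Num.sqrt (v t + eps))^-1 * dv t))).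
  apply: is_deriveV; first by rewrite mulf_neq0.
apply: is_derive_eq; rewrite /GRing.scale/=.
by field.
Qed.


(** The terms in [gradient F] cancel, while the one in [derive1 h] and the one in [p * S] are
    nonpositive. Writing [v] as [sg ^+ 2 - eps], the term in [q * v] becomes [q * m ^+ 2 / (4 * sg)]
    minus a nonnegative quantity, which is the origin of [q / 4]. *)
Lemma energy_derive (c : R) (z : R -> state R d) (t : R) : 0 < t ->
  (forall x, c <= F x) -> Zplus (z t) -> ode_at F S eps h r p q z t ->
  exists2 dE : R, is_derive t 1 (energy c z) dE &
    dE <= - \sum_i (r t - q t / 4) * ((z t).1.2 0 i ^+ 2 / Num.sqrt ((z t).1.1 0 i + eps)).
Proof.
move=> t0 Fc zp oz.
pose sg i := Num.sqrt ((z t).1.1 0 i + eps).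
have ve i : 0 < (z t).1.1 0 i + eps by rewrite ltr_wpDl// zp.
have sg0 i : 0 < sg i by rewrite sqrtr_gt0.
have sg2 i : sg i ^+ 2 = (z t).1.1 0 i + eps by rewrite sqr_sqrtr// ltW.
pose m i := (z t).1.2 0 i; pose x := (z t).2.
pose dv i := p t * S x 0 i - q t * (z t).1.1 0 i.
pose dm i := h t * gradient F x 0 i - r t * m i.
pose l : 'rV[R]_d := \row_i (- (m i / sg i)).
have DF : is_derive t 1 (fun s => F (z s).2) (\sum_i l 0 i * gradient F x 0 i).
  apply: (@is_derive_comp_gradient _ _ F (fun s => (z s).2)); first exact: F_C1.1.
  by move=> i; rewrite mxE; have [_ _] := oz i.
have Dh : is_derive t 1 h (derive1 h t).
  by apply: DeriveDef; [exact: h_derivable|rewrite derive1E].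
have Dt i : is_derive t 1
    (fun s => (z s).1.2 0 i ^+ 2 / (2 * Num.sqrt ((z s).1.1 0 i + eps)))
    (m i * dm i / sg i - m i ^+ 2 * dv i / (4 * sg i ^+ 3)).
  have [D1 D2 _] := oz i.
  exact: (@energy_term_derive (fun s => (z s).1.1 0 i) (fun s => (z s).1.2 0 i)
    (fun=> dv i) (fun=> dm i) t (zp i) D1 D2).
have Ds := is_derive_sum Dt.
exists (derive1 h t * (F x - c) + h t * (\sum_i l 0 i * gradient F x 0 i) +
    \sum_i (m i * dm i / sg i - m i ^+ 2 * dv i / (4 * sg i ^+ 3))).
  rewrite /energy.
  rewrite [X in is_derive _ _ X _](_ : _ = (fun s => h s * (F (z s).2 - c)) +
    \sum_(i < d) (fun s => (z s).1.2 0 i ^+ 2 / (2 * Num.sqrt ((z s).1.1 0 i + eps)))); last first.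
    by apply/funext => s; rewrite [in RHS]/GRing.add/= fct_sumE.
  apply: is_deriveD.
  by apply: is_derive_eq; rewrite /GRing.scale/= subr0 addrC mulrC.
rewrite mulr_sumr -addrA -big_split/= -sumrN.
have h1 : derive1 h t * (F x - c) <= 0.
  by rewrite mulr_le0_ge0 ?h_noninc// subr_ge0.
rewrite -[leRHS]add0r lerD//; apply: ler_sum => i _.
have [h0 r0 p0 q0] := coef_ge0 t0.
rewrite mxE -/(m i) -/(sg i) /dm /dv.
have vE : (z t).1.1 0 i = sg i ^+ 2 - eps by rewrite sg2 addrK.
rewrite vE -subr_ge0.
have -> : - ((r t - q t / 4) * (m i ^+ 2 / sg i)) -
   (h t * (- (m i / sg i) * gradient F x 0 i) +
   (m i * (h t * gradient F x 0 i - r t * m i) / sg i -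
    m i ^+ 2 * (p t * S x 0 i - q t * (sg i ^+ 2 - eps)) / (4 * sg i ^+ 3))) =
   m i ^+ 2 * (p t * S x 0 i + q t * eps) / (4 * sg i ^+ 3).
  by field; rewrite gt_eqF.
apply: divr_ge0.
  by rewrite mulr_ge0 ?sqr_ge0// addr_ge0 ?mulr_ge0 ?S_ge0// ltW.
by rewrite mulr_ge0// exprn_ge0// ltW.
Qed.

Lemma energy_nonincreasing (c a b : R) (z : R -> state R d) : 0 < a -> a <= b ->
  (forall x, c <= F x) ->
  {within `[a, b], continuous z} -> (forall t, a <= t <= b -> Zplus (z t)) ->
  (forall t, a < t < b -> ode_at F S eps h r p q z t) ->
  energy c z b <= energy c z a.
Proof.
move=> a0 ab Fc cz zp oz.
pose dE t := derive1 (energy c z) t.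
have DE t : a < t < b -> is_derive t 1 (energy c z) (dE t) /\ dE t <= 0.
  move=> abt; have t0 : 0 < t by case/andP: abt => at_ _; exact: lt_trans at_.
  have abt' : a <= t <= b by case/andP: abt => /ltW -> /ltW ->.
  have [D HD Dle] := energy_derive t0 Fc (zp t abt') (oz t abt).
  have -> : dE t = D by rewrite /dE derive1E; case: HD.
  split => //; rewrite (le_trans Dle)// oppr_le0 sumr_ge0// => i _.
  by rewrite mulr_ge0 ?subr_ge0 ?r_ge_q4// divr_ge0 ?sqr_ge0// sqrtr_ge0.
apply: (@derive_le0_le _ (energy c z) dE a b ab); last 2 first.
- by move=> t /DE[].
- by move=> t /DE[].
rewrite /energy; apply: within_continuousD.
  apply: within_continuousM.
    apply/subspace_continuousP => t; rewrite /= in_itv/= => /andP[at_ _].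
    apply: cvg_within_filter.
    by have [] := coef_cont (lt_le_trans a0 at_).
  apply: within_continuousB; last exact: within_continuous_cst.
  apply/within_continuousP => t tab e e0.
  have /cvgrPdist_lt/(_ e e0)/nbhs_ballP[e1 /= e10 H1] :=
    differentiable_continuous (F_C1.1 (z t).2).
  have [dl dl0 Hd] := (within_continuousP _ _).1 cz t tab e1 e10.
  exists dl => // u uab ut; rewrite distrC; apply: H1.
  rewrite -ball_normE/= distrC (le_lt_trans _ (Hd u uab ut))//.
  exact: (state_norm_x (z u - z t)).
apply: within_continuous_sum => i.
have [cv cm _] := within_continuous_coord i cz.
apply: within_continuousM; first exact: (within_continuousM cm cm).
have csq : {within `[a, b], continuous (fun t => 2 * Num.sqrt ((z t).1.1 0 i + eps))}.
  apply: within_continuousM; first exact: within_continuous_cst.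
  move=> t; apply: (@continuous_comp _ _ _ (fun t : subspace _ => (z t).1.1 0 i + eps) Num.sqrt).
    by have := within_continuousD cv (within_continuous_cst (A:=`[a, b]%classic) (c:=eps)); exact.
  exact: sqrt_continuous.
apply/subspace_continuousP => t tab; apply: cvgV.
  rewrite mulf_neq0// gt_eqF// sqrtr_gt0 ltr_wpDl// zp//.
by move/subspace_continuousP : csq => /(_ t tab).
Qed.

Variables (hinf rinf qinf pinf : R).
Hypothesis hinf_gt0 : 0 < hinf.
Hypothesis qinf_gt0 : 0 < qinf.
Hypothesis h_ge : forall t : R, 0 < t -> hinf <= h t.
Hypothesis q_ge : forall t : R, 0 < t -> qinf <= q t.
Hypothesis p_cvg : p t @[t --> +oo] --> pinf.

(** [M] is fixed before the trajectory and the final time [b], and only [[a, b]] is looked at: the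
    bound thus applies to a truncated flow for as long as the truncation is inactive. *)
Lemma apriori_bound (a : R) (z0 : state R d) : 0 < a -> Zplus z0 ->
  exists2 M : R, 0 < M & forall (b : R) (z : R -> state R d), a <= b -> z a = z0 ->
  {within `[a, b], continuous z} -> (forall t, a <= t <= b -> Zplus (z t)) ->
  (forall t, a < t < b -> ode_at F S eps h r p q z t) -> `|z b| <= M.
Proof.
move=> a0 z0p.
have cF : continuous F by move=> x; apply: differentiable_continuous; exact: F_C1.1.
have [c Fc] := coercive_lbound cF F_coercive.
pose E0 := h a * (F z0.2 - c) +
  \sum_i z0.1.2 0 i ^+ 2 / (2 * Num.sqrt (z0.1.1 0 i + eps)).
(* Since [hinf * (F x - c)] is at most the energy, hence at most [E0], the position cannot leave the
   ball of radius [Num.max Mx 0]. *)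
have [Mx HMx] := F_coercive (E0 / hinf + c).
have [L L0 HL] := locally_lipschitz_ball (Num.max Mx 0) S_lip.
pose Smax := `|S 0| + L * Num.max Mx 0.
have Smax0 : 0 <= Smax by rewrite addr_ge0// mulr_ge0 ?(ltW L0)// le_max lexx orbT.
have [P P0 HP] := continuous_cvg_bounded a0
  (fun t t0 => let: And4 _ _ cp _ := coef_cont t0 in cp) p_cvg.
(* A barrier for [v]: above this level [p * S <= P * Smax <= qinf * v <= q * v]. *)
pose Vm := `|z0| + P * Smax / qinf.
have Vm0 : 0 <= Vm by rewrite addr_ge0// divr_ge0 ?mulr_ge0// ltW.
(* Bounds the square of each coordinate of [m], whose energy term is at most [E0], using
   [v <= Vm]. *)
pose Mm2 := 2 * E0 * Num.sqrt (Vm + eps).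
exists (`|Mx| + Vm + `|Mm2| + 1).
  by have := normr_ge0 Mx; have := normr_ge0 Mm2; lra.
move=> b z ab za cz zp oz.
have sub t : a <= t <= b -> [/\ {within `[a, t], continuous z},
    forall u, a <= u <= t -> Zplus (z u) &
    forall u, a < u < t -> ode_at F S eps h r p q z u].
  move=> /andP[at_ tb]; split.
  - by apply: continuous_subspaceW cz => v /=; rewrite !in_itv/= => /andP[-> /le_trans]; exact.
  - by move=> u /andP[au ut]; apply: zp; rewrite au (le_trans ut).
  - by move=> u /andP[au ut]; apply: oz; rewrite au (lt_le_trans ut).
have energy_term_ge0 t i : 0 <= (z t).1.2 0 i ^+ 2 / (2 * Num.sqrt ((z t).1.1 0 i + eps)).
  by rewrite divr_ge0 ?sqr_ge0// mulr_ge0// sqrtr_ge0.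
have Et t : a <= t <= b -> energy c z t <= E0.
  move=> tab; have [c1 c2 c3] := sub t tab.
  have -> : E0 = energy c z a by rewrite /energy za.
  by apply: energy_nonincreasing => //; case/andP: tab.
have xM t : a <= t <= b -> `|(z t).2| <= Num.max Mx 0.
  move=> tab; have t0 : 0 < t by case/andP: tab => at_ _; exact: lt_le_trans at_.
  rewrite leNgt; apply/negP; rewrite gt_max => /andP[/HMx + _].
  apply/negP; rewrite -leNgt -lerBlDr ler_pdivlMr//.
  rewrite (le_trans _ (Et t tab))// /energy (@le_trans _ _ (h t * (F (z t).2 - c)))//.
    by rewrite mulrC ler_wpM2r ?h_ge// subr_ge0.
  by rewrite lerDl sumr_ge0.
have vM t i : a <= t <= b -> (z t).1.1 0 i <= Vm.
  move=> tab; have [c1 c2 c3] := sub t tab.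
  have [cv _ _] := within_continuous_coord i c1.
  have at_ : a <= t by case/andP: tab.
  apply: (@barrier_le _ (fun u => (z u).1.1 0 i)
    (fun u => p u * S (z u).2 0 i - q u * (z u).1.1 0 i) Vm a t) => //.
  - by move=> u /c3/(_ i)[].
  - move=> u ut vu.
    have u0 : 0 < u by case/andP: ut => au _; exact: lt_trans au.
    have uab : a <= u <= b.
      by case/andP: ut => /ltW -> /ltW ut /=; rewrite (le_trans ut)//; case/andP: tab.
    have Su : S (z u).2 0 i <= Smax.
      have := HL (z u).2 0 (xM u uab); rewrite normr0 le_max lexx orbT => /(_ isT).
      rewrite subr0 => HLu.
      have h1 := le_mx_norm (S (z u).2 - S 0) 0 i.
      have h2 := le_mx_norm (S 0) 0 i.
      have h3 : L * `|(z u).2| <= L * Num.max Mx 0 by rewrite ler_wpM2l ?(ltW L0)// xM.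
      rewrite !mxE in h1.
      have := ler_norm (S (z u).2 0 i - S 0 0 i); have := ler_norm (S 0 0 i).
      by rewrite /Smax; lra.
    have pu : p u <= P.
      by rewrite (le_trans (ler_norm _))// HP//; case/andP: uab.
    have [_ _ p0 q0] := coef_ge0 u0.
    have pS : p u * S (z u).2 0 i <= P * Smax by rewrite ler_pM.
    have qv : P * Smax <= q u * (z u).1.1 0 i.
      have : P * Smax / qinf <= (z u).1.1 0 i.
        by rewrite (le_trans _ (ltW vu))// /Vm lerDr.
      rewrite ler_pdivrMr// [_ * qinf]mulrC => /le_trans; apply.
      by rewrite ler_wpM2r ?q_ge// zp.
    by lra.
  - rewrite za /Vm; have [] := le_state_norm z0 i => + _ _.
    move=> /(le_trans (ler_norm _)) /le_trans; apply.
    by rewrite lerDl divr_ge0// ?mulr_ge0// ltW.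
have bab : a <= b <= b by rewrite ab lexx.
have nMm := normr_ge0 Mm2; have nMx := normr_ge0 Mx.
apply/state_norm_leP; first by lra.
have xMb := xM b bab.
have Mx_le : Num.max Mx 0 <= `|Mx| by rewrite ge_max ler_norm/=.
move=> i; split.
- rewrite ger0_norm; last exact: zp.
  by have := vM b i bab; lra.
- have se0 : 0 < Num.sqrt ((z b).1.1 0 i + eps).
    by rewrite sqrtr_gt0 ltr_wpDl// zp.
  have m2 : (z b).1.2 0 i ^+ 2 <= Mm2.
    have : (z b).1.2 0 i ^+ 2 / (2 * Num.sqrt ((z b).1.1 0 i + eps)) <= E0.
      rewrite (le_trans _ (Et b bab))// /energy (bigD1 i)//= addrCA lerDl.
      rewrite addr_ge0// ?sumr_ge0//.
      have b0 := lt_le_trans a0 ab; have [h0 _ _ _] := coef_ge0 b0.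
      by rewrite mulr_ge0// subr_ge0.
    rewrite ler_pdivrMr ?mulr_gt0// => /le_trans; apply.
    have E00 : 0 <= E0.
      rewrite addr_ge0//; last first.
        by rewrite -za; apply: sumr_ge0.
      by have [h0 _ _ _] := coef_ge0 a0; rewrite mulr_ge0// subr_ge0.
    rewrite /Mm2 mulrA [E0 * 2]mulrC ler_wpM2l ?mulr_ge0//.
    by rewrite ler_wsqrtr// lerD2r vM.
  (* From [y ^+ 2 <= c] follows [y <= c + 1], which spares a square root. *)
  have h1 : `|(z b).1.2 0 i| <= `|Mm2| + 1.
    have := ler_norm Mm2.
    have : `|(z b).1.2 0 i| ^+ 2 = (z b).1.2 0 i ^+ 2 by rewrite real_normK// num_real.
    by have := normr_ge0 ((z b).1.2 0 i); nra.
  by lra.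
- by have := le_mx_norm (z b).2 0 i; lra.
Qed.

End lyapunov.

(** * Stability over long times and uniqueness *)

Section uniqueness.
Context {R : realType} {d : nat}.
Variables (F : 'rV[R]_d -> R) (S : 'rV[R]_d -> 'rV[R]_d) (eps : R).
Variables (h r p q : R -> R).
Hypothesis gradF_lip : locally_lipschitz (gradient F).
Hypothesis S_lip : locally_lipschitz S.
Hypothesis eps_gt0 : 0 < eps.
Hypothesis coef_ge0 : forall t : R, 0 < t -> [/\ 0 <= h t, 0 <= r t, 0 <= p t & 0 <= q t].

Let sol := solution F S eps h r p q.

Lemma solution_bounded_segment (a b : R) z : sol a z ->
  exists M, forall u, a <= u <= b -> `|z u| <= M.
Proof.
move=> sz; have [ab|ba] := leP a b; last first.
  by exists 0 => u /andP[au /(le_trans au)]; rewrite leNgt ba.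
have cz := within_continuous_state_norm (solution_continuous (t := b) sz (lexx a)).
have [c _ Hc] := EVT_max ab cz; exists `|z c| => u ub.
by apply: Hc; rewrite in_itv.
Qed.

(** The short-time estimate is iterated over [N] windows of length [dl], with [N] determined by [T]
    and [dl]: the constant is the same for all starting times, however close to 0. *)
Lemma long_time_stability (M C T : R) : 0 <= C ->
  exists2 K : R, 0 < K &
  forall (s t : R) (z z' : R -> state R d), s <= t -> t <= s + T ->
    (forall u, s < u <= t -> [/\ 0 <= h u, 0 <= r u & h u <= C * r u] /\
                             [/\ 0 <= p u, 0 <= q u & p u <= C * q u]) ->
    sol s z -> sol s z' ->
    (forall u, s <= u <= t -> `|z u| <= M /\ `|z' u| <= M) ->
    forall u, s <= u <= t -> `|z u - z' u| <= K * `|z s - z' s|.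
Proof.
move=> C0; have [dl dl0 [K K0 HK]] :=
  short_time_stability h r p q gradF_lip S_lip eps_gt0 M C0.
(* With a base at least 1 the powers are nondecreasing, so a bound reached after fewer windows
   remains valid. *)
have K1 : 1 <= K + 1 by rewrite lerDr ltW.
pose N := (Num.trunc (T / dl)).+1.
have TN : T <= N%:R * dl by rewrite -ler_pdivrMr// ltW// truncnS_gt.
exists ((K + 1) ^+ N); first by rewrite exprn_gt0// ltr_wpDl// ltW.
move=> s t z z' st tT coef sz sz' zM.
have key n : forall u, s <= u <= t -> u <= s + n%:R * dl ->
    `|z u - z' u| <= (K + 1) ^+ n * `|z s - z' s|.
  elim: n => [|n IH] u /andP[su ut] un.
    have -> : u = s by apply/eqP; rewrite eq_le su andbT; move: un; rewrite mul0r addr0.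
    by rewrite expr0 mul1r.
  have n0 : 0 <= (K + 1) ^+ n * `|z s - z' s|.
    by rewrite mulr_ge0// exprn_ge0// (le_trans ler01).
  have [us|su'] := leP u (s + n%:R * dl).
    rewrite (le_trans (IH u _ us)) ?su// exprS -mulrA.
    by rewrite ler_peMl.
  pose s' := s + n%:R * dl.
  have ss' : s <= s' by rewrite lerDl mulr_ge0// ltW.
  have s't : s' <= t by exact: le_trans (ltW su') ut.
  have us' : u <= s' + dl by move: un; rewrite /s' -natr1 mulrDl mul1r addrA.
  rewrite (le_trans (HK s' u z z' (ltW su') us' _ (solutionW ss' sz) (solutionW ss' sz') _ u _))//.
  - by move=> w /andP[sw wu]; apply: coef; rewrite (le_lt_trans ss')//= (le_trans wu).
  - by move=> w /andP[sw wu]; apply: zM; rewrite (le_trans ss')//= (le_trans wu).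
  - by rewrite ltW//=.
  - rewrite exprS -mulrA ler_pM//; first exact: ltW.
      by rewrite lerDl.
    by apply: IH; rewrite ?ss'.
move=> u sut; apply: key => //.
by case/andP: sut => _ /le_trans; apply; rewrite (le_trans tT)// lerD2l.
Qed.

(** Continuity bounds both trajectories on [[a, t]], and stability with equal initial data makes
    their difference vanish. The start [a = 0] is allowed because stability sees only the ratios of
    the coefficients. *)
Lemma solution_unique (a C T : R) z z' : 0 <= a -> 0 <= C ->
  (forall u, a < u <= T -> h u <= C * r u /\ p u <= C * q u) ->
  sol a z -> sol a z' -> z a = z' a ->
  forall t, a <= t <= T -> z t = z' t.
Proof.
move=> a0 C0 ratio sz sz' za t /andP[at_ tT].
have [M1 HM1] := solution_bounded_segment t sz.
have [M2 HM2] := solution_bounded_segment t sz'.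
have [K K0 HK] := long_time_stability (Num.max M1 M2) (t - a) C0.
have := HK a t z z' at_ _ _ sz sz' _ t.
rewrite za subrr normr0 mulr0 at_ lexx addrC subrK => H.
apply/eqP; rewrite -subr_eq0 -normr_le0; apply: H => //.
- move=> u /andP[au ut].
  have [? ? ? ?] := coef_ge0 (le_lt_trans a0 au).
  by have [|? ?] := ratio u; rewrite ?au ?(le_trans ut).
- by move=> u ut; rewrite !le_max HM1// HM2// orbT.
Qed.

End uniqueness.

(** * Global existence from a positive time *)

Section clamp.
Context {R : realType}.
Implicit Types B x y : R.

Definition clamp B x : R := Num.max (- B) (Num.min x B).

Lemma clamp_norm B x : 0 <= B -> `|clamp B x| <= B.
Proof.
move=> B0; rewrite ler_norml /clamp le_max lexx/= ge_max ge_min lexx orbT andbT.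
by rewrite lerNl; lra.
Qed.

Lemma clamp_id B x : `|x| <= B -> clamp B x = x.
Proof.
by rewrite ler_norml => /andP[Bx xB]; rewrite /clamp min_l// max_r.
Qed.

Lemma max_lipschitz B x y : `|Num.max x B - Num.max y B| <= `|x - y|.
Proof.
have h1 := ler_norm (x - y); have h2 := ler_norm (y - x).
rewrite distrC in h2.
by case: (leP x B) => ?; case: (leP y B) => ?; rewrite ler_norml;
  apply/andP; split; lra.
Qed.

Lemma min_lipschitz B x y : `|Num.min x B - Num.min y B| <= `|x - y|.
Proof.
have h1 := ler_norm (x - y); have h2 := ler_norm (y - x).
rewrite distrC in h2.
by case: (leP x B) => ?; case: (leP y B) => ?; rewrite ler_norml;
  apply/andP; split; lra.
Qed.

Lemma clamp_lipschitz B x y : `|clamp B x - clamp B y| <= `|x - y|.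
Proof.
rewrite /clamp ![Num.max (- B) _]maxC.
exact: le_trans (max_lipschitz _ _ _) (min_lipschitz _ _ _).
Qed.

Definition clamp_row d B (x : 'rV[R]_d) : 'rV[R]_d := \row_i clamp B (x 0 i).

Lemma clamp_row_norm d B (x : 'rV[R]_d) : 0 <= B -> `|clamp_row B x| <= B.
Proof. by move=> B0; apply: mx_norm_le => // i j; rewrite mxE clamp_norm. Qed.

Lemma clamp_row_lipschitz d B (x y : 'rV[R]_d) :
  `|clamp_row B x - clamp_row B y| <= `|x - y|.
Proof.
apply: mx_norm_le => // i j.
rewrite !mxE (le_trans (clamp_lipschitz _ _ _))//.
by have := le_mx_norm (x - y) 0 j; rewrite !mxE.
Qed.

Lemma clamp_row_id d B (x : 'rV[R]_d) : `|x| <= B -> clamp_row B x = x.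
Proof.
move=> xB; apply/rowP => i; rewrite mxE clamp_id//.
exact: le_trans (le_mx_norm _ _ _) xB.
Qed.

End clamp.

(** * The truncated vector field *)

Section truncation.
Context {R : realType} {d : nat}.
Variables (G S : 'rV[R]_d -> 'rV[R]_d) (eps B : R).
Variables (h r p q : R -> R).
Hypothesis G_lip : locally_lipschitz G.
Hypothesis S_lip : locally_lipschitz S.
Hypothesis eps_gt0 : 0 < eps.
Hypothesis B0 : 0 <= B.
Hypothesis coef_cont : [/\ continuous h, continuous r, continuous p & continuous q].
Variable C : R.
Hypothesis coef_bound : forall t, [/\ `|h t| <= C, `|r t| <= C, `|p t| <= C & `|q t| <= C].

Local Notation vrow Z := (row (@Ordinal 3 0 isT) Z).
Local Notation mrow Z := (row (@Ordinal 3 1 isT) Z).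
Local Notation xrow Z := (row (@Ordinal 3 2 isT) Z).

(** The state is packed into a matrix with rows [v], [m], [x], the form taken by the Picard theorem.
    The linear occurrences of [v] and [m] are already Lipschitz; the clamp acts on [x] inside [S]
    and [G] and on [m] in the quotient, and [v] is cut at 0 to keep the root away from its
    singularity. *)
Definition truncated_field (t : R) (Z : 'M[R]_(3, d)) : 'M[R]_(3, d) :=
  \matrix_(k, j) match val k with
    | 0%N => p t * S (clamp_row B (xrow Z)) 0 j - q t * vrow Z 0 j
    | 1%N => h t * G (clamp_row B (xrow Z)) 0 j - r t * mrow Z 0 j
    | _ => - (clamp B (mrow Z 0 j) / Num.sqrt (Num.max (vrow Z 0 j) 0 + eps))
    end.

Lemma row_norm (Z : 'M[R]_(3, d)) k : `|row k Z| <= `|Z|.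
Proof. by apply: mx_norm_le => // i j; rewrite mxE le_mx_norm. Qed.

Let C0 : 0 <= C.
Proof. by have [+ _ _ _] := coef_bound 0; exact: le_trans. Qed.

Lemma truncated_field_continuous Z : continuous (truncated_field ^~ Z).
Proof.
have [ch cr cp cq] := coef_cont.
move=> t; apply: cvg_mx => -[[|[|[|//]]] k3] j; rewrite /truncated_field mxE/=;
  under eq_fun do rewrite mxE/=.
- by apply: cvgB; apply: cvgMl; [exact: cp|exact: cq].
- by apply: cvgB; apply: cvgMl; [exact: ch|exact: cr].
- exact: cvg_cst.
Qed.

Lemma truncated_field_lipschitz : exists2 K : R, 1 <= K & forall t Y Z,
  `|truncated_field t Y - truncated_field t Z| <= K * `|Y - Z|.
Proof.
have [L1 L10 HG] := locally_lipschitz_ball B G_lip.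
have [L2 L20 HS] := locally_lipschitz_ball B S_lip.
pose Kd := (Num.sqrt eps)^-1 + B / Num.sqrt eps ^+ 3.
have s0 : 0 < Num.sqrt eps by rewrite sqrtr_gt0.
have Kd0 : 0 < Kd by rewrite ltr_pwDl ?invr_gt0// divr_ge0 ?exprn_ge0 ?(ltW s0).
have CL1 : 0 <= C * L1 by rewrite mulr_ge0// ltW.
have CL2 : 0 <= C * L2 by rewrite mulr_ge0// ltW.
exists (1 + C * L1 + C * L2 + C + 2 * Kd); first by have := C0; lra.
move=> t Y Z; have YZ0 := normr_ge0 (Y - Z).
have [ht rt pt qt] := coef_bound t.
have xYZ : `|clamp_row B (xrow Y) - clamp_row B (xrow Z)| <= `|Y - Z|.
  rewrite (le_trans (clamp_row_lipschitz _ _ _))//.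
  rewrite (_ : _ - _ = xrow (Y - Z)) ?row_norm//.
  by apply/rowP => i; rewrite !mxE.
have linear (c b L : R) (f : 'rV[R]_d -> 'rV[R]_d) k j : `|c| <= C -> `|b| <= C -> 0 < L ->
    (forall x y, `|x| <= B -> `|y| <= B -> `|f x - f y| <= L * `|x - y|) ->
    `|c * f (clamp_row B (xrow Y)) 0 j - b * row k Y 0 j -
      (c * f (clamp_row B (xrow Z)) 0 j - b * row k Z 0 j)| <= (C * L + C) * `|Y - Z|.
  move=> cC bC L0 fL.
  have -> : forall x y z t : R, c * x - b * y - (c * z - b * t) = c * (x - z) - b * (y - t).
    by move=> *; ring.
  rewrite (le_trans (ler_normB _ _))// mulrDl lerD// normrM.
    rewrite -mulrA ler_pM//.
    have := le_mx_norm (f (clamp_row B (xrow Y)) - f (clamp_row B (xrow Z))) 0 j.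
    rewrite !mxE => /le_trans; apply.
    rewrite (le_trans (fL _ _ _ _)) ?clamp_row_norm//.
    by rewrite ler_wpM2l// ltW.
  rewrite ler_pM//; have := le_mx_norm (Y - Z) k j.
  by rewrite !mxE.
have CYZ : 0 <= C * `|Y - Z| by rewrite mulr_ge0.
have KYZ : 0 <= Kd * `|Y - Z| by rewrite mulr_ge0// ltW.
have C1YZ : 0 <= C * L1 * `|Y - Z| by rewrite mulr_ge0// ltW.
have C2YZ : 0 <= C * L2 * `|Y - Z| by rewrite mulr_ge0// ltW.
apply: mx_norm_le; first by rewrite !mulrDl !mul1r -!mulrA; lra.
move=> [[|[|[|//]]] k3] j; rewrite /truncated_field !mxE/=.
- by have := linear _ _ _ _ (@Ordinal 3 0 isT) j pt qt L20 HS; rewrite !mxE; lra.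
- by have := linear _ _ _ _ (@Ordinal 3 1 isT) j ht rt L10 HG; rewrite !mxE; lra.
- rewrite opprK addrC distrC.
  have max0 x : 0 <= Num.max x 0 :> R by rewrite le_max lexx orbT.
  have h1 := direction_lipschitz (clamp B (Y (@Ordinal 3 1 isT) j))
    eps_gt0 (max0 (Y (@Ordinal 3 0 isT) j)) (max0 (Z (@Ordinal 3 0 isT) j))
    (clamp_norm (Z (@Ordinal 3 1 isT) j) B0).
  have h2 := le_mx_norm (Y - Z) (@Ordinal 3 1 isT) j.
  have h3 := le_mx_norm (Y - Z) (@Ordinal 3 0 isT) j.
  rewrite !mxE in h2 h3.
  have h4 := clamp_lipschitz B (Y (@Ordinal 3 1 isT) j) (Z (@Ordinal 3 1 isT) j).
  have h5 := max_lipschitz 0 (Y (@Ordinal 3 0 isT) j) (Z (@Ordinal 3 0 isT) j).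
  rewrite (le_trans h1)// -/Kd.
  rewrite (@le_trans _ _ (Kd * (2 * `|Y - Z|)))//.
    by rewrite ler_wpM2l ?(ltW Kd0)//; lra.
  by lra.
Qed.

Lemma truncated_field_bounded Z : exists A : R, forall t, `|truncated_field t Z| <= A.
Proof.
(* The last summand takes care of the third row, which does not depend on [t]. *)
exists (C * `|S (clamp_row B (xrow Z))| + C * `|G (clamp_row B (xrow Z))| +
   2 * C * `|Z| + `|truncated_field 0 Z|).
move=> t; have [ht rt pt qt] := coef_bound t.
have CZ : 0 <= C * `|Z| by rewrite mulr_ge0.
have CS : 0 <= C * `|S (clamp_row B (xrow Z))| by rewrite mulr_ge0.
have CG : 0 <= C * `|G (clamp_row B (xrow Z))| by rewrite mulr_ge0.
have f0 := normr_ge0 (truncated_field 0 Z).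
have linear (c b : R) (f : 'rV[R]_d) k j : `|c| <= C -> `|b| <= C ->
   `|c * f 0 j - b * Z k j| <= C * `|f| + C * `|Z|.
  move=> cC bC; rewrite (le_trans (ler_normB _ _))// !normrM.
  by rewrite lerD// ler_pM// le_mx_norm.
apply: mx_norm_le; first by lra.
move=> [[|[|[|//]]] k3] j; rewrite mxE/=.
- have := linear _ _ (S (clamp_row B (xrow Z))) (@Ordinal 3 0 isT) j pt qt.
  by rewrite [vrow Z 0 j]mxE; lra.
- have := linear _ _ (G (clamp_row B (xrow Z))) (@Ordinal 3 1 isT) j ht rt.
  by rewrite [mrow Z 0 j]mxE; lra.
- have := le_mx_norm (truncated_field 0 Z) (Ordinal k3) j.
  by rewrite mxE/=; lra.
Qed.

End truncation.

(** * From the truncated flow to the true one *)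

Section existence.
Context {R : realType} {d : nat}.
Variables (F : 'rV[R]_d -> R) (S : 'rV[R]_d -> 'rV[R]_d) (eps : R).
Variables (h r p q : R -> R).
Hypothesis F_C1 : C1_function F.
Hypothesis gradF_lip : locally_lipschitz (gradient F).
Hypothesis F_coercive : coercive_function F.
Hypothesis S_ge0 : forall x i, 0 <= S x 0 i.
Hypothesis S_lip : locally_lipschitz S.
Hypothesis eps_gt0 : 0 < eps.
Hypothesis coef_ge0 : forall t : R, 0 < t -> [/\ 0 <= h t, 0 <= r t, 0 <= p t & 0 <= q t].
Hypothesis coef_cont : forall t : R, 0 < t ->
    [/\ {for t, continuous h}, {for t, continuous r},
        {for t, continuous p} & {for t, continuous q}].
Hypothesis h_derivable : forall t : R, 0 < t -> derivable h t 1.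
Hypothesis h_noninc : forall t : R, 0 < t -> derive1 h t <= 0.
Hypothesis r_ge_q4 : forall t : R, 0 < t -> q t / 4 <= r t.
Variables (hinf rinf qinf pinf : R).
Hypothesis hinf_gt0 : 0 < hinf.
Hypothesis qinf_gt0 : 0 < qinf.
Hypothesis h_ge : forall t : R, 0 < t -> hinf <= h t.
Hypothesis q_ge : forall t : R, 0 < t -> qinf <= q t.
Hypothesis h_cvg : h t @[t --> +oo] --> hinf.
Hypothesis r_cvg : r t @[t --> +oo] --> rinf.
Hypothesis p_cvg : p t @[t --> +oo] --> pinf.
Hypothesis q_cvg : q t @[t --> +oo] --> qinf.

Lemma coef_bounded (a : R) : 0 < a -> exists C : R, forall t, a <= t ->
  [/\ `|h t| <= C, `|r t| <= C, `|p t| <= C & `|q t| <= C].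
Proof.
move=> a0.
have [C1 C10 H1] := continuous_cvg_bounded a0
  (fun t t0 => let: And4 c _ _ _ := coef_cont t0 in c) h_cvg.
have [C2 C20 H2] := continuous_cvg_bounded a0
  (fun t t0 => let: And4 _ c _ _ := coef_cont t0 in c) r_cvg.
have [C3 C30 H3] := continuous_cvg_bounded a0
  (fun t t0 => let: And4 _ _ c _ := coef_cont t0 in c) p_cvg.
have [C4 C40 H4] := continuous_cvg_bounded a0
  (fun t t0 => let: And4 _ _ _ c := coef_cont t0 in c) q_cvg.
exists (C1 + C2 + C3 + C4) => t at_.
by have := H1 t at_; have := H2 t at_; have := H3 t at_; have := H4 t at_; split; lra.
Qed.

(** The truncated flow keeps [v >= 0], because where [v < 0] both [p * S] and [- q * v] are
    nonnegative. As long as its norm is at most [B] it solves the true equations, so the a priori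
    bound improves [B] to [M < B]; by the bootstrap this persists for ever. *)
Lemma global_existence (a : R) (z0 : state R d) : 0 < a -> Zplus z0 ->
  exists z, is_global_solution F S eps h r p q a z0 z.
Proof.
move=> a0 z0p.
have [M M0 HM] := apriori_bound F_C1 F_coercive S_ge0 S_lip eps_gt0 coef_ge0 coef_cont
  h_derivable h_noninc r_ge_q4 hinf_gt0 qinf_gt0 h_ge q_ge p_cvg a0 z0p.
(* The excess over [M] is the strict margin that [continuation] requires. *)
pose B := M + 1.
have B0 : 0 <= B by rewrite addr_ge0// ltW.
have [C HC] := coef_bounded a0.
(* The coefficients are frozen before time [a], since the Picard theorem wants a field that is
   continuous and bounded in time on the whole line. *)
pose ext (f : R -> R) t := f (Num.max t a).
have ext_cont (f : R -> R) : (forall t : R, 0 < t -> {for t, continuous f}) -> continuous (ext f).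
  move=> cf t; apply: (@continuous_comp _ _ _ (fun t => Num.max t a) f).
    by apply: continuous_max; [exact: cvg_id|exact: cst_continuous].
  by apply: cf; rewrite (lt_le_trans a0)// le_max lexx orbT.
have exts_cont : [/\ continuous (ext h), continuous (ext r),
                     continuous (ext p) & continuous (ext q)].
  by split; apply: ext_cont => t t0; have [] := coef_cont t0.
have exts_bound t : [/\ `|ext h t| <= C, `|ext r t| <= C,
                        `|ext p t| <= C & `|ext q t| <= C].
  by apply: HC; rewrite le_max lexx orbT.
have extE (f : R -> R) (t : R) : a <= t -> ext f t = f t by move=> at_; rewrite /ext max_l.
pose fld := truncated_field (gradient F) S eps B (ext h) (ext r) (ext p) (ext q).
pose Z0 : 'M[R]_(3, d) := \matrix_(k, j) match val k with
  | 0%N => z0.1.1 0 j | 1%N => z0.1.2 0 j | _ => z0.2 0 j end.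
have [K K1 HK] := truncated_field_lipschitz gradF_lip S_lip eps_gt0 B0 exts_bound.
have [A HA] := truncated_field_bounded (gradient F) S eps B exts_bound Z0.
have cfld Z : continuous (fld ^~ Z) by exact: truncated_field_continuous.
have [Z [w [cZ Za Zw dw]]] := picard_global a K1 cfld HK HA.
pose o0 := @Ordinal 3 0 isT; pose o1 := @Ordinal 3 1 isT; pose o2 := @Ordinal 3 2 isT.
pose z t : state R d := (row o0 (Z t), row o1 (Z t), row o2 (Z t)).
have za : z a = z0.
  rewrite /z Za (surjective_pairing z0) (surjective_pairing z0.1).
  by congr ((_, _), _); apply/rowP => j; rewrite !mxE.
have cZk k : continuous (fun t => row k (Z t)).
  move=> t; apply: cvg_mx => i j; rewrite mxE; under eq_fun do rewrite mxE.
  by apply: (@continuous_comp _ _ _ Z (fun M => M k j)); [exact: cZ|exact: coord_continuous].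
have cz : continuous z.
  move=> t; rewrite /z.
  exact: (cvg_pair (cvg_pair (cZk o0 t) (cZk o1 t)) (cZk o2 t)).
have DZ t k j : a <= t -> has_derivative_in `[a, +oo[ (fun s => Z s k j) t (fld t (Z t) k j).
  move=> at_; apply: (@has_derivative_in_eq _ _ _ (fun s => w s k j)).
  - by move=> s; rewrite /= in_itv/= andbT => as_; rewrite Zw.
  - by rewrite /= in_itv/= andbT.
  - by apply: is_derive_has_derivative_in; exact: dw.
have DZ' t k j : a < t -> is_derive t 1 (fun s => Z s k j) (fld t (Z t) k j).
  by move=> at_; apply: (has_derivative_in_interior at_); apply: DZ; exact: ltW.
have zp t : a <= t -> Zplus (z t).
  move=> at_ i; rewrite /= mxE -oppr_le0.
  apply: (@barrier_le _ (fun s => - Z s o0 i) (fun s => - fld s (Z s) o0 i) 0 a t) => //.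
  - apply: continuous_subspaceT => s; apply: cvgN.
    by apply: (@continuous_comp _ _ _ Z (fun M => M o0 i)); [exact: cZ|exact: coord_continuous].
  - by move=> u /andP[au _]; have ? := DZ' u o0 i au; exact: is_deriveN.
  - move=> u /andP[au _]; rewrite oppr_gt0 => Zu.
    have u0 := lt_trans a0 au; have [_ _ p0 q0] := coef_ge0 u0.
    rewrite oppr_le0 /fld /truncated_field !mxE/= !(extE _ _ (ltW au)) subr_ge0.
    by rewrite (@le_trans _ _ 0)// ?mulr_ge0 ?S_ge0// mulr_ge0_le0// ltW.
  - by rewrite Za mxE/= oppr_le0 z0p.
have trunc_id t : a <= t -> `|z t| <= B -> forall j,
  [/\ fld t (Z t) o0 j = p t * S (z t).2 0 j - q t * (z t).1.1 0 j,
      fld t (Z t) o1 j = h t * gradient F (z t).2 0 j - r t * (z t).1.2 0 j &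
      fld t (Z t) o2 j = - ((z t).1.2 0 j / Num.sqrt ((z t).1.1 0 j + eps))].
  move=> at_ ztB j.
  have xB : clamp_row B (row o2 (Z t)) = (z t).2.
    by rewrite clamp_row_id// (le_trans (state_norm_x (z t)) ztB).
  split; rewrite /fld /truncated_field [LHS]mxE/= ?extE//.
  - by rewrite xB.
  - by rewrite xB.
  - have [_ mB _] := le_state_norm (z t) j.
    rewrite clamp_id ?(le_trans mB)// max_l//.
    exact: (zp t at_ j).
have zB : forall b, a <= b -> `|z b| < B.
  move=> b ab; have bab : a <= b <= b by rewrite ab lexx.
  have czn : {within `[a, b], continuous (fun t => `|z t|)}.
    by apply: within_continuous_state_norm; exact: continuous_subspaceT.
  apply: (continuation czn) bab => [|t /andP[at_ tb] Hu].
  - rewrite (@le_lt_trans _ _ M) ?ltrDl//; apply: (HM a z (lexx a) za).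
    + exact: continuous_subspaceT.
    + by move=> t /andP[at_ _]; exact: zp.
    + by move=> t /andP[at_ /(lt_trans at_)]; rewrite ltxx.
  - rewrite (@le_lt_trans _ _ M) ?ltrDl//; apply: (HM t z at_ za).
    + exact: continuous_subspaceT.
    + by move=> u /andP[au _]; exact: zp.
    + move=> u /andP[au ut] i.
      have uin : a <= u <= t by rewrite !ltW.
      have [e1 e2 e3] := trunc_id u (ltW au) (Hu u uin) i.
      have := DZ' u o0 i au; have := DZ' u o1 i au; have := DZ' u o2 i au.
      rewrite e1 e2 e3 => D3 D2 D1; split; rewrite /=; under eq_fun do rewrite mxE; by [].
exists z; split => //; first exact: continuous_subspaceT.
move=> t at_ t0.
have [e1 e2 e3] : [/\ forall j, fld t (Z t) o0 j = p t * S (z t).2 0 j - q t * (z t).1.1 0 j,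
      forall j, fld t (Z t) o1 j = h t * gradient F (z t).2 0 j - r t * (z t).1.2 0 j &
      forall j, fld t (Z t) o2 j = - ((z t).1.2 0 j / Num.sqrt ((z t).1.1 0 j + eps))].
  by split=> j; have [] := trunc_id t at_ (ltW (zB t at_)) j.
have at' : `[a, +oo[%classic t by rewrite /= in_itv/= andbT.
split; apply/has_derivative_in_mx => i j; rewrite (ord1 i).
- have := DZ t o0 j at_; rewrite e1 => D.
  have -> : (p t *: S (z t).2 - q t *: (z t).1.1) 0 j =
      p t * S (z t).2 0 j - q t * (z t).1.1 0 j by rewrite !mxE.
  by apply: has_derivative_in_eq D => // s _; rewrite mxE.
- have := DZ t o1 j at_; rewrite e2 => D.
  have -> : (h t *: gradient F (z t).2 - r t *: (z t).1.2) 0 j =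
      h t * gradient F (z t).2 0 j - r t * (z t).1.2 0 j by rewrite !mxE.
  by apply: has_derivative_in_eq D => // s _; rewrite mxE.
- have := DZ t o2 j at_; rewrite e3 => D.
  have -> : direction eps (z t).1.1 (z t).1.2 0 j =
      - ((z t).1.2 0 j / Num.sqrt ((z t).1.1 0 j + eps)) by rewrite mxE.
  by apply: has_derivative_in_eq D => // s _; rewrite mxE.
Qed.

End existence.

(** * Long-time convergence *)

Section limits.
Context {R : realType}.

Lemma nonincreasing_lbounded_cvg (f : R -> R) (a c : R) :
  (forall s t, a <= s -> s <= t -> f t <= f s) -> (forall t, a <= t -> c <= f t) ->
  exists l : R, f t @[t --> +oo] --> l.
Proof.
move=> fn fc; pose E := f @` `[a, +oo[%classic.
have infE : has_inf E.
  split; first by exists (f a), a => //=; rewrite in_itv/= lexx.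
  by exists c => _ [t + <-]; rewrite /= in_itv/= andbT; exact: fc.
exists (inf E); apply/cvgrPdist_lt => e e0.
have [_ [s + <-] sE] := inf_adherent e0 infE; rewrite /= in_itv/= andbT => as_.
exists s; split; first exact: num_real.
move=> t /ltW st.
have h1 : inf E <= f t.
  by apply: ge_inf; [case: infE|exists t => //; rewrite /= in_itv/= andbT (le_trans as_)].
have h2 := fn s t as_ st.
by rewrite ltr_norml; lra.
Qed.

Lemma near_pinftyP (P : R -> Prop) :
  (\forall t \near +oo, P t) <-> exists T, forall t, T <= t -> P t.
Proof.
split=> [[M [_ HM]]|[T HT]].
  by exists (M + 1) => t Mt; apply: HM; rewrite (lt_le_trans _ Mt)// ltrDl.
by exists T; split; [exact: num_real|move=> t /ltW; exact: HT].
Qed.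

Lemma set_dist_cvg0 (V : normedModType R) (A : set V) (z : R -> V) :
  (forall e : R, 0 < e -> \forall t \near +oo, exists2 x, A x & `|z t - x| <= e) ->
  set_dist A (z t) @[t --> +oo] --> 0%E.
Proof.
move=> H.
have dist_ge0 t : (0 <= set_dist A (z t))%E.
  by apply: le_ereal_inf_tmp => _ [x _ <-]; rewrite lee_fin.
have dist_le (e : R) : 0 < e -> \forall t \near +oo, (set_dist A (z t) <= e%:E)%E.
  move=> /H; apply: filterS => t [x Ax zx].
  by apply: ereal_inf_le; exists (`|z t - x|)%:E; [exists x|rewrite lee_fin].
apply/fine_cvgP; split.
  apply: filterS (dist_le 1 ltr01) => t tle; rewrite ge0_fin_numE//.
  by rewrite (le_lt_trans tle)// ltry.
apply/cvgrPdist_le => e /dist_le; apply: filterS => t tle /=.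
rewrite sub0r normrN ger0_norm; last exact: fine_ge0.
rewrite -lee_fin fineK// ge0_fin_numE// (le_lt_trans tle)// ltry//.
Qed.

(** By compactness of the ball it is enough to argue locally: near a zero of [G] that zero is the
    witness, and near any other point [x] the norm of [G] stays above [|G x| / 2], which a small
    [eta] excludes. *)
Lemma near_zero_set d (W : normedModType R) (G : 'rV[R]_d -> W) (M e : R) :
  continuous G -> 0 < e ->
  exists2 eta : R, 0 < eta & forall x, `|x| <= M -> `|G x| <= eta ->
    exists2 y, G y = 0 & `|x - y| < e.
Proof.
move=> cG e0.
have /compact_near_coveringP cM := @compact_norm_le R d M.
have : \forall eta \near (0 : R)^'+, [set x : 'rV[R]_d | `|x| <= M] `<=`
    [set x | `|G x| <= eta -> exists2 y, G y = 0 & `|x - y| < e].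
  apply: (cM R (0 : R)^'+ (fun eta x => `|G x| <= eta -> exists2 y, G y = 0 & `|x - y| < e)).
  move=> x _; have [Gx0|Gx] := eqVneq (G x) 0.
    exists ([set w | `|x - w| < e], setT) => /=.
      split; last exact: filterT.
      by move/cvgrPdist_lt : (@cvg_id _ (nbhs x)); apply.
    by move=> [w eta] [/= xw _] _; exists x => //; rewrite distrC.
  have G2 : 0 < `|G x| / 2 by rewrite divr_gt0// normr_gt0.
  exists ([set w | `|G x - G w| < `|G x| / 2], [set eta | eta < `|G x| / 2]) => /=.
    split; last exact: nbhs_right_lt.
    by move/cvgrPdist_lt : (cG x); apply.
  move=> [w eta] [/= xw etaG] Gw; exfalso.
  by have := ler_distD (G w) (G x) 0; rewrite !subr0; lra.
move=> /(filterI (nbhs_right_gt (0 : R))) /filter_ex[eta [eta0 Heta]].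
by exists eta => // x xM; exact: Heta.
Qed.

End limits.

Section convergence.
Context {R : realType} {d : nat}.
Variables (F : 'rV[R]_d -> R) (S : 'rV[R]_d -> 'rV[R]_d) (eps : R).
Variables (h r p q : R -> R).
Hypothesis F_C1 : C1_function F.
Hypothesis gradF_lip : locally_lipschitz (gradient F).
Hypothesis F_coercive : coercive_function F.
Hypothesis S_ge0 : forall x i, 0 <= S x 0 i.
Hypothesis S_lip : locally_lipschitz S.
Hypothesis eps_gt0 : 0 < eps.
Hypothesis coef_ge0 : forall t : R, 0 < t -> [/\ 0 <= h t, 0 <= r t, 0 <= p t & 0 <= q t].
Hypothesis coef_cont : forall t : R, 0 < t ->
    [/\ {for t, continuous h}, {for t, continuous r},
        {for t, continuous p} & {for t, continuous q}].
Hypothesis h_derivable : forall t : R, 0 < t -> derivable h t 1.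
Hypothesis h_noninc : forall t : R, 0 < t -> derive1 h t <= 0.
Hypothesis r_ge_q4 : forall t : R, 0 < t -> q t / 4 <= r t.
Variables (hinf rinf qinf pinf : R).
Hypothesis hinf_gt0 : 0 < hinf.
Hypothesis qinf_gt0 : 0 < qinf.
Hypothesis h_ge : forall t : R, 0 < t -> hinf <= h t.
Hypothesis q_ge : forall t : R, 0 < t -> qinf <= q t.
Hypothesis h_cvg : h t @[t --> +oo] --> hinf.
Hypothesis r_cvg : r t @[t --> +oo] --> rinf.
Hypothesis p_cvg : p t @[t --> +oo] --> pinf.
Hypothesis q_cvg : q t @[t --> +oo] --> qinf.
Hypothesis rinf_gt_q4 : qinf / 4 < rinf.

Let sol := solution F S eps h r p q.

Lemma solution_bounded (a : R) z : 0 < a -> sol a z ->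
  exists2 M : R, 0 < M & forall t, a <= t -> `|z t| <= M.
Proof.
move=> a0 sz; have [cz zp oz] := sz.
have [M M0 HM] := apriori_bound F_C1 F_coercive S_ge0 S_lip eps_gt0 coef_ge0 coef_cont
  h_derivable h_noninc r_ge_q4 hinf_gt0 qinf_gt0 h_ge q_ge p_cvg a0 (zp a (lexx a)).
exists M => // t at_; apply: (HM t z) => //.
- exact: (solution_continuous sz).
- by move=> u /andP[au _]; exact: zp.
- by move=> u /andP[au _]; exact: oz.
Qed.

Section trajectory.
Variables (a M C : R) (z : R -> state R d).
Hypothesis a0 : 0 < a.
Hypothesis sz : sol a z.
Hypothesis M0 : 0 < M.
Hypothesis zM : forall t, a <= t -> `|z t| <= M.
Hypothesis HC : forall t, a <= t ->
  [/\ `|h t| <= C, `|r t| <= C, `|p t| <= C & `|q t| <= C].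

Let C0 : 0 <= C. Proof. by have [+ _ _ _] := HC (lexx a); exact: le_trans. Qed.

Let pos t : a <= t -> 0 < t. Proof. exact: lt_le_trans. Qed.

Let x_bound t : a <= t -> `|(z t).2| <= M.
Proof. by move=> at_; exact: le_trans (state_norm_x _) (zM at_). Qed.

Let within_coord s t i : a <= s ->
  [/\ {within `[s, t], continuous (fun u => (z u).1.1 0 i)},
      {within `[s, t], continuous (fun u => (z u).1.2 0 i)} &
      {within `[s, t], continuous (fun u => (z u).2 0 i)}].
Proof. by move=> as_; apply: within_continuous_coord; exact: solution_continuous sz as_. Qed.

Lemma lipschitz_ball_bounded (G : 'rV[R]_d -> 'rV[R]_d) : locally_lipschitz G ->
  exists2 A : R, 0 <= A & forall x, `|x| <= M -> `|G x| <= A.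
Proof.
move=> /(locally_lipschitz_ball M)[L L0 HL].
exists (L * M + `|G 0|); first by rewrite addr_ge0// mulr_ge0 ?ltW.
move=> x xM; have := HL x 0 xM; rewrite normr0 (ltW M0) => /(_ isT) h1.
rewrite subr0 in h1.
have := ler_distD (G 0) (G x) 0; rewrite !subr0.
have : L * `|x| <= L * M by rewrite ler_wpM2l// ltW.
by lra.
Qed.

(** With the global bound on [m] it yields Lipschitz continuity in time; with a small [b], once [m]
    tends to 0, it expresses that [x] varies slowly. *)
Lemma x_displacement s t (b : R) i : a <= s -> s <= t ->
  (forall u, s <= u <= t -> `|(z u).1.2 0 i| <= b) ->
  `|(z t).2 0 i - (z s).2 0 i| <= b / Num.sqrt eps * (t - s).
Proof.
move=> as_ st mb; have [_ zp oz] := sz.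
have [_ _ cx] := within_coord t i as_.
apply: (@derive_bound _ (fun u => (z u).2 0 i)
  (fun u => - ((z u).1.2 0 i / Num.sqrt ((z u).1.1 0 i + eps)))) => //.
  by move=> u /andP[su _]; have [] := oz u (le_lt_trans as_ su) i.
move=> u /andP[/ltW su /ltW ut].
rewrite normrN normrM ler_pM//; first by rewrite mb// su.
have v0 : 0 <= (z u).1.1 0 i by apply: zp; exact: le_trans su.
rewrite ger0_norm ?invr_ge0 ?sqrtr_ge0// lef_pV2 ?posrE ?sqrtr_gt0//.
  by rewrite ler_wsqrtr// lerDr.
by rewrite ltr_wpDl.
Qed.

Lemma x_lipschitz s t : a <= s -> s <= t ->
  `|(z t).2 - (z s).2| <= M / Num.sqrt eps * (t - s).
Proof.
move=> as_ st; apply: mx_norm_le.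
  by apply: mulr_ge0; [apply: divr_ge0; [exact: ltW|exact: sqrtr_ge0]|rewrite subr_ge0].
move=> i j; rewrite (ord1 i) !mxE; apply: x_displacement => // u /andP[su _].
have [_ + _] := le_state_norm (z u) j; move=> /le_trans; apply.
by apply: zM; exact: le_trans su.
Qed.

Lemma m_cvg0 i (e : R) : 0 < e -> \forall t \near +oo, `|(z t).1.2 0 i| < e.
Proof.
move=> e0; have [cz zp oz] := sz.
have [A A0 HA] := lipschitz_ball_bounded gradF_lip.
have cF : continuous F by move=> x; apply: differentiable_continuous; exact: F_C1.1.
have [c Fc] := coercive_lbound cF F_coercive.
pose E := energy F eps h c z.
have Ed t : a < t -> exists2 dE, is_derive t 1 E dE & dE <= - \sum_i (r t - q t / 4) *
    ((z t).1.2 0 i ^+ 2 / Num.sqrt ((z t).1.1 0 i + eps)).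
  move=> at_; apply: (energy_derive F_C1 S_ge0 eps_gt0 coef_ge0 h_derivable h_noninc) => //.
  - exact: lt_trans at_.
  - by apply: zp; exact: ltW.
  - exact: oz.
have [l El] : exists l : R, E t @[t --> +oo] --> l.
  apply: (@nonincreasing_lbounded_cvg _ E a 0).
    move=> s t as_ st; apply: (energy_nonincreasing F_C1 S_ge0 eps_gt0 coef_ge0 coef_cont
      h_derivable h_noninc r_ge_q4 (pos as_) st Fc).
    - exact: solution_continuous sz as_.
    - by move=> u /andP[su _]; apply: zp; exact: le_trans su.
    - by move=> u /andP[su _]; apply: oz; exact: le_lt_trans su.
  move=> t at_; have [h0 _ _ _] := coef_ge0 (pos at_).
  rewrite addr_ge0 ?mulr_ge0 ?subr_ge0// sumr_ge0// => j _.
  by rewrite divr_ge0 ?sqr_ge0// mulr_ge0// sqrtr_ge0.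
(* Half of the limiting margin: eventually [kap <= r t - q t / 4]. *)
pose kap := (rinf - qinf / 4) / 2.
have kap0 : 0 < kap by have H := rinf_gt_q4; rewrite /kap; lra.
have [T HT] : exists T, forall t, T <= t -> kap <= r t - q t / 4.
  apply/near_pinftyP.
  have : r t - q t / 4 @[t --> +oo] --> rinf - qinf / 4.
    by apply: cvgB => //; apply: cvgMl.
  move/cvgr_ge; apply; have H := rinf_gt_q4; rewrite /kap; lra.
have sM0 : 0 < Num.sqrt (M + eps) by rewrite sqrtr_gt0 addr_gt0.
(* The least dissipation rate when the chosen coordinate of [m] is at least [e / 2] in absolute
   value, as [v] is at most [M]. *)
pose c1 := kap * ((e / 2) ^+ 2 / Num.sqrt (M + eps)).
have c10 : 0 < c1 by rewrite mulr_gt0// divr_gt0// exprn_gt0// divr_gt0.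
pose Lm := C * A + C * M.
have Lm0 : 0 <= Lm by rewrite addr_ge0// mulr_ge0// ltW.
apply: (@barbalat _ (fun t => - E t) (fun t => - derive1 E t) _ (- l) Lm
   (Num.max (a + 1) T) e c1) => //.
- move=> t; rewrite ge_max => /andP[at_ _].
  have [|dE HdE _] := Ed t; first by rewrite (lt_le_trans _ at_)// ltrDl.
  by have -> : derive1 E t = dE; [rewrite derive1E; case: HdE|exact: is_deriveN].
- move=> s t; rewrite ge_max => /andP[a1s _] st.
  have as_ : a <= s by rewrite (le_trans _ a1s)// lerDl.
  rewrite (le_trans (ler_dist_dist _ _))//.
  have [_ cm _] := within_coord t i as_.
  apply: (@derive_bound _ (fun u => (z u).1.2 0 i)
    (fun u => h u * gradient F (z u).2 0 i - r u * (z u).1.2 0 i)) => //.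
    by move=> u /andP[su _]; have [] := oz u (le_lt_trans as_ su) i.
  move=> u /andP[/ltW su _]; have au := le_trans as_ su.
  have [hC rC _ _] := HC au.
  rewrite (le_trans (ler_normB _ _))// !normrM lerD// ler_pM//.
    by rewrite (le_trans (le_mx_norm _ _ _))// HA// x_bound.
  by have [_ + _] := le_state_norm (z u) i; move=> /le_trans; apply; exact: zM.
- move=> t; rewrite ge_max => /andP[a1t Tt] em.
  have at_ : a < t by rewrite (lt_le_trans _ a1t)// ltrDl.
  have [dE HdE dEle] := Ed t at_.
  have -> : derive1 E t = dE by rewrite derive1E; case: HdE.
  rewrite lerNr (le_trans dEle)// lerN2 (bigD1 i)//=.
  have v0 j : 0 <= (z t).1.1 0 j by apply: zp; exact: ltW.
  rewrite -[c1]addr0 lerD//; last first.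
    rewrite sumr_ge0// => j _; rewrite mulr_ge0 ?divr_ge0 ?sqr_ge0 ?sqrtr_ge0//.
    by rewrite (le_trans (ltW kap0))// HT.
  rewrite /c1 ler_pM ?(ltW kap0) ?HT//; first by rewrite divr_ge0 ?sqr_ge0// ltW.
  rewrite ler_pM ?sqr_ge0 ?invr_ge0 ?(ltW sM0)//.
    rewrite -[leRHS]real_normK ?num_real// ler_pXn2r// nnegrE//.
    by rewrite divr_ge0// ltW.
  rewrite lef_pV2 ?posrE// ?sqrtr_gt0 ?ltr_wpDl// ler_wsqrtr// lerD2r.
  have [+ _ _] := le_state_norm (z t) i.
  by rewrite ger0_norm// => /le_trans; apply; apply: zM; exact: ltW.
- exact: cvgN.
Qed.


(** The convergent function is now the coordinate of [m] itself: where the gradient is large,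
    [h * gradient F] dominates [r * m], which is eventually negligible. The window argument is
    one-sided, whence the two signs. *)
Lemma gradient_cvg0 i (e : R) : 0 < e ->
  \forall t \near +oo, `|gradient F (z t).2 0 i| < e.
Proof.
move=> e0; have [cz zp oz] := sz.
have [L L0 HL] := locally_lipschitz_ball M gradF_lip.
have m_cvg : (z t).1.2 0 i @[t --> +oo] --> 0.
  by apply/cvgr0Pnorm_lt => e1; exact: m_cvg0.
(* If the signed gradient is at least [e / 2], its product with [h] is at least [2 * c1]; with
   [|r * m| <= c1], the signed [m] grows at rate at least [c1]. *)
pose c1 := hinf * (e / 4).
have hp := hinf_gt0.
have c10 : 0 < c1 by rewrite mulr_gt0// divr_gt0.
have CC0 := C0.
have C1 : 0 < C + 1 by rewrite ltr_wpDl.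
have [T HT] : exists T, forall t, T <= t -> `|(z t).1.2 0 i| < c1 / (C + 1).
  by apply/near_pinftyP; apply: m_cvg0; rewrite divr_gt0.
pose X := M / Num.sqrt eps.
have X0 : 0 <= X by rewrite divr_ge0 ?sqrtr_ge0// ltW.
have key (b : bool) : \forall t \near +oo, (-1) ^+ b * gradient F (z t).2 0 i < e.
  apply: (@barbalat _ (fun t => (-1) ^+ b * (z t).1.2 0 i)
    (fun t => (-1) ^+ b * (h t * gradient F (z t).2 0 i - r t * (z t).1.2 0 i))
    (fun t => (-1) ^+ b * gradient F (z t).2 0 i) ((-1) ^+ b * 0) (L * X)
    (Num.max (a + 1) T) e c1) => //.
  - by rewrite mulr_ge0// ltW.
  - move=> t; rewrite ge_max => /andP[a1t _].
    have at_ : a < t by rewrite (lt_le_trans _ a1t)// ltrDl.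
    have [_ ? _] := oz t at_ i.
    by apply: is_derive_eq; rewrite /GRing.scale/=; ring.
  - move=> s t; rewrite ge_max => /andP[a1s _] st.
    have as_ : a <= s by rewrite (le_trans _ a1s)// lerDl.
    rewrite -mulrBr normrMsign.
    have := le_mx_norm (gradient F (z t).2 - gradient F (z s).2) 0 i.
    rewrite [fun_of_matrix (_ - _) _ _]mxE [fun_of_matrix (- _) _ _]mxE => /le_trans; apply.
    rewrite (le_trans (HL _ _ (x_bound (le_trans as_ st)) (x_bound as_)))//.
    by rewrite -mulrA ler_wpM2l ?(ltW L0)//; exact: x_lipschitz.
  - move=> t; rewrite ge_max => /andP[a1t Tt] eg.
    have at_ : a <= t by rewrite (le_trans _ a1t)// lerDl.
    have t0 := pos at_.
    have [h0 _ _ _] := coef_ge0 t0.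
    have [_ rC _ _] := HC at_.
    have rm : `|r t * (z t).1.2 0 i| <= c1.
      rewrite normrM (@le_trans _ _ ((C + 1) * (c1 / (C + 1))))//.
        by rewrite ler_pM// ?(le_trans rC) ?lerDl// ltW// HT.
      by rewrite mulrC divfK// gt_eqF.
    have hg : hinf * (e / 2) <= h t * ((-1) ^+ b * gradient F (z t).2 0 i).
      by rewrite ler_pM ?h_ge ?(ltW hp)// divr_ge0// ltW.
    have : (-1) ^+ b * (r t * (z t).1.2 0 i) <= c1.
      by rewrite (le_trans (ler_norm _))// normrMsign.
    by rewrite /c1 in rm *; lra.
  - by apply: cvgMr.
near=> t.
have h1 : (-1) ^+ false * gradient F (z t).2 0 i < e by near: t; exact: key.
have h2 : (-1) ^+ true * gradient F (z t).2 0 i < e by near: t; exact: key.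
by move: h1 h2; rewrite expr0 expr1 mul1r ltr_norml; lra.
Unshelve. all: by end_near.
Qed.

(** On the window [[t - tau, t]] the target is frozen at its final value [k * S (x t)]. There [v]
    solves a linear equation whose equilibrium is nearly this constant, and the window is long
    enough for the initial gap to decay at rate [qinf]. *)
Lemma v_cvg i (e : R) : 0 < e ->
  \forall t \near +oo, `|(z t).1.1 0 i - pinf / qinf * S (z t).2 0 i| <= e.
Proof.
move=> e0; have [cz zp oz] := sz.
have [A A0 HA] := lipschitz_ball_bounded S_lip.
have [L L0 HL] := locally_lipschitz_ball M S_lip.
have qp := qinf_gt0.
pose k := pinf / qinf.
pose D := M + `|k| * A.
have D0 : 0 <= D by rewrite addr_ge0 ?mulr_ge0// ltW.
(* [D] bounds the gap at the beginning of the window; the choice of [tau] rests on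
   [1 + y <= expR y]. *)
have [tau [tau0 Htau]] : exists tau : R, 0 < tau /\ expR (- qinf * tau) * D <= e / 2.
  exists (2 * D / (e * qinf) + 1); split; first by rewrite ltr_wpDl// divr_ge0 ?mulr_ge0// ltW.
  rewrite mulNr expRN -ler_pdivlMl ?invr_gt0 ?expR_gt0// invrK.
  rewrite -ler_pdivrMr ?divr_gt0//.
  rewrite (le_trans _ (expR_ge1Dx _))// mulrDr mulr1.
  have -> : qinf * (2 * D / (e * qinf)) = D / (e / 2) by field; rewrite !gt_eqF.
  by lra.
have CC0 := C0.
(* If [|m| <= eta * Num.sqrt eps], then [x] moves by at most [eta * tau] over the window, and
   replacing [S (x u)] by [S (x t)] costs at most [qinf * (e / 8)] in the forcing. *)
pose eta := qinf * (e / 8) / ((C + 1) * L * tau).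
have C1 : 0 < C + 1 by rewrite ltr_wpDl.
have eta0 : 0 < eta by rewrite !divr_gt0 ?mulr_gt0// divr_gt0.
have se0 : 0 < Num.sqrt eps by rewrite sqrtr_gt0.
have [T1 HT1] : exists T, forall t, T <= t -> forall j, `|(z t).1.2 0 j| <= eta * Num.sqrt eps.
  apply/near_pinftyP; apply: filter_forall => j.
  by have := @m_cvg0 j _ (mulr_gt0 eta0 se0); apply: filterS => t; exact: ltW.
have [T2 HT2] : exists T, forall t, T <= t -> `|p t - q t * k| <= qinf * (e / 8) / (A + 1).
  apply/near_pinftyP.
  have pq0 : p t - q t * k @[t --> +oo] --> 0.
    rewrite (_ : 0 = pinf - qinf * k); last by rewrite /k mulrC divfK ?subrr// gt_eqF.
    by apply: cvgB => //; apply: cvgMl.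
  by move/cvgr0_norm_le : pq0; apply; rewrite divr_gt0 ?mulr_gt0 ?divr_gt0// ltr_wpDl.
apply/near_pinftyP; exists (Num.max (a + 1) (Num.max T1 T2) + tau) => t Tt.
pose s := t - tau.
have : Num.max (a + 1) (Num.max T1 T2) <= s by rewrite lerBrDr.
rewrite !ge_max => /and3P[a1s T1s T2s].
have as_ : a <= s by rewrite (le_trans _ a1s)// lerDl.
have st : s <= t by rewrite gerBl ltW.
have at_ := le_trans as_ st.
have [cv _ _] := within_coord t i as_.
have forcing u : s < u < t -> `|p u * S (z u).2 0 i - q u * k * S (z t).2 0 i| <= qinf * (e / 4).
  move=> /andP[su ut].
  have au : a <= u by rewrite (le_trans as_) ?ltW.
  have -> : p u * S (z u).2 0 i - q u * k * S (z t).2 0 i =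
     p u * (S (z u).2 0 i - S (z t).2 0 i) + (p u - q u * k) * S (z t).2 0 i by ring.
  rewrite (le_trans (ler_normD _ _))// !normrM.
  have -> : qinf * (e / 4) = qinf * (e / 8) + qinf * (e / 8) by field.
  rewrite lerD//.
    have xd : `|(z u).2 - (z t).2| <= eta * tau.
      apply: mx_norm_le; first by rewrite mulr_ge0 ?ltW.
      move=> i' j; rewrite (ord1 i') !mxE distrC.
      rewrite (le_trans (@x_displacement u t (eta * Num.sqrt eps) j au (ltW ut) _))//.
        move=> w /andP[uw _]; apply: HT1.
        by rewrite (le_trans T1s)// (le_trans (ltW su)).
      have tu : t - u <= tau by move: su; rewrite /s; lra.
      by rewrite mulfK ?gt_eqF// ler_wpM2l// ltW.
    have Sd : `|S (z u).2 0 i - S (z t).2 0 i| <= L * (eta * tau).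
      have := le_mx_norm (S (z u).2 - S (z t).2) 0 i.
      rewrite !mxE => /le_trans; apply.
      rewrite (le_trans (HL _ _ (x_bound au) (x_bound at_)))//.
      by rewrite ler_wpM2l// ltW.
    have [_ _ pC _] := HC au.
    have -> : qinf * (e / 8) = (C + 1) * (L * (eta * tau)).
      by rewrite /eta; field; rewrite !gt_eqF.
    by rewrite ler_pM// (le_trans pC)// lerDl.
  have T2u : T2 <= u by rewrite (le_trans T2s)// ltW.
  have SA : `|S (z t).2 0 i| <= A + 1.
    by rewrite (le_trans (le_mx_norm _ _ _))// (le_trans (HA _ (x_bound at_)))// lerDl.
  have -> : qinf * (e / 8) = qinf * (e / 8) / (A + 1) * (A + 1).
    by rewrite divfK// gt_eqF// ltr_wpDl.
  by rewrite ler_pM// HT2.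
have key (b : bool) : (-1) ^+ b * ((z t).1.1 0 i - k * S (z t).2 0 i) <= e.
  (* Above this level half of the offset, worth [q * (e / 4)], absorbs the forcing error, and decay
     at rate at least [qinf] remains. *)
  pose B := (-1) ^+ b * (k * S (z t).2 0 i) + e / 2.
  have := @posrt_exp_decay _ (fun u => (-1) ^+ b * (z u).1.1 0 i)
    (fun u => (-1) ^+ b * (p u * S (z u).2 0 i - q u * (z u).1.1 0 i)) B qinf s t st.
  have st_tau : t - s = tau by rewrite /s; ring.
  rewrite st_tau => H.
  have {H} : (-1) ^+ b * (z t).1.1 0 i - B <=
    expR (- qinf * tau) * Num.max ((-1) ^+ b * (z s).1.1 0 i - B) 0.
    apply: H.
    - by apply: within_continuousM => //; exact: within_continuous_cst.
    - move=> u /andP[su _]; have [? _ _] := oz u (le_lt_trans as_ su) i.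
      by apply: is_derive_eq; rewrite /GRing.scale/=; ring.
    - move=> u sut yB.
      have u0 : 0 < u by case/andP: sut => su _; exact: lt_trans (pos as_) su.
      have qu := q_ge u0.
      have f1 := forcing u sut.
      have f2 : (-1) ^+ b * (p u * S (z u).2 0 i - q u * k * S (z t).2 0 i) <= qinf * (e / 4).
        by rewrite (le_trans (ler_norm _))// normrMsign.
      have f3 : qinf * (e / 4) <= q u * (e / 4).
        by rewrite ler_wpM2r// divr_ge0// ltW.
      have f4 : qinf * ((-1) ^+ b * (z u).1.1 0 i - B) <= q u * ((-1) ^+ b * (z u).1.1 0 i - B).
        by rewrite ler_wpM2r// subr_ge0 ltW.
      have f5 : 0 <= q u * (e / 4).
        by rewrite mulr_ge0 ?divr_ge0 ?(ltW e0)// (le_trans (ltW qp)).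
      have -> : (-1) ^+ b * (p u * S (z u).2 0 i - q u * (z u).1.1 0 i) =
        (-1) ^+ b * (p u * S (z u).2 0 i - q u * k * S (z t).2 0 i) - q u * (e / 4) - q u * (e / 4)
        - q u * ((-1) ^+ b * (z u).1.1 0 i - B) by rewrite /B; field.
      by lra.
  have maxD : Num.max ((-1) ^+ b * (z s).1.1 0 i - B) 0 <= D.
    rewrite ge_max D0 andbT /B /D.
    have v1 : (-1) ^+ b * (z s).1.1 0 i <= M.
      rewrite (le_trans (ler_norm _))// normrMsign.
      by have [+ _ _] := le_state_norm (z s) i; move=> /le_trans; apply; exact: zM.
    have v2 : - ((-1) ^+ b * (k * S (z t).2 0 i)) <= `|k| * A.
      rewrite (le_trans (ler_norm _))// normrN normrMsign normrM ler_wpM2l//.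
      by rewrite (le_trans (le_mx_norm _ _ _))// HA// x_bound.
    by lra.
  have := ler_wpM2l (expR_ge0 (- qinf * tau)) maxD.
  by rewrite /B; lra.
by rewrite ler_norml -/k; have := key false; have := key true; rewrite expr0 expr1; lra.
Qed.

Lemma trajectory_cvg :
  set_dist (Upsilon F S pinf qinf) (z t) @[t --> +oo] --> 0%E.
Proof.
apply: set_dist_cvg0 => e e0.
have [L L0 HL] := locally_lipschitz_ball (M + 1) S_lip.
pose k := pinf / qinf.
(* The bound by 1 keeps the critical point in the ball of radius [M + 1], where [L] is valid; the
   last entry makes [k * (S x - S y)] at most [e / 2]. *)
pose e1 := Num.min (Num.min 1 e) (e / 2 / ((`|k| + 1) * L)).
have k1 : 0 < `|k| + 1 by rewrite ltr_wpDl.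
have e10 : 0 < e1 by rewrite !lt_min ltr01 e0/= !divr_gt0// mulr_gt0.
have [eta eta0 Heta] := near_zero_set M (F_C1.2) e10.
have e20 : 0 < e / 2 by rewrite divr_gt0.
have Nm : \forall t \near +oo, forall i, `|(z t).1.2 0 i| < e.
  by apply: filter_forall => i; exact: m_cvg0.
have Ng : \forall t \near +oo, forall i, `|gradient F (z t).2 0 i| < eta.
  by apply: filter_forall => i; exact: gradient_cvg0.
have Nv : \forall t \near +oo, forall i, `|(z t).1.1 0 i - k * S (z t).2 0 i| <= e / 2.
  by apply: filter_forall => i; exact: v_cvg.
have Na : \forall t \near +oo, a <= t by exact: nbhs_pinfty_ge (num_real a).
near=> t.
have at_ : a <= t by near: t.
have mt : forall i, `|(z t).1.2 0 i| < e by near: t.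
have gt : forall i, `|gradient F (z t).2 0 i| < eta by near: t.
have vt : forall i, `|(z t).1.1 0 i - k * S (z t).2 0 i| <= e / 2 by near: t.
have [|y Gy xy] := Heta _ (x_bound at_).
  by apply: mx_norm_le => [|i j]; [exact: ltW|rewrite (ord1 i) ltW].
move: xy; rewrite !lt_min => /andP[/andP[xy1 xye] xy].
exists (k *: S y, 0, y); first by exists y.
have yM : `|y| <= M + 1.
  have := ler_distD (z t).2 y 0; rewrite !subr0 distrC; have := x_bound at_; lra.
have xM1 : `|(z t).2| <= M + 1 by rewrite (le_trans (x_bound at_))// lerDl.
apply/state_norm_leP; first exact: ltW.
move=> i; split; rewrite /= ?mxE.
- have Sd := HL _ _ xM1 yM.
  have Sdi := le_mx_norm (S (z t).2 - S y) 0 i.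
  rewrite !mxE in Sdi.
  have h1 : (`|k| + 1) * (L * `|(z t).2 - y|) <= e / 2.
    by rewrite mulrA mulrC -ler_pdivlMr ?mulr_gt0// ltW.
  have h2 : `|k * (S (z t).2 0 i - S y 0 i)| <= (`|k| + 1) * (L * `|(z t).2 - y|).
    by rewrite normrM ler_pM// ?lerDl// (le_trans Sdi).
  have -> : (z t).1.1 0 i - k * S y 0 i =
    ((z t).1.1 0 i - k * S (z t).2 0 i) + k * (S (z t).2 0 i - S y 0 i) by ring.
  by rewrite (le_trans (ler_normD _ _))//; have := vt i; lra.
- by rewrite oppr0 addr0 ltW.
- have := le_mx_norm ((z t).2 - y) 0 i; rewrite !mxE => /le_trans; apply; exact: ltW.
Unshelve. all: by end_near. Qed.

End trajectory.

Lemma solution_cvg (a : R) z : 0 < a -> sol a z ->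
  set_dist (Upsilon F S pinf qinf) (z t) @[t --> +oo] --> 0%E.
Proof.
move=> a0 sz; have [M M0 HM] := solution_bounded a0 sz.
have [C HC] := coef_bounded coef_cont h_cvg r_cvg p_cvg q_cvg a0.
exact: (trajectory_cvg a0 sz M0 HM HC).
Qed.

End convergence.

(** * Starting at time 0 *)

(* Either the coefficients of [y' = k f(x) - l y] stay bounded near [0], or [y0]
   is the limiting equilibrium of this equation; in both cases a solution issued
   from [y0] at a small time cannot leave [y0] quickly. *)
Definition compatible_at0 {R : realType} {d : nat} (k l : R -> R)
    (f : 'rV[R]_d -> 'rV[R]_d) (x0 y0 : 'rV[R]_d) : Prop :=
  (exists C : R, \forall u \near 0^'+, k u <= C /\ l u <= C) \/
  (exists2 lam : R, k u / l u @[u --> 0^'+] --> lam & y0 = lam *: f x0).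

Lemma near_at_right0 {R : realType} (P : R -> Prop) :
  (\forall u \near 0^'+, P u) -> exists2 tau : R, 0 < tau & forall u, 0 < u <= tau -> P u.
Proof.
rewrite /at_right/within/= => /nbhs_ballP[e /= e0 H].
exists (e / 2); first by rewrite divr_gt0.
move=> u /andP[u0 ue]; apply: H => //.
rewrite /ball/= sub0r normrN gtr0_norm// (le_lt_trans ue)//.
by rewrite ltr_pdivrMr// ltr_pMr// ltr1n.
Qed.

(** With bounded coefficients [y] has bounded speed. In the equilibrium case [k * f x - l * y0]
    equals [l * ((k / l - lam) * f x + lam * (f x - f x0))], at most [l * e] at small times whatever
    the size of [l], so that [y0 + e] and [y0 - e] are barriers. In both cases [tau] is independent
    of the starting time [s]. *)
Lemma compatible_at0_close {R : realType} {d : nat} (k l : R -> R)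
    (f : 'rV[R]_d -> 'rV[R]_d) (x0 y0 : 'rV[R]_d) (X B M e : R) :
  locally_lipschitz f -> (forall u : R, 0 < u -> 0 <= k u /\ 0 < l u) ->
  0 <= X -> 0 <= M -> `|x0| <= B -> compatible_at0 k l f x0 y0 -> 0 < e ->
  exists2 tau : R, 0 < tau & forall (s t : R) (x y : R -> 'rV[R]_d),
    0 < s -> s <= t -> t <= tau ->
    (forall i, {within `[s, t], continuous (fun u => y u 0 i)}) ->
    (forall u i, s < u < t ->
       is_derive u 1 (fun u => y u 0 i) (k u * f (x u) 0 i - l u * y u 0 i)) ->
    (forall u, s <= u <= t -> [/\ `|x u - x0| <= X * u, `|x u| <= B & `|y u| <= M]) ->
    y s = y0 -> `|y t - y0| <= e.
Proof.
move=> f_lip kl X0 M0 x0B compat e0.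
have [L L0 HL] := locally_lipschitz_ball B f_lip.
have B0 : 0 <= B by exact: le_trans x0B.
pose A := `|f x0| + L * (2 * B) + 1.
have A0 : 0 < A by rewrite ltr_wpDl// addr_ge0// mulr_ge0 ?(ltW L0)// mulr_ge0.
have HA x i : `|x| <= B -> `|f x 0 i| <= A.
  move=> xB; have h1 := HL _ _ xB x0B.
  have h2 := le_mx_norm (f x) 0 i.
  have h3 : L * `|x - x0| <= L * (2 * B).
    by rewrite ler_wpM2l ?(ltW L0)//; have := ler_normB x x0; lra.
  have h4 := ler_distD (f x0) (f x) 0; rewrite !subr0 in h4.
  by rewrite /A; lra.
case: compat => [[C /near_at_right0[tau1 tau10 H1]]|[lam klam y0E]].
- pose W := `|C| * A + `|C| * M + 1.
  have W0 : 0 < W by rewrite ltr_wpDl// addr_ge0// mulr_ge0// ltW.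
  exists (Num.min tau1 (e / W)); first by rewrite lt_min tau10 divr_gt0.
  move=> s t x y s0 st; rewrite le_min => /andP[t1 tW] cy dy xy ys.
  apply: mx_norm_le => [|i j]; first exact: ltW.
  rewrite (ord1 i) !mxE -ys.
  apply: (@le_trans _ _ (W * (t - s))); last first.
    by rewrite -ler_pdivlMl// mulrC; lra.
  apply: (@derive_bound _ (fun u => y u 0 j) (fun u => k u * f (x u) 0 j - l u * y u 0 j)) => //.
  move=> u /andP[su ut].
  have u0 : 0 < u by exact: lt_trans su.
  have [k0 l0] := kl u u0.
  have [kC lC] : k u <= C /\ l u <= C by apply: H1; rewrite u0 (le_trans (ltW ut)).
  have [|_ xB yM] := xy u; first by rewrite !ltW.
  have h1 : `|k u * f (x u) 0 j| <= `|C| * A.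
    by rewrite normrM ler_pM ?HA// ger0_norm// (le_trans kC)// ler_norm.
  have h2 : `|l u * y u 0 j| <= `|C| * M.
    rewrite normrM ler_pM//; last exact: le_trans (le_mx_norm _ _ _) yM.
    by rewrite ger0_norm ?(ltW l0)// (le_trans lC)// ler_norm.
  by rewrite (le_trans (ler_normB _ _))// /W; lra.
(* One half of [e] pays for [(k / l - lam) * f x], as [f] is at most [A] on the ball; the other
   half, through [tau2], for the displacement of [x]. *)
- have e1 : 0 < e / 2 / A by rewrite !divr_gt0.
  have [tau1 tau10 H1] := near_at_right0 ((cvgrPdist_le _ _).1 klam _ e1).
  have lLX0 : 0 <= `|lam| * L * X by rewrite !mulr_ge0// ltW.
  pose tau2 := e / 2 / (`|lam| * L * X + 1).
  have tau20 : 0 < tau2 by rewrite !divr_gt0// ltr_wpDl.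
  exists (Num.min tau1 tau2); first by rewrite lt_min tau10.
  move=> s t x y s0 st; rewrite le_min => /andP[t1 t2] cy dy xy ys.
  apply: mx_norm_le => [|i j]; first exact: ltW.
  rewrite (ord1 i) !mxE.
  have close u : s < u < t -> `|k u * f (x u) 0 j - l u * y0 0 j| <= l u * e.
    move=> /andP[su ut].
    have u0 : 0 < u by exact: lt_trans su.
    have [k0 l0] := kl u u0.
    have [|xX xB yM] := xy u; first by rewrite !ltW.
    have -> : k u * f (x u) 0 j - l u * y0 0 j =
       l u * ((k u / l u - lam) * f (x u) 0 j + lam * (f (x u) 0 j - f x0 0 j)).
      by rewrite y0E mxE; field; rewrite gt_eqF.
    rewrite normrM (gtr0_norm l0) ler_pM2l// (le_trans (ler_normD _ _))// !normrM.
    have h1 : `|k u / l u - lam| * `|f (x u) 0 j| <= e / 2 / A * A.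
      by rewrite ler_pM ?HA// distrC H1// u0 (le_trans (ltW ut)).
    have h2 : `|f (x u) 0 j - f x0 0 j| <= L * (X * u).
      have := le_mx_norm (f (x u) - f x0) 0 j; rewrite !mxE => /le_trans; apply.
      by rewrite (le_trans (HL _ _ xB x0B))// ler_wpM2l// ltW.
    have h3 : `|lam| * (L * (X * u)) <= e / 2.
      have -> : `|lam| * (L * (X * u)) = `|lam| * L * X * u by ring.
      rewrite (@le_trans _ _ ((`|lam| * L * X + 1) * tau2))//.
        by rewrite ler_pM ?(ltW u0)// ?lerDl// (le_trans (ltW ut)).
      by rewrite /tau2 mulrC divfK// gt_eqF// ltr_wpDl.
    have h4 := ler_wpM2l (normr_ge0 lam) h2.
    by rewrite divfK ?gt_eqF// in h1; lra.
  have key (b : bool) : (-1) ^+ b * y t 0 j <= (-1) ^+ b * y0 0 j + e.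
    apply: (@barrier_le _ (fun u => (-1) ^+ b * y u 0 j)
      (fun u => (-1) ^+ b * (k u * f (x u) 0 j - l u * y u 0 j)) _ s t st).
    + by apply: within_continuousM => //; exact: within_continuous_cst.
    + move=> u su; have ? := dy u j su.
      by apply: is_derive_eq; rewrite /GRing.scale/=; ring.
    + move=> u su yu.
      have u0 : 0 < u by case/andP: su => su _; exact: lt_trans su.
      have [k0 l0] := kl u u0.
      have h1 : (-1) ^+ b * (k u * f (x u) 0 j - l u * y0 0 j) <= l u * e.
        by rewrite (le_trans (ler_norm _))// normrMsign close.
      have h2 := ler_wpM2l (ltW l0) (ltW yu).
      by lra.
    + by rewrite ys lerDl ltW.
  by rewrite ler_norml; have := key false; have := key true; rewrite expr0 expr1; lra.
Qed.

Section start.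
Context {R : realType} {d : nat}.
Variables (F : 'rV[R]_d -> R) (S : 'rV[R]_d -> 'rV[R]_d) (eps : R).
Variables (h r p q : R -> R).
Hypothesis gradF_lip : locally_lipschitz (gradient F).
Hypothesis S_lip : locally_lipschitz S.
Hypothesis eps_gt0 : 0 < eps.
Hypothesis coef_ge0 : forall t : R, 0 < t -> [/\ 0 <= h t, 0 <= r t, 0 <= p t & 0 <= q t].
Hypothesis rq_gt0 : forall t : R, 0 < t -> 0 < r t /\ 0 < q t.
Variable C : R.
Hypothesis C0 : 0 <= C.
Hypothesis ratio : forall t : R, 0 < t -> h t <= C * r t /\ p t <= C * q t.

Let sol := solution F S eps h r p q.

(** A bootstrap on [|x - x0| <= 1]: as long as it holds the forcing terms are bounded, comparison
    bounds [v] and [m] by [Mm], and [x] moves at speed at most [X]. Every constant is chosen before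
    [s], which is what allows [s] to tend to 0. *)
Lemma early_bound (z0 : state R d) : exists rho X M : R, [/\ 0 < rho, 0 <= X, 0 <= M &
  forall (s t : R) z, 0 < s -> s <= t -> t <= rho -> sol s z -> z s = z0 ->
    [/\ `|(z t).2 - z0.2| <= X * t, `|(z t).2| <= `|z0| + 1 & `|z t| <= M]].
Proof.
pose B := `|z0| + 1.
have B0 : 0 < B by rewrite ltr_wpDl.
have [A1 A10 HA1] := lipschitz_ball_bounded B0 gradF_lip.
have [A2 A20 HA2] := lipschitz_ball_bounded B0 S_lip.
pose Mm := `|z0| + C * (A1 + A2).
have Mm0 : 0 <= Mm by rewrite addr_ge0// mulr_ge0// addr_ge0.
have se0 : 0 < Num.sqrt eps by rewrite sqrtr_gt0.
pose X := Mm / Num.sqrt eps.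
have X0 : 0 <= X by rewrite divr_ge0// ltW.
have X1 : 0 < X + 1 by rewrite ltr_wpDl.
(* Up to time [(X + 1)^-1] the product [X * u] stays below 1, which closes the bootstrap. *)
exists (X + 1)^-1, X, (Mm + B); split => //; first by rewrite invr_gt0.
  by rewrite addr_ge0// ltW.
move=> s t z s0 st trho sz zs; have [cz zp oz] := sz.
have Xt u : s <= u <= t -> X * u < 1.
  move=> /andP[su ut].
  have u0 : 0 < u by exact: lt_le_trans su.
  have : (X + 1) * u <= 1.
    by rewrite -ler_pdivlMl// mulr1 (le_trans ut).
  by lra.
have bound u : s <= u <= t -> (forall w, s <= w <= u -> `|(z w).2 - z0.2| <= 1) ->
    (forall w i, s <= w <= u -> `|(z w).1.1 0 i| <= Mm /\ `|(z w).1.2 0 i| <= Mm) /\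
    `|(z u).2 - z0.2| <= X * (u - s).
  move=> /andP[su ut] Hx.
  have xB w : s <= w <= u -> `|(z w).2| <= B.
    move=> sw; have := ler_distD z0.2 (z w).2 0; rewrite !subr0.
    by have := Hx w sw; have := state_norm_x z0; rewrite /B; lra.
  have vm w i : s <= w <= u -> `|(z w).1.1 0 i| <= Mm /\ `|(z w).1.2 0 i| <= Mm.
    move=> /andP[sw wu].
    have [cv cm _] := within_continuous_coord i (solution_continuous (t := w) sz (lexx s)).
    have coef v : s < v < w -> [/\ 0 <= h v, 0 <= r v & h v <= C * r v] /\
        [/\ 0 <= p v, 0 <= q v & p v <= C * q v].
      move=> /andP[sv _]; have v0 := lt_trans s0 sv.
      by have [? ? ? ?] := coef_ge0 v0; have [? ?] := ratio v0.
    have xBv v : s < v < w -> `|(z v).2| <= B.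
      by move=> /andP[/ltW sv /ltW vw]; apply: xB; rewrite sv (le_trans vw).
    split.
    - apply: (@le_trans _ _ (`|z0| + C * A2)).
        apply: (@linear_comparison _ (fun v => (z v).1.1 0 i) p q
           (fun v => S (z v).2 0 i) s w) => //.
        + by move=> v /andP[sv _]; have [] := oz v sv i.
        + by move=> v /coef[].
        + by move=> v /xBv vB; rewrite (le_trans (le_mx_norm _ _ _))// HA2.
        + by rewrite zs; have [] := le_state_norm z0 i.
      by rewrite /Mm mulrDr lerD2l lerDr mulr_ge0.
    - apply: (@le_trans _ _ (`|z0| + C * A1)).
        apply: (@linear_comparison _ (fun v => (z v).1.2 0 i) h r
           (fun v => gradient F (z v).2 0 i) s w) => //.
        + by move=> v /andP[sv _]; have [] := oz v sv i.
        + by move=> v /coef[].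
        + by move=> v /xBv vB; rewrite (le_trans (le_mx_norm _ _ _))// HA1.
        + by rewrite zs; have [] := le_state_norm z0 i.
      by rewrite /Mm mulrDr lerD2l lerDl mulr_ge0.
  split=> //; apply: mx_norm_le; first by rewrite mulr_ge0// subr_ge0.
  move=> i j; rewrite (ord1 i) !mxE -zs.
  apply: (x_displacement eps_gt0 sz (lexx s) su) => w sw.
  by have [] := vm w j sw.
have small u : s <= u <= t -> `|(z u).2 - z0.2| < 1.
  move=> sut; have stt : s <= u <= t by [].
  have cx : {within `[s, t], continuous (fun u => `|(z u).2 - z0.2|)}.
    have cst := solution_continuous (t := t) sz (lexx s).
    apply/within_continuousP => w wt e e0.
    have [d1 d10 H] := (within_continuousP _ _).1 cst w wt e e0.
    exists d1 => // w' w't ww'; rewrite (le_lt_trans (ler_dist_dist _ _))//.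
    rewrite opprB addrA subrK (le_lt_trans _ (H w' w't ww'))//.
    exact: (state_norm_x (z w' - z w)).
  apply: (continuation cx) stt => [|w sw Hw].
    by rewrite zs subrr normr0.
  have [_ +] := bound w sw Hw; move=> /le_lt_trans; apply.
  have := Xt w sw; have : 0 <= X * s by rewrite mulr_ge0// ltW.
  by lra.
have stt : s <= t <= t by rewrite st lexx.
have [vm xX] := bound t stt (fun w sw => ltW (small w sw)).
have xB : `|(z t).2| <= B.
  have := ler_distD z0.2 (z t).2 0; rewrite !subr0.
  by have := small t stt; have := state_norm_x z0; rewrite /B; lra.
split => //.
  by rewrite (le_trans xX)// ler_wpM2l// lerBlDr lerDl ltW.
apply/state_norm_leP; first by rewrite addr_ge0// ltW.
move=> i; have [h1 h2] := vm t i stt; have h3 := le_mx_norm (z t).2 0 i.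
by clear -h1 h2 h3 xB Mm0 B0; split; lra.
Qed.

(** [m] and [v] obey the same kind of linear equation, with data [h], [r], [gradient F] and [p],
    [q], [S] respectively, while [x] has bounded speed. *)
Lemma early_close (z0 : state R d) (e : R) :
  compatible_at0 h r (gradient F) z0.2 z0.1.2 -> compatible_at0 p q S z0.2 z0.1.1 ->
  0 < e -> exists2 tau : R, 0 < tau & forall (s t : R) z, 0 < s -> s <= t -> t <= tau ->
    sol s z -> z s = z0 -> `|z t - z0| <= e.
Proof.
move=> cm cv e0.
have [rho [X [M [rho0 X0 M0 H]]]] := early_bound z0.
have hr u : 0 < u -> 0 <= h u /\ 0 < r u.
  by move=> u0; have [] := coef_ge0 u0; have [] := rq_gt0 u0.
have pq u : 0 < u -> 0 <= p u /\ 0 < q u.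
  by move=> u0; have [] := coef_ge0 u0; have [] := rq_gt0 u0.
have x0B : `|z0.2| <= `|z0| + 1 by rewrite (le_trans (state_norm_x _))// lerDl.
have [tau1 tau10 H1] := compatible_at0_close gradF_lip hr X0 M0 x0B cm e0.
have [tau2 tau20 H2] := compatible_at0_close S_lip pq X0 M0 x0B cv e0.
have X1 : 0 < X + 1 by rewrite ltr_wpDl.
exists (Num.min (Num.min rho (e / (X + 1))) (Num.min tau1 tau2)).
  by rewrite !lt_min rho0 tau10 tau20 divr_gt0.
move=> s t z s0 st; rewrite !le_min => /andP[/andP[trho tX] /andP[t1 t2]] sz zs.
have [_ _ oz] := sz.
have Hu u : s <= u <= t -> [/\ `|(z u).2 - z0.2| <= X * u, `|(z u).2| <= `|z0| + 1 & `|z u| <= M].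
  by move=> /andP[su ut]; apply: (H s) => //; exact: le_trans trho.
have t0 : 0 < t by exact: lt_le_trans st.
have zm : `|(z t).1.2 - z0.1.2| <= e.
  apply: (H1 s t (fun u => (z u).2) (fun u => (z u).1.2)) => //.
  - by move=> i; have [] := within_continuous_coord i (solution_continuous (t := t) sz (lexx s)).
  - by move=> u i /andP[su _]; have [] := oz u su i.
  - move=> u /Hu[xX xB zM]; split => //.
    apply: mx_norm_le => // i j; rewrite (ord1 i).
    by have [_ /le_trans + _] := le_state_norm (z u) j; apply.
  - by rewrite zs.
have zv : `|(z t).1.1 - z0.1.1| <= e.
  apply: (H2 s t (fun u => (z u).2) (fun u => (z u).1.1)) => //.
  - by move=> i; have [] := within_continuous_coord i (solution_continuous (t := t) sz (lexx s)).
  - by move=> u i /andP[su _]; have [] := oz u su i.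
  - move=> u /Hu[xX xB zM]; split => //.
    apply: mx_norm_le => // i j; rewrite (ord1 i).
    by have [/le_trans + _ _] := le_state_norm (z u) j; apply.
  - by rewrite zs.
have zx : `|(z t).2 - z0.2| <= e.
  have [|xX _ _] := Hu t; first by rewrite st lexx.
  rewrite (le_trans xX)// (@le_trans _ _ ((X + 1) * t))//; last by rewrite -ler_pdivlMl// mulrC.
  by rewrite ler_wpM2r ?lerDl// ltW.
apply/state_norm_leP; first exact: ltW.
by move=> i; split; apply: le_trans (le_mx_norm _ 0 i) _.
Qed.

End start.

Lemma ode_at_near {R : realType} {d : nat} (F : 'rV[R]_d -> R)
    (S : 'rV[R]_d -> 'rV[R]_d) (eps : R) (h r p q : R -> R) (z z' : R -> state R d)
    (t : R) : (\forall s \near t, z s = z' s) ->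
  ode_at F S eps h r p q z t -> ode_at F S eps h r p q z' t.
Proof.
move=> zz' oz i; have zt : z t = z' t by exact: nbhs_singleton zz'.
have [D1 D2 D3] := oz i; rewrite -zt; split.
- by apply: near_eq_is_derive D1; apply: filterS zz' => s ->.
- by apply: near_eq_is_derive D2; apply: filterS zz' => s ->.
- by apply: near_eq_is_derive D3; apply: filterS zz' => s ->.
Qed.

Lemma cauchy_state_cvg {R : realType} {d : nat} (u : nat -> state R d) :
  (forall e : R, 0 < e ->
    exists N, forall i j, (N <= i)%N -> (N <= j)%N -> `|u i - u j| < e) ->
  exists l : state R d, forall e : R, 0 < e ->
    exists N, forall i, (N <= i)%N -> `|u i - l| <= e.
Proof.
move=> H.
have Hf (f : state R d -> 'rV[R]_d) : (forall a b, `|f a - f b| <= `|a - b|) ->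
    exists l : 'rV[R]_d, (fun k => f (u k)) @ \oo --> l.
  move=> fl; apply: cauchy_seq_cvg => e /H[N HN]; exists N => i j Ni Nj.
  exact: le_lt_trans (fl _ _) (HN i j Ni Nj).
have [v vl] : exists l : 'rV[R]_d, (fun k => (u k).1.1) @ \oo --> l.
  apply: (Hf (fun z => z.1.1)) => a b; apply: mx_norm_le => // i j; rewrite (ord1 i).
  by have [] := le_state_norm (a - b) j.
have [m ml] : exists l : 'rV[R]_d, (fun k => (u k).1.2) @ \oo --> l.
  apply: (Hf (fun z => z.1.2)) => a b; apply: mx_norm_le => // i j; rewrite (ord1 i).
  by have [] := le_state_norm (a - b) j.
have [x xl] : exists l : 'rV[R]_d, (fun k => (u k).2) @ \oo --> l.
  by apply: (Hf (fun z => z.2)) => a b; exact: (state_norm_x (a - b)).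
exists (v, m, x) => e e0.
have [N1 _ H1] := (cvgrPdist_le _ _).1 vl e e0.
have [N2 _ H2] := (cvgrPdist_le _ _).1 ml e e0.
have [N3 _ H3] := (cvgrPdist_le _ _).1 xl e e0.
exists (maxn N1 (maxn N2 N3)) => i; rewrite !geq_max => /and3P[i1 i2 i3].
apply/state_norm_leP; first exact: ltW.
move=> j; have := H1 i i1; have := H2 i i2; have := H3 i i3 => /= h3 h2 h1.
by rewrite distrC in h1; rewrite distrC in h2; rewrite distrC in h3; split;
  [apply: le_trans h1|apply: le_trans h2|apply: le_trans h3];
  apply: le_trans (le_mx_norm _ 0 j); rewrite !mxE.
Qed.

Section singular.
Context {R : realType} {d : nat}.
Variables (F : 'rV[R]_d -> R) (S : 'rV[R]_d -> 'rV[R]_d) (eps : R).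
Variables (h r p q : R -> R).
Hypothesis gradF_lip : locally_lipschitz (gradient F).
Hypothesis S_lip : locally_lipschitz S.
Hypothesis eps_gt0 : 0 < eps.
Hypothesis coef_ge0 : forall t : R, 0 < t -> [/\ 0 <= h t, 0 <= r t, 0 <= p t & 0 <= q t].
Hypothesis rq_gt0 : forall t : R, 0 < t -> 0 < r t /\ 0 < q t.
Variable C : R.
Hypothesis C0 : 0 <= C.
Hypothesis ratio : forall t : R, 0 < t -> h t <= C * r t /\ p t <= C * q t.

Let sol := solution F S eps h r p q.

Hypothesis existence : forall (a : R) z0, 0 < a -> Zplus z0 ->
  exists2 z, sol a z & z a = z0.
Hypothesis bounded : forall (a : R) z, 0 < a -> sol a z ->
  exists2 M : R, 0 < M & forall t, a <= t -> `|z t| <= M.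

Let coef (s t : R) : 0 <= s -> forall u, s < u <= t ->
  [/\ 0 <= h u, 0 <= r u & h u <= C * r u] /\ [/\ 0 <= p u, 0 <= q u & p u <= C * q u].
Proof.
move=> s0 u /andP[su _]; have u0 := le_lt_trans s0 su.
by have [? ? ? ?] := coef_ge0 u0; have [? ?] := ratio u0.
Qed.

(* The solutions issued from [z0] at small positive times form a Cauchy family;
   on [a, +oo[ with a > 0 their limit is the solution issued from its value at a,
   by stability away from the singularity. *)
Lemma solution_from0 (z0 : state R d) : Zplus z0 ->
  compatible_at0 h r (gradient F) z0.2 z0.1.2 -> compatible_at0 p q S z0.2 z0.1.1 ->
  exists2 z, sol 0 z & z 0 = z0.
Proof.
move=> z0p cm cv.
have [rho [X [M [rho0 X0 M0 HB]]]] :=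
  early_bound gradF_lip S_lip eps_gt0 coef_ge0 C0 ratio z0.
have Hclose := early_close gradF_lip S_lip eps_gt0 coef_ge0 rq_gt0 C0 ratio cm cv.
have [zs Hzs] : exists zs : R -> R -> state R d,
    forall s, 0 < s -> sol s (zs s) /\ zs s s = z0.
  have /choice[f Hf] : forall s : R, exists z, 0 < s -> sol s z /\ z s = z0.
    move=> s; have [s0|s0] := pselect (0 < s); last by exists (fun=> z0).
    by have [z sz zsz] := existence s0 z0p; exists z.
  by exists f.
pose sq (n : nat) : R := rho / 2 ^+ n.
have sq0 n : 0 < sq n by rewrite divr_gt0// exprn_gt0.
have sq_small (e : R) : 0 < e -> exists N, forall n, (N <= n)%N -> sq n <= e.
  move=> e0; have [N HN] := half_pow_lt (ltW rho0) e0.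
  exists N => n Nn; rewrite (le_trans _ (ltW HN))// ler_wpM2l// ?(ltW rho0)//.
  by rewrite lef_pV2 ?posrE ?exprn_gt0// ler_eXn2l// ltr1n.
have [K K0 HK] := long_time_stability h r p q gradF_lip S_lip eps_gt0 M rho C0.
have zsB s t : 0 < s -> s <= t -> t <= rho -> `|zs s t| <= M.
  by move=> s0 st tr; have [sz szz] := Hzs s s0; have [] := HB s t (zs s) s0 st tr sz szz.
(* For [sq i <= sq j] the comparison starts at time [sq j]: one solution equals [z0] there, the
   other has had little time to leave it. *)
have cauchy_zs t : 0 < t <= rho -> forall e : R, 0 < e ->
    exists N, forall i j, (N <= i)%N -> (N <= j)%N -> `|zs (sq i) t - zs (sq j) t| < e.
  move=> /andP[t0 tr] e e0.
  have eK : 0 < e / 2 / K by rewrite !divr_gt0.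
  have [tau tau0 Htau] := Hclose _ eK.
  have [|N HN] := sq_small (Num.min t tau); first by rewrite lt_min t0.
  exists N.
  suff wlog_ij i j : (N <= i)%N -> (N <= j)%N -> sq i <= sq j ->
      `|zs (sq i) t - zs (sq j) t| < e.
    move=> i j Ni Nj; have [ij|/ltW ij] := leP (sq i) (sq j); first exact: wlog_ij.
    by rewrite distrC; exact: wlog_ij.
  move=> Ni Nj ij.
  have [/= sit sitau] : sq i <= t /\ sq i <= tau.
    by have := HN i Ni; rewrite le_min => /andP.
  have [/= sjt sjtau] : sq j <= t /\ sq j <= tau.
    by have := HN j Nj; rewrite le_min => /andP.
  have [si zi] := Hzs (sq i) (sq0 i); have [sj zj] := Hzs (sq j) (sq0 j).
  have jt : sq j <= t <= t by rewrite sjt lexx.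
  have trho : t <= sq j + rho by rewrite (le_trans tr)// lerDr ltW.
  have := HK (sq j) t (zs (sq i)) (zs (sq j)) sjt trho (coef (ltW (sq0 j)))
    (solutionW ij si) sj _ t jt.
  rewrite zj => /(_ _)/le_lt_trans; apply.
    move=> u /andP[ju ut]; have ur := le_trans ut tr.
    by split; apply: zsB => //; exact: le_trans ij ju.
  have := Htau (sq i) (sq j) _ (sq0 i) ij sjtau si zi.
  by rewrite ler_pdivlMr// mulrC => h1; rewrite (le_lt_trans h1)//; lra.
have /choice[zeta Hzeta] : forall t : R, exists l : state R d, 0 < t <= rho ->
    forall e : R, 0 < e -> exists N, forall i, (N <= i)%N -> `|zs (sq i) t - l| <= e.
  move=> t; have [tr|tr] := pselect (is_true (0 < t <= rho)); last by exists z0 => /tr.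
  by have [l Hl] := cauchy_state_cvg (cauchy_zs t tr); exists l.
have zeta_p t : 0 < t <= rho -> Zplus (zeta t).
  move=> tr i; have /andP[t0 _] := tr; rewrite leNgt; apply/negP => zn.
  have e0 : 0 < - (zeta t).1.1 0 i / 2 by rewrite divr_gt0// oppr_gt0.
  have [N1 H1] := Hzeta t tr _ e0; have [N2 H2] := sq_small t t0.
  pose n := maxn N1 N2.
  have h1 := H1 n (leq_maxl _ _); have h2 := H2 n (leq_maxr _ _).
  have [[_ zp _] _] := Hzs (sq n) (sq0 n).
  have h3 := zp t h2 i.
  have [h4 _ _] := le_state_norm (zs (sq n) t - zeta t) i.
  rewrite !mxE in h4; have h5 := ler_norm ((zs (sq n) t).1.1 0 i - (zeta t).1.1 0 i).
  by lra.
(* The gap between [y] and the approximations tends to 0 at time [a], and stability on [[a, rho]]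
   carries this to every later [t]. *)
have zeta_sol a y : 0 < a <= rho -> sol a y -> y a = zeta a ->
    forall t, a <= t <= rho -> y t = zeta t.
  move=> ar sy ya t /andP[at_ tr]; have /andP[a0 _] := ar.
  have [M' M'0 HM'] := bounded a0 sy.
  have [K' K'0 HK'] :=
    long_time_stability h r p q gradF_lip S_lip eps_gt0 (Num.max M M') rho C0.
  apply/eqP; rewrite -subr_eq0 -normr_le0; apply/ler_addgt0Pr => e e0; rewrite add0r.
  have e20 : 0 < e / 2 by rewrite divr_gt0.
  have eK0 : 0 < e / 2 / K' by rewrite divr_gt0.
  have [N1 H1] := Hzeta t (andb_true_intro (conj (lt_le_trans a0 at_) tr)) _ e20.
  have [N2 H2] := Hzeta a ar _ eK0.
  have [N3 H3] := sq_small a a0.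
  pose n := maxn N1 (maxn N2 N3).
  have h1 := H1 n (leq_maxl _ _).
  have h2 := H2 n (leq_trans (leq_maxl _ _) (leq_maxr _ _)).
  have h3 := H3 n (leq_trans (leq_maxr _ _) (leq_maxr _ _)).
  have [sn _] := Hzs (sq n) (sq0 n).
  have att : a <= t <= t by rewrite at_ lexx.
  have trho : t <= a + rho by rewrite (le_trans tr)// lerDr ltW.
  have h4 : `|y t - zs (sq n) t| <= K' * `|y a - zs (sq n) a|.
    apply: (HK' a t) => //; [exact: coef (ltW a0)|exact: solutionW h3 sn|].
    move=> u /andP[au ut]; rewrite !le_max HM'// orbT; split => //.
    by rewrite zsB// ?(le_trans h3)// (le_trans ut).
  have h5 : K' * `|y a - zs (sq n) a| <= e / 2.
    by rewrite -ler_pdivlMl// mulrC ya distrC.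
  rewrite (le_trans (ler_distD (zs (sq n) t) _ _))// [leRHS]splitr.
  by apply: lerD; [exact: le_trans h4 h5|exact: h1].
have /choice[y Hy] : forall a : R, exists z, 0 < a <= rho -> sol a z /\ z a = zeta a.
  move=> a; have [ar|ar] := pselect (is_true (0 < a <= rho)); last by exists (fun=> z0) => /ar.
  by have /andP[a0 _] := ar; have [z sz za] := existence a0 (zeta_p a ar); exists z.
(* On []0, rho]] this is the limit [zeta], beyond [rho] the solution issued from [zeta rho]. By [Zy]
   it coincides on each [[a, +oo[] with the single solution [y a], which gives the equations. *)
pose Z t := if t <= 0 then z0 else y (Num.min t rho) t.
have rr : 0 < rho <= rho by rewrite rho0 lexx.
have Zy a t : 0 < a <= rho -> a <= t -> Z t = y a t.
  move=> ar at_; have /andP[a0 a_rho] := ar; have [sa ya] := Hy a ar.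
  have t0 : 0 < t by exact: lt_le_trans at_.
  rewrite /Z leNgt t0/=; have [tr|/ltW rt] := leP t rho.
    have ttr : 0 < t <= rho by rewrite t0.
    have [_ ->] := Hy t ttr.
    by rewrite (zeta_sol a (y a) ar sa ya t)// at_.
  have [sr yr] := Hy rho rr.
  apply: (@solution_unique _ _ F S eps h r p q gradF_lip S_lip eps_gt0 coef_ge0 rho C t
    (y rho) (y a) (ltW rho0) C0 _ sr (solutionW a_rho sa)).
  - by move=> u /andP[ru _]; apply: ratio; exact: lt_trans ru.
  - by rewrite yr (zeta_sol a (y a) ar sa ya rho)// a_rho lexx.
  - by rewrite rt lexx.
have Z0 : Z 0 = z0 by rewrite /Z lexx.
have half t : 0 < t -> 0 < Num.min t rho / 2 <= rho /\ Num.min t rho / 2 < t.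
  move=> t0; have m0 : 0 < Num.min t rho by rewrite lt_min t0.
  have m1 : Num.min t rho <= t by rewrite ge_min lexx.
  have m2 : Num.min t rho <= rho by rewrite ge_min lexx orbT.
  by split; [apply/andP; split|]; lra.
(* Continuity at 0: closeness to [z0], uniform in the starting time, survives the limit. *)
have Zclose (e : R) : 0 < e ->
    exists2 tau : R, 0 < tau & forall t, 0 < t <= tau -> `|Z t - z0| <= e.
  move=> e0; have e20 : 0 < e / 2 by rewrite divr_gt0.
  have [tau tau0 Htau] := Hclose _ e20.
  exists (Num.min tau rho); first by rewrite lt_min tau0.
  move=> t /andP[t0]; rewrite le_min => /andP[ttau tr].
  have ttr : 0 < t <= rho by rewrite t0.
  rewrite (Zy t t ttr (lexx t)); have [_ ->] := Hy t ttr.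
  have [N1 H1] := Hzeta t ttr _ e20; have [N2 H2] := sq_small t t0.
  pose n := maxn N1 N2.
  have h1 := H1 n (leq_maxl _ _); have h2 := H2 n (leq_maxr _ _).
  have [sn zn] := Hzs (sq n) (sq0 n).
  have h3 := Htau (sq n) t (zs (sq n)) (sq0 n) h2 ttau sn zn.
  rewrite distrC in h1; rewrite (le_trans (ler_distD (zs (sq n) t) _ _))//.
  by lra.
exists Z => //; split.
- apply/within_continuousP => t; rewrite /= in_itv/= andbT le_eqVlt => /predU1P[<-|t0] e e0.
    have [tau tau0 Ht] := Zclose (e / 2) (divr_gt0 e0 (ltr0n _ 2)).
    exists tau => // u; rewrite in_itv/= andbT le_eqVlt => /predU1P[<- _|u0].
      by rewrite subrr normr0.
    rewrite subr0 gtr0_norm// => /ltW ut; rewrite Z0.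
    by rewrite (le_lt_trans (Ht u _)) ?u0//; lra.
  have [ar at_] := half t t0; set a := _ / 2 in ar at_.
  have [[cy _ _] _] := Hy a ar.
  have ta : `[a, +oo[%classic t by rewrite /= in_itv/= andbT ltW.
  have [d1 d10 H1] := (within_continuousP _ _).1 cy t ta e e0.
  exists (Num.min d1 (t - a)); first by rewrite lt_min d10 subr_gt0.
  move=> u _; rewrite lt_min => /andP[ud uta].
  have au : a <= u by move: uta; rewrite ltr_norml; lra.
  by rewrite !(Zy a)// ?(ltW at_)//; apply: H1 => //; rewrite /= in_itv/= andbT.
- move=> t; rewrite le_eqVlt => /predU1P[<-|t0]; first by rewrite Z0.
  have [ar at_] := half t t0; rewrite (Zy _ _ ar (ltW at_)).
  by have [[_ yp _] _] := Hy _ ar; apply: yp; exact: ltW.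
- move=> t t0; have [ar at_] := half t t0; set a := _ / 2 in ar at_.
  have [[_ _ oy] _] := Hy a ar.
  apply: ode_at_near (oy t at_).
  near=> s; rewrite (Zy a)//.
  by near: s; apply: filterS (lt_nbhsr at_) => s /ltW.
Unshelve. all: by end_near. Qed.

End singular.

(** The extension [g] is differentiable, hence continuous, at 0 relatively to [I], and agrees with
    [f] at positive times: the limit is [g 0]. *)
Lemma extends_C1_nneg_cvg {R : realType} (I : set R) (f : R -> R) :
  I 0 -> (\forall u \near 0^'+, I u) -> extends_C1_nneg I f ->
  exists l : R, f u @[u --> 0^'+] --> l.
Proof.
move=> I0 nI [g [dg [gf _ Dg _]]]; exists (g 0).
have gc := has_derivative_in_continuous (Dg 0 I0).
apply/cvgrPdist_lt => e e0.
have /nbhs_ballP[dl /= dl0 H] : nbhs (0 : R) [set s | I s -> `|g 0 - g s| < e].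
  by move/cvgrPdist_lt : gc; apply.
near=> u.
have u0 : 0 < u by near: u; exact: nbhs_right_gt.
have Iu : I u by near: u.
rewrite -gf//; apply: H => //; rewrite /ball/= sub0r normrN gtr0_norm//.
Unshelve. all: by end_near. Qed.

Lemma cvg_near_bounded {R : realType} (f : R -> R) (l : R) :
  f u @[u --> 0^'+] --> l -> \forall u \near 0^'+, f u <= `|l| + 1.
Proof.
move=> /cvgrPdist_lt/(_ 1 ltr01); apply: filterS => u.
by rewrite ltr_norml; have := ler_norm l; lra.
Qed.

Theorem theorem2p1 (R : realType) (d : nat) (d_ge1 : (1 <= d)%N)
  (F : 'rV[R]_d -> R) (F_C1 : C1_function F)
  (gradF_lip : locally_lipschitz (gradient F))
  (F_coercive : coercive_function F)
  (S : 'rV[R]_d -> 'rV[R]_d) (S_ge0 : forall x i, 0 <= S x 0 i)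
  (S_lip : locally_lipschitz S)
  (eps : R) (eps_gt0 : 0 < eps)
  (h r p q : R -> R)
  (hrpq_ge0 : forall t : R, 0 < t -> [/\ 0 <= h t, 0 <= r t, 0 <= p t & 0 <= q t])
  (hrpq_cont : forall t : R, 0 < t ->
    [/\ {for t, continuous h}, {for t, continuous r},
        {for t, continuous p} & {for t, continuous q}])
  (h_C1 : forall t : R, 0 < t -> derivable h t 1 /\ {for t, continuous (derive1 h)})
  (h_noninc : forall t : R, 0 < t -> derive1 h t <= 0)
  (hinf : R) (h_cvg : h t @[t --> +oo] --> hinf) (hinf_gt0 : 0 < hinf)
  (r_noninc : forall s t : R, 0 < s -> s <= t -> r t <= r s)
  (q_noninc : forall s t : R, 0 < s -> s <= t -> q t <= q s)
  (rinf : R) (r_cvg : r t @[t --> +oo] --> rinf) (rinf_gt0 : 0 < rinf)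
  (qinf : R) (q_cvg : q t @[t --> +oo] --> qinf) (qinf_gt0 : 0 < qinf)
  (pinf : R) (p_cvg : p t @[t --> +oo] --> pinf)
  (r_ge_q4 : forall t : R, 0 < t -> q t / 4 <= r t) (rinf_gt_q4 : qinf / 4 < rinf)
  (z0 : state R d) (z0_Zplus : Zplus z0) (t0 : R) (t0_gt0 : 0 < t0) :
  well_posed_and_convergent F S eps h r p q pinf qinf t0 z0
  /\ (condition_A0 F S h r p q z0 ->
      well_posed_and_convergent F S eps h r p q pinf qinf 0 z0).
Proof.
have h_der t : 0 < t -> derivable h t 1 by move=> /h_C1[].
have h_ge := nonincreasing_cvg_ge (derive1_le0_nonincreasing h_der h_noninc) h_cvg.
have r_ge := nonincreasing_cvg_ge r_noninc r_cvg.
have q_ge := nonincreasing_cvg_ge q_noninc q_cvg.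
have bounded a z : 0 < a -> solution F S eps h r p q a z ->
    exists2 M : R, 0 < M & forall t, a <= t -> `|z t| <= M.
  exact: (solution_bounded F_C1 F_coercive S_ge0 S_lip eps_gt0 hrpq_ge0 hrpq_cont h_der
    h_noninc r_ge_q4 hinf_gt0 qinf_gt0 h_ge q_ge p_cvg).
have convergent a z : 0 < a -> solution F S eps h r p q a z ->
    set_dist (Upsilon F S pinf qinf) (z t) @[t --> +oo] --> 0%E.
  exact: (solution_cvg F_C1 gradF_lip F_coercive S_ge0 S_lip eps_gt0 hrpq_ge0 hrpq_cont
    h_der h_noninc r_ge_q4 hinf_gt0 qinf_gt0 h_ge q_ge h_cvg r_cvg p_cvg q_cvg rinf_gt_q4).
have existence (a : R) w : 0 < a -> Zplus w ->
    exists z, is_global_solution F S eps h r p q a w z.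
  exact: (global_existence F_C1 gradF_lip F_coercive S_ge0 S_lip eps_gt0 hrpq_ge0
    hrpq_cont h_der h_noninc r_ge_q4 hinf_gt0 qinf_gt0 h_ge q_ge h_cvg r_cvg p_cvg q_cvg).
(* Away from 0 the coefficients [h] and [p] are bounded, while [r] and [q] stay above their positive
   limits. *)
have ratio_away a : 0 < a -> exists2 C : R, 0 <= C &
    forall u, a <= u -> h u <= C * r u /\ p u <= C * q u.
  move=> a0.
  have [C HC] := coef_bounded hrpq_cont h_cvg r_cvg p_cvg q_cvg a0.
  have C0 : 0 <= C by have [+ _ _ _] := HC a (lexx a); exact: le_trans.
  exists (C / rinf + C / qinf); first by rewrite addr_ge0// divr_ge0// ltW.
  move=> u au; have u0 := lt_le_trans a0 au.
  have [hC _ pC _] := HC u au; have [h0 r0 p0 q0] := hrpq_ge0 u u0.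
  have Cr : C <= C / rinf * r u.
    by rewrite -mulrA ler_peMr// mulrC ler_pdivlMr// mul1r r_ge.
  have Cq : C <= C / qinf * q u.
    by rewrite -mulrA ler_peMr// mulrC ler_pdivlMr// mul1r q_ge.
  have := ler_norm (h u); have := ler_norm (p u).
  have : 0 <= C / qinf * r u by rewrite mulr_ge0// divr_ge0// ltW.
  have : 0 <= C / rinf * q u by rewrite mulr_ge0// divr_ge0// ltW.
  by rewrite !mulrDl; split; lra.
(* Common to both kinds of starting time: boundedness and convergence are read from a positive time
   [b], and continuity bounds the solution on [[a, b]]. *)
have well_posed (a C : R) z : 0 <= a -> 0 <= C ->
    (forall u, a < u -> h u <= C * r u /\ p u <= C * q u) ->
    is_global_solution F S eps h r p q a z0 z -> (exists2 b, a <= b & 0 < b) ->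
    well_posed_and_convergent F S eps h r p q pinf qinf a z0.
  move=> a0 C0 ratio zsol [b ab b0].
  have sz := global_solution_solution a0 zsol.
  have szb := solutionW ab sz.
  exists z; split => //.
  - move=> z' zsol' t at_; have sz' := global_solution_solution a0 zsol'.
    apply: (@solution_unique _ _ F S eps h r p q gradF_lip S_lip eps_gt0 hrpq_ge0 a C t
      z' z a0 C0 _ sz' sz).
    + by move=> u /andP[au _]; exact: ratio.
    + by case: zsol' => -> _ _ _; case: zsol => -> _ _ _.
    + by rewrite at_ lexx.
  - have [M1 M10 HM1] := bounded b z b0 szb.
    have [M2 HM2] := solution_bounded_segment b sz.
    exists (Num.max M1 M2); split; first exact: num_real.
    move=> M MM _ [t + <-]; rewrite /= in_itv/= andbT => at_.
    rewrite (le_trans _ (ltW MM))// le_max.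
    have [bt|/ltW tb] := leP b t; first by rewrite HM1.
    by rewrite HM2 ?orbT// at_.
  - exact: (convergent b z b0 szb).
split.
  have [z zsol] := existence t0 z0 t0_gt0 z0_Zplus.
  have [C C0 ratio] := ratio_away t0 t0_gt0.
  apply: (well_posed t0 C z (ltW t0_gt0) C0 _ zsol); last by exists t0.
  by move=> u /ltW; exact: ratio.
move=> A0.
suff [tau tau0 [C C0 [ratio0 cm cv]]] : exists2 tau : R, 0 < tau & exists2 C : R, 0 <= C &
    [/\ forall u, 0 < u <= tau -> h u <= C * r u /\ p u <= C * q u,
        compatible_at0 h r (gradient F) z0.2 z0.1.2 & compatible_at0 p q S z0.2 z0.1.1].
  have [C' C'0 ratio'] := ratio_away tau tau0.
  (* [C] serves up to [tau] and [C'] beyond; all quantities being nonnegative, the sum serves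
     everywhere. *)
  have ratio u : 0 < u -> h u <= (C + C') * r u /\ p u <= (C + C') * q u.
    move=> u0; have [h0 r0 p0 q0] := hrpq_ge0 u u0.
    have Cr : 0 <= C * r u by exact: mulr_ge0.
    have C'r : 0 <= C' * r u by exact: mulr_ge0.
    have Cq : 0 <= C * q u by exact: mulr_ge0.
    have C'q : 0 <= C' * q u by exact: mulr_ge0.
    rewrite !mulrDl; have [ut|/ltW tu] := leP u tau.
      by have [|? ?] := ratio0 u; [rewrite u0|split; lra].
    by have [? ?] := ratio' u tu; split; lra.
  have CC0 : 0 <= C + C' by exact: addr_ge0.
  have rq_gt0 t : 0 < t -> 0 < r t /\ 0 < q t.
    by move=> t1; split; [exact: lt_le_trans (r_ge t t1)|exact: lt_le_trans (q_ge t t1)].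
  have ex2 (a : R) w : 0 < a -> Zplus w ->
      exists2 z, solution F S eps h r p q a z & z a = w.
    move=> a0 wp; have [z zsol] := existence a w a0 wp; exists z.
      exact: global_solution_solution (ltW a0) zsol.
    by case: zsol.
  have [z sz zz0] := solution_from0 gradF_lip S_lip eps_gt0 hrpq_ge0 rq_gt0 CC0 ratio ex2
    bounded z0_Zplus cm cv.
  apply: (well_posed 0 (C + C') z (lexx _) CC0) => //; last by exists 1.
  (* From starting time 0 the equations are required at positive times only, all of them
     interior. *)
  have [cz zp _] := sz; split => // t _ t1.
  exact: solution_has_derivative_in sz t1.
(* If the coefficients extend to 0 they are bounded there, and the lower bounds [rinf] and [qinf]
   turn this into a bound on the ratios. *)
case: A0 => [[Eh Er Ep Eq]|[_ _ _ [delta delta0 [Ehr Epq]] z0E]].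
  have I0 : `[0, +oo[%classic (0 : R) by rewrite /= in_itv/= lexx.
  have nI : \forall u \near (0 : R)^'+, `[0, +oo[%classic u.
    by near=> u; rewrite /= in_itv/= andbT; near: u; exact: nbhs_right_ge.
  have [lh /cvg_near_bounded ch] := extends_C1_nneg_cvg I0 nI Eh.
  have [lr /cvg_near_bounded cr] := extends_C1_nneg_cvg I0 nI Er.
  have [lp /cvg_near_bounded cp] := extends_C1_nneg_cvg I0 nI Ep.
  have [lq /cvg_near_bounded cq] := extends_C1_nneg_cvg I0 nI Eq.
  have [tau tau0 Htau] := near_at_right0 (filterI ch cp).
  pose B := `|lh| + 1 + (`|lp| + 1).
  have B0 : 0 <= B by rewrite !addr_ge0.
  exists tau => //; exists (B / rinf + B / qinf); first by rewrite addr_ge0// divr_ge0// ltW.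
  split.
  - move=> u utau; have u0 : 0 < u by case/andP: utau.
    have [hB pB] := Htau u utau; have [h0 r0 p0 q0] := hrpq_ge0 u u0.
    have Br : B <= B / rinf * r u.
      by rewrite -mulrA ler_peMr// mulrC ler_pdivlMr// mul1r r_ge.
    have Bq : B <= B / qinf * q u.
      by rewrite -mulrA ler_peMr// mulrC ler_pdivlMr// mul1r q_ge.
    have : 0 <= B / qinf * r u by rewrite mulr_ge0// divr_ge0// ltW.
    have : 0 <= B / rinf * q u by rewrite mulr_ge0// divr_ge0// ltW.
    have := normr_ge0 lh; have := normr_ge0 lp.
    rewrite !mulrDl => n1 n2 n3 n4; clear -hB pB Br Bq n1 n2 n3 n4.
    by split; rewrite /B in Br Bq *; lra.
  - left; exists (`|lh| + 1 + (`|lr| + 1)); near=> u; split.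
      rewrite (@le_trans _ _ (`|lh| + 1))//; first by near: u.
      by rewrite lerDl addr_ge0.
    rewrite (@le_trans _ _ (`|lr| + 1))//; first by near: u.
    by rewrite lerDr addr_ge0.
  - left; exists (`|lp| + 1 + (`|lq| + 1)); near=> u; split.
      rewrite (@le_trans _ _ (`|lp| + 1))//; first by near: u.
      by rewrite lerDl addr_ge0.
    rewrite (@le_trans _ _ (`|lq| + 1))//; first by near: u.
    by rewrite lerDr addr_ge0.
(* In the other alternative the ratios themselves converge at 0, and the initial condition is the
   equilibrium built from their limits. *)
have I0 : `[0, delta[%classic (0 : R) by rewrite /= in_itv/= lexx.
have nI : \forall u \near (0 : R)^'+, `[0, delta[%classic u.
  near=> u; rewrite /= in_itv/=; apply/andP; split; near: u.
    exact: nbhs_right_ge.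
  exact: nbhs_right_lt.
have [lh chr] := extends_C1_nneg_cvg I0 nI Ehr.
have [lp cpq] := extends_C1_nneg_cvg I0 nI Epq.
have [tau tau0 Htau] := near_at_right0 (filterI (cvg_near_bounded chr) (cvg_near_bounded cpq)).
exists tau => //; exists (`|lh| + 1 + (`|lp| + 1)); first by rewrite !addr_ge0.
have [m0E v0E] : z0.1.2 = lh *: gradient F z0.2 /\ z0.1.1 = lp *: S z0.2.
  by move: z0E; case: (z0) => [[v0 m0] x0] /= [-> ->]; rewrite (cvg_lim _ chr)// (cvg_lim _ cpq).
split; last 2 first.
- by right; exists lh.
- by right; exists lp.
move=> u utau; have u0 : 0 < u by case/andP: utau.
have [hB pB] := Htau u utau.
have ru : 0 < r u by exact: lt_le_trans (r_ge u u0).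
have qu : 0 < q u by exact: lt_le_trans (q_ge u u0).
have := normr_ge0 lh; have := normr_ge0 lp => n1 n2.
by rewrite -!ler_pdivrMr//; clear -hB pB n1 n2; split; lra.
Unshelve. all: by end_near. Qed.
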